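(* Let $(M^n,g)$ be a complete noncompact $n$-dimensional Riemannian manifold, $u\in C^\infty(M)$, $V=e^u$, $\lambda,\mu\in\mathbb{R}$, $D=D^{\lambda,\mu}$, and $\tau=(n+1)\lambda+\mu$. Let $\delta$ be a positive function, and let $\rho$ and $a$ be nonnegative functions on $M$ such that $|\nabla^D\rho|=1$, $\Delta^D\rho\ge\frac{C}{\rho}V^{\lambda-\mu}$, $\langle\nabla^Da,\nabla^D\rho\rangle\ge0$ and $-V^\tau\,\mathrm{div}^D\left(a\rho^{1-C}\nabla^D\delta\right)\ge0$ in the sense of distributions, where $C>1$ is a constant, $C+\alpha-1>0$ and $\alpha\in\mathbb{R}$. Then for every $\phi\in C_0^\infty(M\setminus\rho^{-1}\{0\})$, $$\begin{aligned}\int_Ma\rho^\alpha|\nabla^D\phi|^2V^{\tau+\lambda-\mu}\,dv_g\ \ge\ &\left(\frac{C+\alpha-1}{2}\right)^2\int_Ma\rho^{\alpha-2}\phi^2V^{\tau+\lambda-\mu}\,dv_g\\&+\frac{C+\alpha-1}{2}\int_M\rho^{\alpha-1}\phi^2\langle\nabla^Da,\nabla^D\rho\rangle V^{\tau+\lambda-\mu}\,dv_g\\&+\frac14\int_Ma\rho^\alpha\frac{|\nabla^D\delta|^2}{\delta^2}\phi^2V^{\tau+\lambda-\mu}\,dv_g.\end{aligned}$$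
   Context: $\nabla$, $\Delta=\mathrm{div}\,\nabla$, $dv_g$ denote the Levi-Civita connection/gradient, Laplacian and Riemannian volume of $g$; $\langle\cdot,\cdot\rangle=g$ and $|\cdot|$ is the norm of $g$. The affine connection $D=D^{\lambda,\mu}$ is $D_XY=\nabla_XY+\lambda\,du(X)Y+\lambda\,du(Y)X+\mu\,g(X,Y)\nabla u$. The affine gradient of a function $f$ is $\nabla^Df=V^{\mu-\lambda}\nabla f$. The affine divergence of a vector field $W$ is $\mathrm{div}^DW=D_iW^i$, and it satisfies $V^\tau\mathrm{div}^DW=\mathrm{div}(V^\tau W)$. The affine Laplacian is $\Delta^Df=V^{\mu-\lambda}\left[\Delta f+(2\mu+n\lambda)\langle\nabla u,\nabla f\rangle\right]=\mathrm{div}^D(\nabla^Df)$. Distributional conditions: ''$|\nabla^D\rho|=1$ in the sense of distributions'' means that $\rho$ is locally Lipschitz and its (weak) gradient satisfies $|\nabla^D\rho|=1$ almost everywhere. ''$\Delta^D\rho\ge\frac{C}{\rho}V^{\lambda-\mu}$ in the sense of distributions'' means that $-\int_M\langle\nabla\psi,\nabla^D\rho\rangle V^\tau\,dv_g\ge\int_M\frac{C}{\rho}\psi V^{\tau+\lambda-\mu}\,dv_g$ for all nonnegative compactly supported Lipschitz $\psi$ with support in $M\setminus\rho^{-1}\{0\}$. The functions $a$ and $\delta$ are locally Lipschitz; $\langle\nabla^Da,\nabla^D\rho\rangle\ge0$ holds almost everywhere; and $-V^\tau\mathrm{div}^D(a\rho^{1-C}\nabla^D\delta)\ge0$ means $\int_Ma\rho^{1-C}\langle\nabla^D\delta,\nabla\psi\rangle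 V^\tau\,dv_g\ge0$ for all nonnegative compactly supported Lipschitz $\psi$ with support in $M\setminus\rho^{-1}\{0\}$. *)

(* Defs.v *)
From HB Require Import structures.
From mathcomp Require Import all_boot all_order all_algebra.
From mathcomp Require Import all_classical all_reals all_analysis.

Set Implicit Arguments.
Unset Strict Implicit.
Unset Printing Implicit Defensive.

Import Order.TTheory GRing.Theory Num.Theory.
Import numFieldNormedType.Exports.

Local Open Scope classical_set_scope.
Local Open Scope ring_scope.

Section tuple_measure.
Context d (T : measurableType d) {R : realType}.

Definition tuple_cons n (x : T * n.-tuple T) : n.+1.-tuple T :=
  [the n.+1.-tuple T of x.1 :: x.2].

Lemma measurable_tuple_cons n : measurable_fun setT (@tuple_cons n).
Proof. exact: measurable_cons. Qed.

Section step.
Variables (m1 : {sigma_finite_measure set T -> \bar R}) (n : nat)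
  (m : {sigma_finite_measure set (n.-tuple T) -> \bar R}).

Definition tuple_measure_step (A : set (n.+1.-tuple T)) : \bar R :=
  (m1 \x m)%E (@tuple_cons n @^-1` A).

Let step0 : tuple_measure_step set0 = 0%E.
Proof. by rewrite /tuple_measure_step preimage_set0 measure0. Qed.

Let step_ge0 A : (0 <= tuple_measure_step A)%E.
Proof. exact: measure_ge0. Qed.

Let mcons (A : set (n.+1.-tuple T)) :
  measurable A -> measurable (@tuple_cons n @^-1` A).
Proof.
by move=> mA; rewrite -[X in measurable X]setTI; exact: measurable_tuple_cons.
Qed.

Let step_sigma_additive : semi_sigma_additive tuple_measure_step.
Proof.
move=> F mF tF mUF; rewrite /tuple_measure_step preimage_bigcup.
apply: measure_semi_sigma_additive.
- by move=> k; exact: mcons.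
- apply/trivIsetP => /= i j _ _ ij; rewrite -preimage_setI.
  by move/trivIsetP : tF => /(_ _ _ _ _ ij) ->//; rewrite preimage_set0.
- by rewrite -preimage_bigcup; exact: mcons.
Qed.

HB.instance Definition _ := isMeasure.Build _ _ _ tuple_measure_step
  step0 step_ge0 step_sigma_additive.

Let step_sigma_finite : sigma_finite setT tuple_measure_step.
Proof.
have /sigma_finiteP[F [TF ndF Foo]] := sigma_finiteT m1.
have /sigma_finiteP[G [TG ndG Goo]] := sigma_finiteT m.
pose uncons (t : n.+1.-tuple T) := (thead t, [tuple of behead t]).
have muncons : measurable_fun setT uncons.
  apply/measurable_fun_pairP; split; first exact: measurable_tnth.
  exact: measurable_behead.
exists (fun k => uncons @^-1` (F k `*` G k)).
  apply/esym/seteqP; split=> // t _.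
  have [i _ Fi] : (\bigcup_i F i) (thead t) by rewrite -TF.
  have [j _ Gj] : (\bigcup_i G i) [tuple of behead t] by rewrite -TG.
  exists (maxn i j) => //; split => /=.
    by move: Fi; exact/subsetPset/ndF/leq_maxl.
  by move: Gj; exact/subsetPset/ndG/leq_maxr.
move=> k; have [mF Fk] := Foo k; have [mG Gk] := Goo k; split.
  by rewrite -[X in measurable X]setTI; apply: muncons => //; exact: measurableX.
rewrite /tuple_measure_step (_ : _ @^-1` _ = F k `*` G k).
  by rewrite product_measure1E// lte_mul_pinfty// ge0_fin_numE.
apply/funext => -[x t]; rewrite /preimage/uncons/tuple_cons /= theadE.
rewrite (_ : [tuple of _] = t)//; exact/val_inj.
Qed.

HB.instance Definition _ := Measure_isSigmaFinite.Build _ _ _ tuple_measure_step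
  step_sigma_finite.

End step.

(* The n-fold product of m1 with itself. *)
Fixpoint tuple_measure (m1 : {sigma_finite_measure set T -> \bar R}) n :
    {sigma_finite_measure set (n.-tuple T) -> \bar R} :=
  match n with
  | 0 => \d_ ([tuple] : 0.-tuple T)
  | k.+1 => tuple_measure_step m1 (tuple_measure m1 k)
  end.

End tuple_measure.

Definition lebesgue_tuple (R : realType) (n : nat) :=
  tuple_measure (@lebesgue_measure R) n.

Definition row_of_tuple (R : realType) (n : nat)
  (t : n.-tuple (measurableTypeR R)) : 'rV[R]_n := \row_i tnth t i.

Notation std_vec i := (delta_mx ord0 i).

Fixpoint Ck_on (R : realType) (U W : normedModType R) (k : nat) (O : set U)
    (f : U -> W) : Prop :=
  match k with
  | 0 => forall x, O x -> {for x, continuous f}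
  | k'.+1 => (forall x, O x -> differentiable f x) /\
             (forall v, Ck_on k' O ('D_v f))
  end.

(* Meant for open O. *)
Definition smooth_on (R : realType) (U W : normedModType R) (O : set U)
  (f : U -> W) : Prop := forall k, Ck_on k O f.

Definition support_of (R : realType) (T : topologicalType) (f : T -> R) :
  set T := closure [set x | f x != 0].

(* The maps are total functions whose values outside chart_dom, resp. chart_cod,
   are irrelevant. *)
Record chart (R : realType) (n : nat) (M : topologicalType) := Chart {
  chart_dom : set M;
  chart_cod : set 'rV[R]_n;
  chart_to : M -> 'rV[R]_n;
  chart_inv : 'rV[R]_n -> M;
  chart_dom_open : open chart_dom;
  chart_cod_open : open chart_cod;
  chart_to_cod : forall p, chart_dom p -> chart_cod (chart_to p);
  chart_inv_dom : forall x, chart_cod x -> chart_dom (chart_inv x);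
  chart_toK : forall p, chart_dom p -> chart_inv (chart_to p) = p;
  chart_invK : forall x, chart_cod x -> chart_to (chart_inv x) = x;
  chart_to_continuous :
    forall p, chart_dom p -> {for p, continuous chart_to};
  chart_inv_continuous :
    forall x, chart_cod x -> {for x, continuous chart_inv} }.

(* The atlas need not be maximal. chart_at is only a choice of a chart around each
   point, without any continuity or measurability in the point. *)
Record manifold (R : realType) (n : nat) := Manifold {
  point_space :> ptopologicalType;
  point_space_hausdorff : hausdorff_space point_space;
  point_space_second_countable : @second_countable point_space;
  point_space_connected : connected [set: point_space];
  atlas : set (chart R n point_space);
  chart_at : point_space -> chart R n point_space;
  chart_at_atlas : forall p, atlas (chart_at p);
  chart_at_dom : forall p, chart_dom (chart_at p) p;
  atlas_compatible : forall c c', atlas c -> atlas c' ->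
    smooth_on (chart_cod c `&` chart_inv c @^-1` chart_dom c')
      (chart_to c' \o chart_inv c) }.

Definition borel (R : realType) (n : nat) (M : manifold R n) :=
  g_sigma_algebraType (@open M).

(* A tangent vector at p is given by its coordinates in chart_at p. *)
Definition tangent (R : realType) (n : nat) (M : manifold R n) (p : M) :=
  'rV[R]_n.

Definition vector_field (R : realType) (n : nat) (M : manifold R n) :=
  forall p : M, tangent p.

Definition coord_vec (R : realType) (n : nat) (M : manifold R n)
    (c : chart R n M) (i : 'I_n) : vector_field M :=
  fun p => 'D_(std_vec i) (chart_to (chart_at p) \o chart_inv c) (chart_to c p).

Definition smooth (R : realType) (n : nat) (M : manifold R n) (f : M -> R) :=
  forall c, atlas c -> smooth_on (chart_cod c) (f \o chart_inv c : _ -> R^o).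

(* metric_at p is the Gram matrix in the coordinates of chart_at p. *)
Record riemannian_metric (R : realType) (n : nat) (M : manifold R n) :=
  RiemannianMetric {
  metric_at : M -> 'M[R]_n;
  metric_sym : forall p, (metric_at p)^T = metric_at p;
  metric_pos : forall p (v : 'rV[R]_n), v != 0 ->
    0 < (v *m metric_at p *m v^T) ord0 ord0;
  metric_smooth : forall c, atlas c -> forall i j,
    smooth_on (chart_cod c) (fun x => let p := chart_inv c x in
      (coord_vec c i p *m metric_at p *m (coord_vec c j p)^T) ord0 ord0 : R^o) }.

Section riemannian.
Context (R : realType) (n : nat) (M : manifold R n) (g : riemannian_metric M).

Definition inner (p : M) (v w : tangent p) : R :=
  (v *m metric_at g p *m w^T) ord0 ord0.

Definition rnorm (p : M) (v : tangent p) : R := Num.sqrt (inner v v).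

Definition gram (c : chart R n M) (p : M) : 'M[R]_n :=
  \matrix_(i, j) inner (coord_vec c i p) (coord_vec c j p).

Definition is_riemannian_volume
    (vol : {measure set (borel M) -> \bar R}) : Prop :=
  forall c, atlas c ->
  forall A : set (borel M), measurable A -> A `<=` chart_dom c ->
  vol A = (\int[lebesgue_tuple R n]_(t in
      [set t | chart_cod c (row_of_tuple t) /\ A (chart_inv c (row_of_tuple t))])
    (Num.sqrt (\det (gram c (chart_inv c (row_of_tuple t)))))%:E)%E.

Definition velocity (gamma : R -> M) (t : R) : tangent (gamma t) :=
  derive1 (chart_to (chart_at (gamma t)) \o gamma) t.

Definition C1_curve (gamma : R -> M) : Prop :=
  forall t, 0 <= t <= 1 -> {for t, continuous gamma} /\
  forall c, atlas c -> chart_dom c (gamma t) ->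
    (\forall s \near t, derivable (chart_to c \o gamma) s 1) /\
    {for t, continuous (derive1 (chart_to c \o gamma))}.

Definition curve_length (gamma : R -> M) : \bar R :=
  (\int[lebesgue_measure]_(t in `[0%R, 1%R]) (rnorm (velocity gamma t))%:E)%E.

(* A piecewise C^1 curve, each piece being parametrized by [0, 1]. *)
Fixpoint piecewise_curve (p q : M) (s : seq (R -> M)) : Prop :=
  match s with
  | [::] => p = q
  | gamma :: s' =>
      [/\ C1_curve gamma, gamma 0 = p & piecewise_curve (gamma 1) q s']
  end.

Definition rdist (p q : M) : \bar R :=
  ereal_inf [set (\sum_(gamma <- s) curve_length gamma)%E
            | s in [set s | piecewise_curve p q s]].

Definition riemannian_complete : Prop :=
  forall s : nat -> M,
  (forall e : R, 0 < e -> exists N : nat, forall i j : nat,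
     (N <= i)%N -> (N <= j)%N -> (rdist (s i) (s j) < e%:E)%E) ->
  exists p : M, s @ \oo --> p.

Definition rlipschitz_in (A : set M) (f : M -> R) : Prop :=
  exists K : R, forall p q, A p -> A q ->
    (`|f p - f q|%:E <= K%:E * rdist p q)%E.

Definition rlipschitz (f : M -> R) : Prop := rlipschitz_in setT f.

Definition locally_rlipschitz (f : M -> R) : Prop :=
  forall p : M, exists2 A : set M, nbhs p A & rlipschitz_in A f.

Definition grad (f : M -> R) : vector_field M := fun p =>
  let c := chart_at p in
  (\row_i 'D_(std_vec i) (f \o chart_inv c : _ -> R^o) (chart_to c p))
    *m invmx (metric_at g p).

(* By Rademacher's theorem a locally Lipschitz f has such a G, unique almost
   everywhere. In each chart c, the components <G, d/dx_i> of the covector dual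
   to G are the weak partial derivatives of f. *)
Definition is_weak_grad (f : M -> R) (G : vector_field M) : Prop :=
  forall c, atlas c -> forall i : 'I_n,
  let dfi (x : 'rV[R]_n) :=
    let p := chart_inv c x in inner (G p) (coord_vec c i p) in
  (forall K : set 'rV[R]_n, compact K -> K `<=` chart_cod c ->
     (lebesgue_tuple R n).-integrable (@row_of_tuple R n @^-1` K)
       (fun t => (dfi (row_of_tuple t))%:E)) /\
  (forall eta : 'rV[R]_n -> R^o, smooth_on setT eta ->
     compact (support_of eta) -> support_of eta `<=` chart_cod c ->
     (\int[lebesgue_tuple R n]_(t in @row_of_tuple R n @^-1` chart_cod c)
        (f (chart_inv c (row_of_tuple t)) *
           'D_(std_vec i) eta (row_of_tuple t))%:E =
      - \int[lebesgue_tuple R n]_(t in @row_of_tuple R n @^-1` chart_cod c)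
        (dfi (row_of_tuple t) * eta (row_of_tuple t))%:E)%E).

(* The connection D^{lambda,mu} only enters through its gradient
   nabla^D f = V^(mu - lambda) nabla f and through its divergence, which satisfies
   V^tau div^D W = div (V^tau W) for tau = (n+1) lambda + mu. Here G stands for
   the (weak) gradient nabla f. *)
Definition affine_grad (V : M -> R) (lambda mu : R) (G : vector_field M) :
  vector_field M := fun p => V p `^ (mu - lambda) *: G p.

Definition test_on (O : set M) (psi : M -> R) : Prop :=
  [/\ forall p, 0 <= psi p, rlipschitz psi, compact (support_of psi) &
      support_of psi `<=` O].

Context (vol : {measure set (borel M) -> \bar R}) (V : M -> R).
Context (lambda mu tau : R).

(* Delta^D rho >= (C / rho) V^(lambda - mu) off rho^{-1}{0}, tested against
   nonnegative compactly supported Lipschitz functions; Grho is the weak gradient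
   of rho. *)
Definition affine_laplacian_ge (C : R) (rho : M -> R) (Grho : vector_field M) :
    Prop :=
  forall psi Gpsi, test_on [set p | rho p != 0] psi -> is_weak_grad psi Gpsi ->
  (\int[vol]_p (C / rho p * psi p * V p `^ (tau + lambda - mu))%:E <=
   - \int[vol]_p (inner (Gpsi p) (affine_grad V lambda mu Grho p) *
                  V p `^ tau)%:E)%E.

(* - V^tau div^D (w nabla^D delta) >= 0 on O in the sense of distributions. *)
Definition affine_div_le0 (O : set M) (w : M -> R) (Gdelta : vector_field M) :
    Prop :=
  forall psi Gpsi, test_on O psi -> is_weak_grad psi Gpsi ->
  (0 <= \int[vol]_p (w p * inner (affine_grad V lambda mu Gdelta p) (Gpsi p) *
                     V p `^ tau)%:E)%E.

End riemannian.

(* Main.v *)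
Require Import Defs.
From HB Require Import structures.
From mathcomp Require Import all_boot all_order all_algebra.
From mathcomp Require Import all_classical all_reals all_analysis.
From mathcomp Require Import perm measurable_realfun.
From mathcomp Require Import ring lra.

Set Implicit Arguments.
Unset Strict Implicit.
Unset Printing Implicit Defensive.

Import Order.TTheory GRing.Theory Num.Theory.
Import numFieldNormedType.Exports.

Local Open Scope classical_set_scope.
Local Open Scope ring_scope.

(* Let k = (C + alpha - 1) / 2. Test the inequality for the Laplacian of rho with
   psi1 = a rho^(alpha-1) phi^2 and the divergence condition with
   psi2 = rho^(2k) phi^2 / delta; both are compactly supported Lipschitz functions.
   Then integrate
     0 <= a rho^alpha |nabla phi + k phi nabla rho / rho - phi nabla delta / (2 delta)|^2,
   in which |nabla^D rho| = 1 turns the square of the middle term into the first term of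
   the right-hand side: the cross terms with nabla rho are controlled by the test with
   psi1, and those with nabla delta by the test with psi2. *)

(** * Measurability for the Lebesgue measure on tuples *)

(** The gradients of a, rho and delta are only used as locally integrable fields that satisfy
    integration by parts in charts. The obstacle is that psi1 and psi2 must be admissible: Lipschitz
    for [rdist], with the weak gradient that the chain rule predicts. Rademacher's theorem is
    bypassed: the chain rule comes from weak limits of difference quotients, the global Lipschitz
    bound from integration along curves.

    The power in psi2 is forced: rho^(1-C) rho^(2k) = rho^alpha is the weight of the delta term, and
    differentiating rho^(2k) gives exactly the cross term of nabla rho and nabla delta in the
    square. In psi1, differentiating rho^(alpha-1) gives alpha - 1, which adds up with the C of the
    Laplacian bound to 2k; multiplied by k, this outweighs the k^2 of the square and leaves k^2.

    A product of two locally integrable gradients need not be integrable. Products with nabla rho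
    are, since |nabla rho| is almost everywhere a power of V, and so are those with the smooth nabla
    phi. For |nabla delta|^2, integrability is extracted from the divergence condition itself. *)

Lemma measurable_fun_open_preimage d (T : measurableType d) (R : realType)
    (D : set T) (f : T -> R) :
  (forall O : set R, open O -> measurable (D `&` f @^-1` O)) ->
  measurable_fun D f.
Proof.
move=> Df; apply: (measurability _ (RGenOpens.measurableE R)).
by move=> _ [_ [a [b ->] <-]]; exact/Df/interval_open.
Qed.

Section lebesgue_tuple_theory.
Context {R : realType}.
Local Notation mR := (measurableTypeR R).

(** The sigma-algebra on tuples is generated by the coordinates, so an open set is reached through a
    countable base of cubes: rational centres, half-widths 1/(k+1). *)
Let box n (q : 'rV[rat]_n * nat) : set 'rV[R]_n :=
  [set x | forall i, `|x ord0 i - ratr (q.1 ord0 i)| < (q.2.+1%:R)^-1].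

Let nbhs_box n (x : 'rV[R]_n) (U : set 'rV[R]_n) : nbhs x U ->
  exists q, box q x /\ box q `<=` U.
Proof.
move=> /nbhs_ballP[e e0 xU].
(* The centre may be off [x] by one half-width, so a cube containing [x] reaches up to twice that
   far. *)
have [k ke] : exists k, 2 * (k.+1%:R)^-1 < e.
  exists (Num.trunc (2 / e)).
  rewrite ltr_pdivrMr ?ltr0n// mulrC -ltr_pdivrMr//.
  by rewrite truncnS_gt.
have rq i : exists q : rat, `|x ord0 i - ratr q| < (k.+1%:R)^-1.
  have k0 : (0 : R) < (k.+1%:R)^-1 by rewrite invr_gt0.
  have xk : x ord0 i - (k.+1%:R)^-1 < x ord0 i + (k.+1%:R)^-1.
    by rewrite ltrD2l gtrN.
  have [q] := rat_in_itvoo xk.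
  rewrite in_itv/= => /andP[q1 q2]; exists q.
  by rewrite ltr_distlC q1 q2.
pose q := \row_i sval (cid (rq i)).
exists (q, k); split.
  by move=> i /=; rewrite mxE; case: cid.
move=> y yq; apply: xU; split=> // i j; rewrite (ord1 i).
rewrite /ball /=; have := yq j; rewrite /= mxE; case: cid => /= r xr yr.
apply: le_lt_trans ke; rewrite -[x _ _](subrK (ratr r)) -addrA.
rewrite (le_trans (ler_normD _ _))// mulr_natl mulr2n lerD ?(ltW xr)//.
by rewrite distrC ltW.
Qed.

Lemma open_measurable_row n (U : set 'rV[R]_n) :
  open U -> measurable (@row_of_tuple R n @^-1` U).
Proof.
move=> oU.
pose F (q : 'rV[rat]_n * nat) := if `[< box q `<=` U >] then box q else set0.
have -> : U = \bigcup_q F q.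
  apply/seteqP; split=> [x Ux|x [q _]].
    have /nbhs_box[q [xq qU]] : nbhs x U by exact: open_nbhs_nbhs.
    by exists q => //; rewrite /F; case: asboolP.
  by rewrite /F; case: asboolP => // qU /qU.
rewrite preimage_bigcup.
apply: (countable_bigcupT_measurable (countableP [set: 'rV[rat]_n * nat])) => q.
rewrite /F; case: asboolP => _; last by rewrite preimage_set0.
rewrite (_ : _ @^-1` _ = \bigcap_(i in [set: 'I_n])
    ((@tnth n mR ^~ i) @^-1` ball (ratr (q.1 ord0 i) : R) (q.2.+1%:R)^-1)).
  apply: fin_bigcap_measurable => //.
  move=> i _; rewrite -[X in measurable X]setTI; apply: measurable_tnth => //.
  by apply: open_measurable; apply: ball_open; rewrite invr_gt0.
apply/seteqP; split=> [t tq i _|t tq i] /=.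
  by rewrite /ball/= distrC; have := tq i; rewrite mxE.
by rewrite mxE distrC; exact: (tq i I).
Qed.

Lemma closed_measurable_row n (K : set 'rV[R]_n) :
  closed K -> measurable (@row_of_tuple R n @^-1` K).
Proof.
move=> cK; rewrite -[X in measurable X]setCK; apply: measurableC.
exact: (open_measurable_row (closed_openC cK)).
Qed.

Lemma compact_measurable_row n (K : set 'rV[R]_n) :
  compact K -> measurable (@row_of_tuple R n @^-1` K).
Proof.
by move=> cK; apply: closed_measurable_row; apply: compact_closed.
Qed.

Lemma continuous_on_measurable_row n (O : set 'rV[R]_n) (f : 'rV[R]_n -> R) :
  open O -> (forall x, O x -> {for x, continuous f}) ->
  measurable_fun (@row_of_tuple R n @^-1` O) (fun t => f (row_of_tuple t)).
Proof.
move=> oO cf; apply: measurable_fun_open_preimage => U oU.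
rewrite (_ : _ `&` _ = @row_of_tuple R n @^-1` (O `&` f @^-1` U))//.
apply: open_measurable_row; rewrite openE => x [Ox Ux].
apply: filterI; first exact: open_nbhs_nbhs.
by apply: cf => //; exact: open_nbhs_nbhs.
Qed.

Lemma lebesgue_tuple_cube_fin n (r : R) : (lebesgue_tuple R n
  [set t : n.-tuple mR | forall i, (-r <= tnth t i <= r)%R] < +oo)%E.
Proof.
elim: n => [|n ih].
  by rewrite /lebesgue_tuple/= diracE; case: (_ \in _); rewrite ltry.
have mC : measurable [set t : n.-tuple mR | forall i, (-r <= tnth t i <= r)%R].
  rewrite (_ : [set t | _] = \bigcap_(i in [set: 'I_n])
      ((@tnth n mR ^~ i) @^-1` `[-r, r])).
    apply: fin_bigcap_measurable => //.
    by move=> i _; rewrite -[X in measurable X]setTI; exact: measurable_tnth.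
  by apply/seteqP; split=> [t tr i _|t tr i]; have := tr i;
    rewrite /= in_itv//=; apply.
rewrite /lebesgue_tuple /= /tuple_measure_step.
set S := _ @^-1` _; suff -> : S = (`[-r, r] : set mR) `*`
    [set t : n.-tuple mR | forall i, (-r <= tnth t i <= r)%R].
  have H : (lebesgue_measure (`[(- r)%R, r%R] : set mR) < +oo)%E.
    by rewrite lebesgue_measure_itv/=; case: ifP => // _; rewrite ltry.
  rewrite product_measure1E//; apply: lte_mul_pinfty => //.
  by rewrite ge0_fin_numE//; exact: H.
apply/seteqP; split=> [[x t] /= xt|[x t] [/= xr tr] i].
  split; first by have := xt ord0; rewrite /= in_itv.
  by move=> i; have := xt (lift ord0 i); rewrite !(tnth_nth 0).
rewrite (tnth_nth 0)/=; case: (unliftP ord0 i) => [j ->|->] /=.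
  by rewrite -tnth_nth.
by move: xr; rewrite in_itv.
Qed.

Lemma compact_lebesgue_tuple_fin n (K : set 'rV[R]_n) : compact K ->
  (lebesgue_tuple R n (@row_of_tuple R n @^-1` K) < +oo)%E.
Proof.
move=> cK; have [M [_ MK]] := compact_bounded cK.
apply: le_lt_trans (lebesgue_tuple_cube_fin n (M + 1)).
apply: le_measure; rewrite ?inE.
- exact: compact_measurable_row.
- rewrite (_ : [set t | _] = \bigcap_(i in [set: 'I_n])
      ((@tnth n mR ^~ i) @^-1` `[-(M + 1), M + 1])).
    apply: fin_bigcap_measurable => //.
    by move=> i _; rewrite -[X in measurable X]setTI; exact: measurable_tnth.
  by apply/seteqP; split=> [t tr i _|t tr i]; have := tr i;
    rewrite /= in_itv//=; apply.
- move=> t Kt i; rewrite -ler_norml.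
  have /(_ (row_of_tuple t) Kt) : forall x, K x -> `|x| <= M + 1.
    by move=> x; apply: MK; rewrite ltrDl.
  apply: le_trans; rewrite [leRHS]mx_normrE.
  have -> : tnth t i = row_of_tuple t ord0 i by rewrite mxE.
  by apply/(le_bigmax_cond _ (fun i0 : 'I_1 * 'I_n => `|row_of_tuple t i0.1 i0.2|)
    (isT : xpredT (ord0, i))).
Qed.

Definition tuple_shift n (h : 'rV[R]_n) (t : n.-tuple mR) : n.-tuple mR :=
  [tuple tnth t i + h ord0 i | i < n].

Lemma row_of_tuple_shift n (h : 'rV[R]_n) (t : n.-tuple mR) :
  row_of_tuple (tuple_shift h t) = row_of_tuple t + h.
Proof. by apply/rowP => i; rewrite !mxE tnth_mktuple. Qed.

Lemma measurable_tuple_shift n (h : 'rV[R]_n) :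
  measurable_fun [set: n.-tuple mR] (@tuple_shift n h).
Proof.
apply/measurable_fun_tnthP => i.
rewrite (_ : _ \o _ = (fun t : n.-tuple mR => tnth t i + h ord0 i)).
  by apply: measurable_funD => //; exact: measurable_tnth.
by apply/funext => t; rewrite /= tnth_mktuple.
Qed.

(** By uniqueness of Lebesgue measure: the translated measure gives half-open intervals their
    length. *)
Lemma lebesgue_measure_shift (a : R) (A : set mR) : measurable A ->
  lebesgue_measure ((fun x => x + a) @^-1` A) = lebesgue_measure A.
Proof.
move=> mA.
have ms : measurable_fun [set: mR] (fun x : mR => x + a).
  by apply: measurable_funD.
apply/esym.
rewrite -[RHS]/(pushforward lebesgue_measure (fun x : mR => x + a) A).
apply: (lebesgue_measure_unique (mu := pushforward lebesgue_measure _)) => // X.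
move=> [[b c] _ <-]; rewrite /= /pushforward.
rewrite (_ : _ @^-1` _ = `](b - a), (c - a)]%classic).
  rewrite !lebesgue_measure_itv /= !lte_fin ltrD2r.
  by case: ifP => // _; congr (_%:E); lra.
by apply/seteqP; split=> x /=; rewrite !in_itv/= => /andP[? ?]; apply/andP;
  split; lra.
Qed.

(** Peeling off the first coordinate turns the translation into a product map; uniqueness of the
    product measure then leaves only rectangles to compare. *)
Lemma lebesgue_tuple_shift n (h : 'rV[R]_n) (A : set (n.-tuple mR)) :
  measurable A ->
  lebesgue_tuple R n (tuple_shift h @^-1` A) = lebesgue_tuple R n A.
Proof.
elim: n h A => [|n ih] h A mA.
  congr (lebesgue_tuple R 0 _); apply/seteqP; split=> t /=;
  by rewrite (tuple0 (tuple_shift h t)) (tuple0 t).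
pose h' : 'rV[R]_n := \row_i h ord0 (lift ord0 i).
pose sh (z : mR * n.-tuple mR) : mR * n.-tuple mR :=
  (z.1 + h ord0 ord0, tuple_shift h' z.2).
have msh : measurable_fun [set: mR * n.-tuple mR] sh.
  apply/measurable_fun_pairP; split => /=.
    by apply: measurable_funD => //; exact: measurable_fst.
  exact: (measurableT_comp (measurable_tuple_shift h') measurable_snd).
rewrite /lebesgue_tuple /= /tuple_measure_step.
set m := tuple_measure _ n.
pose B := @tuple_cons _ mR n @^-1` A.
have mB : measurable B.
  by rewrite -[X in measurable X]setTI; exact: measurable_tuple_cons.
have -> : @tuple_cons _ mR n @^-1` (tuple_shift h @^-1` A) = sh @^-1` B.
  have shE z : tuple_shift h (tuple_cons z) = tuple_cons (sh z).
    apply: eq_from_tnth => i; rewrite tnth_mktuple.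
    case: (unliftP ord0 i) => [j ->|->]; last by rewrite !tnth0.
    by rewrite !tnthS tnth_mktuple mxE.
  by apply/funext => z; rewrite /B /preimage/= shE.
apply/esym; rewrite -[RHS]/(pushforward (lebesgue_measure \x m)%E sh B).
apply: (product_measure_unique (m' := pushforward (lebesgue_measure \x m)%E _)) => //.
move=> X Y mX mY /=; rewrite /pushforward.
rewrite (_ : sh @^-1` _ = ((fun x => x + h ord0 ord0) @^-1` X) `*`
    (tuple_shift h' @^-1` Y))//.
rewrite product_measure1E//.
- by congr (_ * _)%E; [exact: lebesgue_measure_shift|exact: ih].
- rewrite -[X in measurable X]setTI.
  by apply: (measurable_funD _ _) => //; exact: measurable_id.
- by rewrite -[X in measurable X]setTI; exact: measurable_tuple_shift.
Qed.

Lemma integral_tuple_shift n (h : 'rV[R]_n) (f : n.-tuple mR -> \bar R) :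
  measurable_fun setT f ->
  (lebesgue_tuple R n).-integrable setT (f \o tuple_shift h) ->
  (\int[lebesgue_tuple R n]_t f (tuple_shift h t) =
   \int[lebesgue_tuple R n]_t f t)%E.
Proof.
move=> mf fi.
have E := @integral_pushforward _ _ _ _ _ _ (measurable_tuple_shift h)
  (lebesgue_tuple R n) setT f mf fi measurableT.
rewrite preimage_setT in E; transitivity
  (\int[pushforward (lebesgue_tuple R n) (tuple_shift h)]_t f t)%E.
  exact/esym/E.
apply: (eq_measure_integral _ (m1 := pushforward (lebesgue_tuple R n) _)).
  exact: measurable_tuple_shift.
by move=> ? A mA _; exact: lebesgue_tuple_shift.
Qed.

End lebesgue_tuple_theory.

(** * Smooth functions on vector spaces *)

Section Ck_closure.
Context {R : realType} {U : normedModType R}.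
Implicit Types (f g : U -> R^o) (k : nat).

(** In the Leibniz and quotient rules a factor of class k+1 also occurs undifferentiated, where
    class k is required. *)
Lemma Ck_onS k f : Ck_on k.+1 setT f -> Ck_on k setT f.
Proof.
elim: k f => [|k ih] f [df Df].
  by move=> x _; apply: differentiable_continuous; exact: df.
by split=> // v; exact/ih/Df.
Qed.

Lemma Ck_on_cst k (a : R) : Ck_on k [set: U] (fun=> a : R^o).
Proof.
elim: k a => [|k ih] a; first by move=> x _; exact: cst_continuous.
split=> [x _|v]; first exact: differentiable_cst.
rewrite (_ : 'D_v _ = fun=> 0); first exact: ih.
by apply/funext => x; rewrite derive_cst.
Qed.

Lemma Ck_onD k f g : Ck_on k setT f -> Ck_on k setT g ->
  Ck_on k setT (fun x => f x + g x).
Proof.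
elim: k f g => [|k ih] f g.
  by move=> cf cg x _; exact: (continuousD (cf x I) (cg x I)).
move=> [df Df] [dg Dg]; split=> [x _|v].
  exact: (differentiableD (df x I) (dg x I)).
rewrite (_ : 'D_v _ = fun x => 'D_v f x + 'D_v g x).
  exact: (ih _ _ (Df v) (Dg v)).
apply/funext => x; rewrite -deriveD//; apply: diff_derivable;
  [exact: df|exact: dg].
Qed.

Lemma Ck_onM k f g : Ck_on k setT f -> Ck_on k setT g ->
  Ck_on k setT (fun x => f x * g x : R^o).
Proof.
elim: k f g => [|k ih] f g.
  by move=> cf cg x _; exact: (continuousM (cf x I) (cg x I)).
move=> fk gk; have [df Df] := fk; have [dg Dg] := gk; split=> [x _|v].
  exact: (differentiableM (df x I) (dg x I)).
rewrite (_ : 'D_v _ = fun x => f x * 'D_v g x + g x * 'D_v f x).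
  exact: (Ck_onD (ih _ _ (Ck_onS fk) (Dg v)) (ih _ _ (Ck_onS gk) (Df v))).
apply/funext => x.
have -> : (fun x => f x * g x : R^o) = (f : U -> R) * (g : U -> R) by [].
by rewrite deriveM//; apply: diff_derivable; [exact: df|exact: dg].
Qed.

Lemma Ck_onV k f : (forall x, f x != 0) -> Ck_on k setT f ->
  Ck_on k setT (fun x => (f x)^-1 : R^o).
Proof.
move=> f0; elim: k f f0 => [|k ih] f f0.
  by move=> cf x _; exact: (continuousV (f0 x) (cf x I)).
move=> fk; have [df Df] := fk; split=> [x _|v].
  exact: (differentiableV (df x I) (f0 x)).
rewrite (_ : 'D_v _ = fun x => ((-1 : R) * ((f x)^-1 * (f x)^-1)) * 'D_v f x).
  have ck := ih _ f0 (Ck_onS fk).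
  exact: (Ck_onM (Ck_onM (Ck_on_cst k (-1)) (Ck_onM ck ck)) (Df v)).
apply/funext => x.
rewrite deriveV//; last by apply: diff_derivable; exact: df.
by rewrite expr2 invfM mulN1r.
Qed.

Lemma smooth_cst (a : R) : smooth_on [set: U] (fun=> a : R^o).
Proof. by move=> k; exact: Ck_on_cst. Qed.

Lemma smoothD f g : smooth_on setT f -> smooth_on setT g ->
  smooth_on setT (fun x => f x + g x).
Proof. by move=> sf sg k; apply: Ck_onD. Qed.

Lemma smoothM f g : smooth_on setT f -> smooth_on setT g ->
  smooth_on setT (fun x => f x * g x : R^o).
Proof. by move=> sf sg k; apply: Ck_onM. Qed.

Lemma smoothV f : (forall x, f x != 0) -> smooth_on setT f ->
  smooth_on setT (fun x => (f x)^-1 : R^o).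
Proof. by move=> f0 sf k; apply: Ck_onV. Qed.

Lemma smoothX f N : smooth_on setT f -> smooth_on setT (fun x => f x ^+ N : R^o).
Proof.
move=> sf; elim: N => [|N ih]; first exact: (smooth_cst 1).
rewrite (_ : (fun x => _) = (fun x => f x * f x ^+ N : R^o)).
  exact: smoothM.
by apply/funext => x; rewrite exprS.
Qed.

Lemma smooth_sum I (s : seq I) (F : I -> U -> R) :
  (forall i, smooth_on setT (F i : U -> R^o)) ->
  smooth_on setT ((fun x => \sum_(i <- s) F i x) : U -> R^o).
Proof.
move=> sF; elim: s => [|i s ih].
  rewrite (_ : (fun x => _) = (fun=> 0)); first exact: smooth_cst.
  by apply/funext => x; rewrite big_nil.
rewrite (_ : (fun x => _) = (fun x => F i x + \sum_(i <- s) F i x)).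
  exact: (smoothD (sF i) ih).
by apply/funext => x; rewrite big_cons.
Qed.

Lemma smooth_continuous f : smooth_on setT f -> continuous f.
Proof. by move=> /(_ 0%N) cf x; exact: cf. Qed.

End Ck_closure.

(** * Uniform approximation by smooth functions on compact sets *)

Section smooth_approximation.
Context {R : realType} {n : nat}.

Lemma smooth_coord (i : 'I_n) :
  smooth_on setT (fun x : 'rV[R]_n => x ord0 i : R^o).
Proof.
case=> [|k] /=; first by move=> x _; exact: coord_continuous.
split=> [x _|v]; first exact: differentiable_coord.
rewrite (_ : 'D_v _ = fun=> v ord0 i); first exact: Ck_on_cst.
apply/funext => x.
have l : linear (fun y : 'rV[R]_n => y ord0 i : R^o) by move=> a b c; rewrite !mxE.
pose lm := GRing.isLinear.Build _ _ _ _ (fun y : 'rV[R]_n => y ord0 i : R^o) l.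
pose L : {linear 'rV[R]_n -> R^o} := HB.pack (fun y : 'rV[R]_n => y ord0 i : R^o) lm.
rewrite deriveE; last exact: differentiable_coord.
have cL : continuous L by exact: coord_continuous.
exact: (congr1 (fun h : 'rV[R]_n -> R^o => h v) (diff_lin x cL)).
Qed.

(* Shepard interpolation: with gauges q_c vanishing at the nodes c, the weights
   (1 + q_c)^-N concentrate, as N grows, on the nodes with small gauge. *)
Lemma smooth_approx (K : set 'rV[R]_n) (G : 'rV[R]_n -> R) (e : R) :
  compact K -> (forall x, K x -> {for x, continuous G}) -> 0 < e ->
  exists P : 'rV[R]_n -> R^o, smooth_on setT P /\
    forall x, K x -> `|P x - G x| <= e.
Proof.
move=> cK cG e0.
(* A point of [K] guarantees at least one node, hence a positive denominator [W] everywhere. *)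
have [->|/set0P[x0 Kx0]] := eqVneq K set0.
  by exists (fun=> 0); split => //; exact: smooth_cst.
have gauge c : exists q : 'rV[R]_n -> R^o, [/\ smooth_on setT q, forall x, 0 <= q x,
    q c = 0 & K c -> forall x, q x <= 4 -> `|G x - G c| <= e / 2].
  have [Kc|nKc] := pselect (K c); last first.
    by exists (fun=> 0); split => //; exact: smooth_cst.
  have /cvgr_dist_le/(_ _ (divr_gt0 e0 (@ltr0n R 2))) := cG _ Kc.
  move=> /nbhs_ballP[r /= r0 rG].
  (* The factor 3/r makes a gauge of at most 4 confine each coordinate to within 2r/3 < r of the
     node, where [G] varies by at most e/2. *)
  pose t i (x : 'rV[R]_n) : R := (3 / r * (x ord0 i - c ord0 i)) ^+ 2.
  exists (fun x => \sum_i t i x : R); split.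
  - apply: (smooth_sum _ (F := t)) => i.
    exact: (smoothX 2 (smoothM (smooth_cst _)
      (smoothD (smooth_coord i) (smooth_cst (- c ord0 i))))).
  - by move=> x; apply: sumr_ge0 => i _; exact: sqr_ge0.
  - by apply: big1 => i _; rewrite /t subrr mulr0 expr0n.
  - move=> _ x qx; rewrite distrC; apply: rG; split=> // i j; rewrite (ord1 i).
    have : (3 / r * (x ord0 j - c ord0 j)) ^+ 2 <= 2 ^+ 2.
      apply: le_trans (le_trans qx _); last by rewrite -natrX.
      by rewrite (bigD1 j)//= lerDl sumr_ge0// => l _; exact: sqr_ge0.
    rewrite -[leLHS]real_normK ?num_real// ler_pXn2r ?nnegrE//.
    rewrite normrM gtr0_norm ?divr_gt0// /ball/= distrC => h.
    have h' : `|c ord0 j - x ord0 j| <= 2 / 3 * r.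
      by move: h; rewrite mulrAC ler_pdivrMr//; set a := `|_|; lra.
    by rewrite (le_lt_trans h')//; lra.
pose q c := sval (cid (gauge c)).
have qP c : [/\ smooth_on setT (q c), forall x, 0 <= q c x,
    q c c = 0 & K c -> forall x, q c x <= 4 -> `|G x - G c| <= e / 2].
  by rewrite /q; case: cid.
have qs c : smooth_on setT (q c) by have [] := qP c.
have q0 c x : 0 <= q c x by have [] := qP c.
have := cK; rewrite compact_cover.
move=> /(_ _ K (fun c => [set x | q c x < 1])); case.
- move=> c _; apply: (@open_comp _ _ (q c) [set z | z < 1]).
    by move=> x _; exact: (smooth_continuous (qs c)).
  exact: open_lt.
- by move=> x Kx; exists x => //=; have [_ _ -> _] := qP x; exact: ltr01.
move=> D DK KD; pose s := finmap.enum_fset D.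
have sK c : c \in s -> K c by move=> /DK; rewrite inE.
have sx x : K x -> exists2 c, c \in s & q c x < 1.
  by move=> /KD[c /= cD qc]; exists c.
(* The spare [e] lets [M] also bound [G] on all of [K], each point of which is e/2-close in value to
   some node. *)
pose M := \sum_(c <- s) `|G c| + e.
have Ms c : c \in s -> `|G c| <= M - e.
  move=> cs; rewrite /M addrK (big_rem c)//= lerDl.
  by apply: sumr_ge0 => i _; exact: normr_ge0.
have MK x : K x -> `|G x| <= M - e / 2.
  move=> Kx; have [c cs qc] := sx _ Kx.
  have [_ _ _ /(_ (sK _ cs) x)] := qP c.
  have qc4 : q c x <= 4 by apply: (le_trans (ltW qc)); rewrite ler1n.
  move=> /(_ qc4) h; have := Ms _ cs.
  rewrite -[G x](subrK (G c)) => h'; rewrite (le_trans (ler_normD _ _))//.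
  have : e = e / 2 + e / 2 by rewrite -splitr.
  by move: h h'; set a := `|G x - _|; set b := `|G c|; lra.
have M0 : 0 <= M by rewrite addr_ge0 ?(ltW e0)// sumr_ge0.
pose m : R := (size s)%:R.
(* A node of gauge above 4 has weight at most 5^-N, while every point of [K] has a node of gauge
   below 1, of weight at least 2^-N. So the far nodes contribute at most [m] times 2M times (2/5)^N
   relative to [W]. *)
have [N hN] : exists N, m * (2 * M) * (2 / 5) ^+ N <= e / 2.
  have : (fun N => m * (2 * M) * (2 / 5) ^+ N) @ \oo --> m * (2 * M) * 0.
    apply: cvgM; first exact: cvg_cst.
    by apply: cvg_expr; rewrite gtr0_norm//; lra.
  rewrite mulr0 => /cvgr_dist_le/(_ _ (divr_gt0 e0 (@ltr0n R 2)))[N _ /(_ N)] /=.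
  rewrite leqnn => /(_ isT); rewrite sub0r normrN => h; exists N.
  exact: le_trans (ler_norm _) h.
pose w c x := ((1 + q c x) ^+ N)^-1.
have q1 c x : 0 < 1 + q c x by rewrite ltr_wpDr.
have w0 c x : 0 < w c x by rewrite invr_gt0 exprn_gt0.
have ws c : smooth_on setT (w c : _ -> R^o).
  apply: smoothV; first by move=> x; rewrite gt_eqF// exprn_gt0.
  by apply: smoothX; apply: smoothD => //; exact: smooth_cst.
pose W x := \sum_(c <- s) w c x.
have W0 x : 0 < W x.
  have [c cs _] := sx _ Kx0; rewrite /W (big_rem c)//= ltr_pwDl//.
  by apply: sumr_ge0 => i _; exact: ltW.
exists (fun x => (\sum_(c <- s) w c x * G c) * (W x)^-1 : R); split.
  apply: smoothM.
    apply: (smooth_sum _ (F := fun c x => w c x * G c)) => c.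
    exact: (smoothM (ws c) (smooth_cst (G c))).
  apply: smoothV; first by move=> x; rewrite gt_eqF.
  exact: smooth_sum.
move=> x Kx.
have -> : (\sum_(c <- s) w c x * G c) * (W x)^-1 - G x =
    (\sum_(c <- s) w c x * (G c - G x)) / W x.
  rewrite -[G x in LHS](mulfK (lt0r_neq0 (W0 x))) -mulrBl; congr (_ / _).
  rewrite /W mulr_sumr -sumrB; apply: eq_bigr => c _; ring.
rewrite normrM (gtr0_norm (_ : 0 < (W x)^-1)) ?invr_gt0// ler_pdivrMr//.
apply: le_trans (ler_norm_sum _ _ _) _.
apply: (@le_trans _ _ (\sum_(c <- s) (w c x * (e / 2) + 2 * M * (5 ^+ N)^-1))).
  rewrite big_seq [leRHS]big_seq; apply: ler_sum => c cs.
  rewrite normrM (gtr0_norm (w0 _ _)).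
  have [qc|qc] := leP (q c x) 4.
    rewrite -[leLHS]addr0 lerD//.
      by rewrite ler_pM2l// distrC; have [_ _ _] := qP c; apply=> //; exact: sK.
    by rewrite mulr_ge0// ?mulr_ge0// invr_ge0 exprn_ge0.
  rewrite -[leLHS]add0r lerD//; first by rewrite mulr_ge0 ?(ltW (w0 _ _))// divr_ge0// ltW.
  rewrite mulrC; apply: ler_pM => //; first by rewrite ltW.
    rewrite (le_trans (ler_normB _ _))//; have := Ms _ cs; have := MK _ Kx.
    by move: e0; set a := `|G x|; set b := `|G c|; lra.
  rewrite lef_pV2 ?posrE ?exprn_gt0//.
  apply: lerXn2r; rewrite ?nnegrE ?(ltW (q1 _ _))//.
  by move: qc; set z : R := q c x => qc; lra.
rewrite big_split/= -mulr_suml big_const_seq count_predT iter_addr_0.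
have -> : e * W x = W x * (e / 2) + W x * (e / 2) by rewrite -mulrDr -splitr mulrC.
rewrite lerD2l.
have W2 : (2 ^+ N)^-1 <= W x.
  have [c cs qc] := sx _ Kx.
  rewrite /W (big_rem c)//= -[leLHS]addr0 lerD//; last first.
    by apply: sumr_ge0 => i _; exact: ltW.
  rewrite lef_pV2 ?posrE ?exprn_gt0//.
  apply: lerXn2r; rewrite ?nnegrE ?(ltW (q1 _ _))//.
  by move: qc; set z : R := q c x => qc; lra.
apply: (@le_trans _ _ ((2 ^+ N)^-1 * (e / 2))); last first.
  by rewrite ler_pM2r// divr_gt0.
rewrite [leRHS]mulrC ler_pdivlMr ?exprn_gt0//.
apply: le_trans hN; rewrite expr_div_n -[_ *+ _]mulr_natl.
by rewrite le_eqVlt; apply/orP; left; apply/eqP; rewrite -/m; ring.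
Qed.

End smooth_approximation.

(** * Weak partial derivatives *)

Section integrable_EFin.
Context {d} {T : measurableType d} {R : realType}.
Variables (m : {measure set T -> \bar R}) (D : set T).
Hypothesis mD : measurable D.
Implicit Types f g : T -> R.
Local Notation intble f := (m.-integrable D (fun x => (f x)%:E)).

Lemma integrableD_EFin f g :
  intble f -> intble g -> m.-integrable D (fun x => (f x + g x)%:E).
Proof. by move=> fi gi; exact: (integrableD mD fi gi). Qed.

Lemma integrableB_EFin f g :
  intble f -> intble g -> m.-integrable D (fun x => (f x - g x)%:E).
Proof. by move=> fi gi; exact: (integrableB mD fi gi). Qed.

Lemma integrableZl_EFin (k : R) f :
  intble f -> m.-integrable D (fun x => (k * f x)%:E).
Proof. by move=> fi; exact: (integrableZl mD k fi). Qed.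

Lemma integrable_normr_EFin f :
  intble f -> m.-integrable D (fun x => `|f x|%:E).
Proof. by move=> fi; exact: (integrable_abse fi). Qed.

Lemma integrable_cst (k : R) :
  (m D < +oo)%E -> m.-integrable D (fun=> k%:E).
Proof.
move=> mfin; apply: (measurable_bounded_integrable (f := fun=> k)) => //.
exists `|k|; split; first by rewrite num_real.
by move=> M kM x _; exact: ltW.
Qed.

End integrable_EFin.

Lemma near_compact_bounded {R : realType} (X : topologicalType) (K : set X)
    (F : X -> R) : compact K -> (forall x, K x -> {for x, continuous F}) ->
  exists M : R, 0 < M /\ forall x, K x -> `|F x| <= M.
Proof.
move=> cK cF.
have : \forall M \near +oo, K `<=` [set x | `|F x| <= M].
  apply: (iffLR (compact_near_coveringP K)) => // x Kx.
  exists ([set y | `|F y| < `|F x| + 1], [set M | `|F x| + 1 < M]).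
    split => /=; last by exists (`|F x| + 1); split => //; rewrite num_real.
    have cN : {for x, continuous (fun y => `|F y|)}.
      by apply: cvg_norm; exact: cF.
    by apply: (cvgr_lt _ cN); rewrite ltrDl.
  by move=> [y M] [/= h1 h2]; exact: ltW (lt_trans h1 h2).
move=> nK; near (pinfty_nbhs R) => M; exists M; split; first by near: M; exact: nbhs_pinfty_gt.
by near: M; exact: nK.
Unshelve. all: by end_near. Qed.

Section weak_partial.
Context {R : realType} {n : nat}.
Local Notation mu := (lebesgue_tuple R n).
Local Notation row := (@row_of_tuple R n).
Local Notation mR := (measurableTypeR R).
Implicit Types (O K B : set 'rV[R]_n) (f F G : 'rV[R]_n -> R) (i : 'I_n).

Definition continuous_on O F := forall x, O x -> {for x, continuous F}.

(** One coordinate of [is_weak_grad] read in a fixed chart, with [O] the chart codomain. *)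
Definition weak_partial O i f df :=
  (forall K, compact K -> K `<=` O ->
     mu.-integrable (row @^-1` K) (fun t => (df (row t))%:E)) /\
  (forall eta : 'rV[R]_n -> R^o, smooth_on setT eta ->
     compact (support_of eta) -> support_of eta `<=` O ->
     (\int[mu]_(t in row @^-1` O) (f (row t) * 'D_(std_vec i) eta (row t))%:E =
      - \int[mu]_(t in row @^-1` O) (df (row t) * eta (row t))%:E)%E).

Definition locally_lipschitz O f := forall x0, O x0 -> exists L : R,
  \forall x \near x0 & y \near x0, `|f x - f y| <= L * `|x - y|.

Lemma locally_lipschitz_continuous O f :
  locally_lipschitz O f -> continuous_on O f.
Proof.
move=> lf x /lf[L] [[U V] [xU xV] UV].
apply/(@cvgrPdist_le _ _ _ (nbhs x)) => e e0.
have L0 : 0 < `|L| + 1 by rewrite ltr_wpDl.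
have xb : nbhs x (ball x (e / (`|L| + 1))) by apply: nbhsx_ballx; rewrite divr_gt0.
near=> y.
apply: (@le_trans _ _ (L * `|x - y|)).
  by apply: (UV (x, y)); split => /=; [exact: nbhs_singleton|near: y].
have : `|x - y| < e / (`|L| + 1).
  have : ball x (e / (`|L| + 1)) y by near: y.
  by rewrite -ball_normE.
rewrite ltr_pdivlMr// => h.
rewrite (le_trans _ (ltW h))// mulrC ler_wpM2l// (le_trans (ler_norm _))//.
by rewrite lerDl.
Unshelve. all: by end_near. Qed.

Lemma integrable_continuous_on O K F : open O -> compact K -> K `<=` O ->
  continuous_on O F -> mu.-integrable (row @^-1` K) (fun t => (F (row t))%:E).
Proof.
move=> oO cK KO cF.
have [M [M0 FM]] : exists M, 0 < M /\ forall x, K x -> `|F x| <= M.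
  by apply: near_compact_bounded => // x /KO; exact: cF.
apply: (measurable_bounded_integrable (f := fun t => F (row t))).
- exact: compact_measurable_row.
- exact: compact_lebesgue_tuple_fin.
- apply: (@measurable_funS _ _ _ _ (row @^-1` O)).
  + exact: open_measurable_row.
  + by move=> t /KO.
  + exact: continuous_on_measurable_row.
- exists M; split; first by rewrite num_real.
  by move=> M' MM' t /= Kt; exact: le_trans (FM _ Kt) (ltW MM').
Qed.

Lemma integrable_continuousM O K F G : open O -> compact K -> K `<=` O ->
  continuous_on O G -> mu.-integrable (row @^-1` K) (fun t => (F (row t))%:E) ->
  mu.-integrable (row @^-1` K) (fun t => (F (row t) * G (row t))%:E).
Proof.
move=> oO cK KO cG iF.
have [M [M0 GM]] : exists M, 0 < M /\ forall x, K x -> `|G x| <= M.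
  by apply: near_compact_bounded => // x /KO; exact: cG.
have mG : measurable_fun (row @^-1` K) (fun t => G (row t)).
  apply: (@measurable_funS _ _ _ _ (row @^-1` O)).
  + exact: open_measurable_row.
  + by move=> t /KO.
  + exact: continuous_on_measurable_row.
apply: (le_integrable _ _ (g := fun t => (M%:E * (F (row t))%:E)%E)).
- exact: compact_measurable_row.
- apply/measurable_EFinP; apply: measurable_funM => //.
  by have /integrableP[/measurable_EFinP] := iF.
- move=> t Kt; rewrite -EFinM !abse_EFin lee_fin !normrM mulrC.
  by rewrite ler_wpM2r// (le_trans (GM _ Kt))// ler_norm.
- by apply: integrableZl => //; exact: compact_measurable_row.
Qed.

Lemma integral_compact_support K B F : K `<=` B -> measurable (row @^-1` K) ->
  measurable (row @^-1` B) -> (forall x, B x -> ~ K x -> F x = 0) ->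
  (\int[mu]_(t in row @^-1` B) (F (row t))%:E =
   \int[mu]_(t in row @^-1` K) (F (row t))%:E)%E.
Proof.
move=> KB mK mB F0; rewrite integral_mkcond [RHS]integral_mkcond.
apply: eq_integral => t _; rewrite !patchE.
case: ifPn => [/set_mem tB|/negP tB]; case: ifPn => [/set_mem tK|/negP tK] //.
- by rewrite F0// => /mem_set.
- by exfalso; apply: tB; apply/mem_set/KB.
Qed.

Lemma support_of_eq0 (T : topologicalType) (f : T -> R) x :
  ~ support_of f x -> f x = 0.
Proof.
by move=> nsx; apply: contrapT => /eqP fx; apply: nsx; exact: subset_closure.
Qed.

Lemma derive_support (eta : 'rV[R]_n -> R^o) v x :
  ~ support_of eta x -> 'D_v eta x = 0.
Proof.
move=> nsx; rewrite -(derive_cst (0 : R^o) x v).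
apply: near_eq_derive.
have : open_nbhs x (~` support_of eta).
  by split => //; rewrite openC; exact: closed_closure.
move/open_nbhs_nbhs; apply: filterS => y; exact: support_of_eq0.
Qed.

(** Replaces extended integrals over the open set by real integrals over a compact set containing
    the support of [eta]. There [f], being continuous, is bounded, and linearity of the integral is
    at hand. *)
Lemma weak_partialE O i f df : open O -> continuous_on O f ->
  weak_partial O i f df <->
  (forall K, compact K -> K `<=` O ->
     mu.-integrable (row @^-1` K) (fun t => (df (row t))%:E)) /\
  (forall (eta : 'rV[R]_n -> R^o) K, smooth_on setT eta -> compact K ->
     K `<=` O -> support_of eta `<=` K ->
     \int[mu]_(t in row @^-1` K) (f (row t) * 'D_(std_vec i) eta (row t)) =
      - \int[mu]_(t in row @^-1` K) (df (row t) * eta (row t))).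
Proof.
move=> oO cf.
have key (eta : 'rV[R]_n -> R^o) K : smooth_on setT eta -> compact K ->
    K `<=` O -> support_of eta `<=` K -> 
    (forall K, compact K -> K `<=` O ->
     mu.-integrable (row @^-1` K) (fun t => (df (row t))%:E)) ->
    (\int[mu]_(t in row @^-1` O) (f (row t) * 'D_(std_vec i) eta (row t))%:E =
     (\int[mu]_(t in row @^-1` K) (f (row t) * 'D_(std_vec i) eta (row t)))%:E /\
    \int[mu]_(t in row @^-1` O) (df (row t) * eta (row t))%:E =
     (\int[mu]_(t in row @^-1` K) (df (row t) * eta (row t)))%:E)%E.
  move=> se cK KO sK di.
  have mO := open_measurable_row oO.
  have mK := compact_measurable_row cK.
  split.
    rewrite (integral_compact_support (K := K)
      (F := fun x => f x * 'D_(std_vec i) eta x))//; last first.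
      by move=> x _ nKx; rewrite (derive_support _ (contra_not (@sK x) nKx)) mulr0.
    rewrite /Rintegral fineK//; apply: integrable_fin_num => //.
    apply: (integrable_continuous_on
      (F := fun x => f x * 'D_(std_vec i) eta x) oO) => // x Ox.
    apply: (continuousM (cf x Ox)).
    by have [_ /(_ (std_vec i)) /(_ x I)] := se 1%N.
  rewrite (integral_compact_support (K := K) (F := fun x => df x * eta x))//.
    rewrite /Rintegral fineK//; apply: integrable_fin_num => //.
    apply: (integrable_continuousM (F := df) (G := eta) oO) => //; last exact: di.
    by move=> x _; exact: smooth_continuous.
  by move=> x _ nKx; rewrite (support_of_eq0 (contra_not (@sK x) nKx)) mulr0.
split=> [[di fD]|[di fD]]; split=> //.
  move=> eta K se cK KO sK.
  have cs : compact (support_of eta).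
    by apply: (subclosed_compact _ cK sK); exact: closed_closure.
  have [E1 E2] := key eta K se cK KO sK di.
  have := fD eta se cs (subset_trans sK KO).
  by rewrite E1 E2 -EFinN => -[].
move=> eta se cs sO.
have [E1 E2] := key eta _ se cs sO (@subset_refl _ _) di.
by rewrite E1 E2 -EFinN fD.
Qed.

End weak_partial.

(** * Difference quotients and discrete integration by parts *)

Section difference_quotient.
Context {R : realType} {n : nat}.
Local Notation mu := (lebesgue_tuple R n).
Local Notation row := (@row_of_tuple R n).
Local Notation mR := (measurableTypeR R).
Implicit Types (O K B : set 'rV[R]_n) (f F G : 'rV[R]_n -> R) (i : 'I_n).

Lemma norm_std_vec_le1 i : `|std_vec i : 'rV[R]_n| <= 1.
Proof.
rewrite [leLHS]mx_normrE; apply: bigmax_le => // -[j k] _ /=.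
by rewrite mxE; case: (_ && _); rewrite ?normr1 ?normr0.
Qed.

Lemma derive_line (W : normedModType R) (f : 'rV[R]_n -> W) (v x : 'rV[R]_n)
    (s : R) : differentiable f (s *: v + x) ->
  is_derive (s : R^o) 1 (fun s : R^o => f (s *: v + x)) ('D_v f (s *: v + x)).
Proof.
move=> df.
have E : (fun h : R => h^-1 *: (f ((h *: (1 : R^o) + s) *: v + x) - f (s *: v + x))) =
  (fun h => h^-1 *: (f (h *: v + (s *: v + x)) - f (s *: v + x))).
  by apply/funext => h; rewrite [X in (X + s) *: v]mulr1 scalerDl addrA.
have dv : derivable f (s *: v + x) v by exact: diff_derivable.
apply: DeriveDef; first by rewrite /derivable/= E.
by rewrite /derive E.
Qed.

Lemma mean_value_line (f : 'rV[R]_n -> R^o) (v x : 'rV[R]_n) (h : R) :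
  0 < h -> (forall s, 0 <= s <= h -> differentiable f (s *: v + x)) ->
  exists c, 0 < c < h /\ f (h *: v + x) - f x = h * 'D_v f (c *: v + x).
Proof.
move=> h0 df.
have [] := @MVT R (fun s : R => f (s *: v + x)) (fun s => 'D_v f (s *: v + x)) 0 h h0.
- move=> s; rewrite in_itv/= => /andP[s0 sh]; apply: derive_line.
  by apply: df; rewrite !ltW.
- apply: derivable_within_continuous => s; rewrite in_itv/= => sh.
  by have [] := derive_line (df s sh).
move=> c; rewrite in_itv/= => c0h E; exists c; split=> //.
by move: E; rewrite scale0r add0r subr0 => ->; rewrite mulrC.
Qed.

Lemma near_ball_line O i (x0 : 'rV[R]_n) : nbhs x0 O ->
  \forall x \near x0 & h \near (0 : R), O (h *: std_vec i + x).
Proof.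
move=> /nbhs_ballP[d /= d0 dO].
exists (ball x0 (d / 2), ball (0 : R) (d / 2)); first by
  split; apply: nbhsx_ballx; rewrite divr_gt0.
move=> [x h]; rewrite /= -!ball_normE /= sub0r normrN => -[xd hd]; apply: dO.
rewrite -ball_normE /= opprD addrCA addrC.
rewrite (le_lt_trans (ler_normB _ _))// [ltRHS]splitr ltr_leD//.
rewrite normrZ (le_trans _ (ltW hd))// -[leRHS]mulr1 ler_wpM2l//.
exact: norm_std_vec_le1.
Qed.

(** The mean value theorem turns the quotient into a derivative at a nearby point; compactness makes
    the continuity of that derivative uniform. *)
Lemma uniform_difference_quotient (eta : 'rV[R]_n -> R^o) B i (e : R) :
  smooth_on setT eta -> compact B -> 0 < e ->
  \forall h \near 0^'+, B `<=` [set x |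
    `|(eta (h *: std_vec i + x) - eta x) / h - 'D_(std_vec i) eta x| <= e].
Proof.
move=> se cB e0.
have [deta /(_ (std_vec i)) cD] := se 1%N.
apply: (iffLR (compact_near_coveringP B)) => // x0 _.
have /cvgr_dist_le/(_ _ (divr_gt0 e0 (@ltr0n R 2))) := cD x0 I.
move=> /(near_ball_line i)[[U V] [/= x0U V0] UV].
have V0' : \forall h \near (0 : R)^'+, forall c, 0 <= c <= h -> V c.
  have /nbhs_ballP[d /= d0 dV] := V0.
  near=> h => c /andP[c0 ch]; apply: dV; rewrite -ball_normE /= sub0r normrN.
  by rewrite ger0_norm// (le_lt_trans ch)//; near: h; exact: nbhs_right_lt.
exists (U, [set h | 0 < h /\ forall c, 0 <= c <= h -> V c]).
  by split => //; near=> h; split; [near: h; exact: nbhs_right_gt|near: h].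
move=> [x h] /= [Ux [h0 hV]].
have [c [/andP[c0 ch] ->]] :=
    mean_value_line (x := x) h0 (fun s _ => deta (s *: std_vec i + x) I).
rewrite mulrAC mulfV ?gt_eqF// mul1r.
have Vc : V c by apply: hV; rewrite !ltW.
have V00 : V 0 by apply: hV; rewrite lexx ltW.
have /= {}Vc := UV (x, c) (conj Ux Vc).
have /= := UV (x, 0) (conj Ux V00).
rewrite scale0r add0r => {}V00.
rewrite -[X in X - _](subrK ('D_(std_vec i) eta x0)) -addrA.
by rewrite (le_trans (ler_normD _ _))// [leRHS]splitr lerD// distrC.
Unshelve. all: by end_near. Qed.

(** The translation carries [K] into [B], and [F] vanishes on the part of [B] that is not
    reached. *)
Lemma Rintegral_shift B K (v : 'rV[R]_n) F :
  measurable (row @^-1` K) -> measurable (row @^-1` B) ->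
  mu.-integrable (row @^-1` B) (fun t => (F (row t))%:E) ->
  mu.-integrable (row @^-1` K) (fun t => (F (row t - v))%:E) ->
  (forall x, K x -> B (x - v)) -> (forall y, B y -> ~ K (y + v) -> F y = 0) ->
  \int[mu]_(t in row @^-1` K) F (row t - v) = \int[mu]_(t in row @^-1` B) F (row t).
Proof.
move=> mK mB iB iK KB F0; rewrite /Rintegral; congr fine.
pose f := (fun t => (F (row t))%:E) \_ (row @^-1` B).
have E : f \o tuple_shift (- v) = (fun t => (F (row t - v))%:E) \_ (row @^-1` K).
  apply/funext => t; rewrite /f /= !patchE.
  case: ifPn => [/set_mem tB|/negP tB]; case: ifPn => [/set_mem tK|/negP tK] //.
  - by rewrite row_of_tuple_shift.
  - by rewrite F0// row_of_tuple_shift subrK => h; apply: tK; exact/mem_set.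
  - by exfalso; apply/tB/mem_set; rewrite /= row_of_tuple_shift; exact: KB.
rewrite integral_mkcond [RHS]integral_mkcond -E.
apply: integral_tuple_shift.
  by have /integrableP[] := (integrable_mkcond _ mB).1 iB.
by rewrite E; exact/(integrable_mkcond _ mK).1.
Qed.

(** Translation moves the quotient from [f], which is merely continuous, to [eta], whose quotients
    converge uniformly. The increment of [f] goes backwards, so weakly the quotient is minus the
    partial derivative; hence no sign in the limit. *)
Lemma cvg_difference_quotient O i f (eta : 'rV[R]_n -> R^o) K :
  open O -> continuous_on O f -> smooth_on setT eta ->
  compact K -> K `<=` O -> support_of eta `<=` K ->
  (fun h => \int[mu]_(t in row @^-1` K)
     ((f (row t - h *: std_vec i) - f (row t)) / h * eta (row t))) @ 0^'+ -->
  \int[mu]_(t in row @^-1` K) (f (row t) * 'D_(std_vec i) eta (row t)).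
Proof.
move=> oO cf se cK KO sK.
set e := std_vec i.
have [d d0 dO] : exists2 d : R, 0 < d & forall s x, `|s| < d -> K x -> O (x - s *: e).
  have : \forall s \near (0 : R), K `<=` [set x | O (s *: e + x)].
    have nc := iffLR (compact_near_coveringP K) cK R (nbhs (0 : R))
      (fun s x => O (s *: e + x)) _.
    apply: nc => x /KO Ox.
    exact: (@near_ball_line O i x (open_nbhs_nbhs (conj oO Ox))).
  move=> /nbhs_ballP[d /= d0 dO]; exists d => // s x sd Kx.
  rewrite addrC -scaleNr; apply: (dO (- s)) => //.
  by rewrite -ball_normE /= sub0r opprK.
(* [B] is [K] swept by all translations of size at most d/2: still a compact subset of [O], and
   containing the support of every translate of [eta] that occurs. *)
pose B := (fun z : 'rV[R]_n * R => z.1 - z.2 *: e) @` (K `*` `[0, d / 2]).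
have cB : compact B.
  apply: continuous_compact.
    apply: continuous_subspaceT => z; apply: cvgB; first exact: cvg_fst.
    by apply: cvgZr_tmp; exact: cvg_snd.
  by apply: compact_setX => //; exact: segment_compact.
have BO : B `<=` O.
  move=> _ [[x s] /= [Kx sI] <-].
  move: sI; rewrite in_itv/= => /andP[s0 sd].
  by apply: dO => //; rewrite ger0_norm//; lra.
have KB : K `<=` B.
  move=> x Kx; exists (x, 0) => /=; last by rewrite scale0r subr0.
  by split => //; rewrite in_itv/= lexx divr_ge0// ltW.
have mB := compact_measurable_row cB.
have mK := compact_measurable_row cK.
have [deta /(_ e) cD] := se 1%N.
have ceta := smooth_continuous se.
have outK g x : ~ K x -> g x * eta x = 0.
  by move=> nKx; rewrite (support_of_eq0 (contra_not (@sK x) nKx)) mulr0.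
have -> : \int[mu]_(t in row @^-1` K) (f (row t) * 'D_e eta (row t)) =
    \int[mu]_(t in row @^-1` B) (f (row t) * 'D_e eta (row t)).
  rewrite /Rintegral (integral_compact_support
    (F := fun x => f x * 'D_e eta x) KB)// => x _ nKx.
  by rewrite (derive_support _ (contra_not (@sK x) nKx)) mulr0.
have [M [M0 fM]] : exists M, 0 < M /\ forall x, B x -> `|f x| <= M.
  by apply: near_compact_bounded => // x /BO; exact: cf.
pose m := fine (mu (row @^-1` B)).
have Bfin := compact_lebesgue_tuple_fin cB.
have m0 : 0 <= m by exact: fine_ge0.
have iB1 : mu.-integrable (row @^-1` B) (fun t => (f (row t) * 'D_e eta (row t))%:E).
  apply: (integrable_continuous_on (F := fun x => f x * 'D_e eta x) oO) => // x Ox.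
  exact: (continuousM (cf x Ox) (cD x I)).
have shiftc (v : 'rV[R]_n) : continuous (fun x : 'rV[R]_n => x + v).
  move=> x; have ci : {for x, continuous (@id 'rV[R]_n)} by exact: cvg_id.
  exact: (continuousD ci (@cst_continuous _ _ v x)).
apply/cvgrPdist_le => eps eps0.
(* [m + 1] instead of [m], as [B] may have measure zero. *)
have M1 : 0 < M * (m + 1) by rewrite mulr_gt0// ltr_wpDl.
near=> h.
have h0 : 0 < h by near: h; exact: nbhs_right_gt.
have hd : h < d / 2 by near: h; apply: nbhs_right_lt; rewrite divr_gt0.
have oOh : open (O `&` (fun x => x - h *: e) @^-1` O).
  by apply: openI => //; apply: open_comp => // x _; exact: (shiftc (- (h *: e))).
have KOh : K `<=` O `&` (fun x => x - h *: e) @^-1` O.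
  move=> x Kx; split; first exact: KO.
  by apply: dO => //; rewrite gtr0_norm//; lra.
have iK1 : mu.-integrable (row @^-1` K)
    (fun t => (f (row t - h *: e) * eta (row t))%:E).
  apply: (integrable_continuous_on (F := fun x => f (x - h *: e) * eta x) oOh) => //.
  move=> x [Ox Ohx]; apply: (continuousM _ (ceta x)).
  by apply: continuous_comp; [exact: (shiftc (- (h *: e)))|exact: cf].
have iK2 : mu.-integrable (row @^-1` K) (fun t => (f (row t) * eta (row t))%:E).
  apply: (integrable_continuous_on (F := fun x => f x * eta x) oO) => // x Ox.
  exact: (continuousM (cf x Ox) (ceta x)).
have iB2 : mu.-integrable (row @^-1` B) (fun t => (f (row t) * eta (row t))%:E).
  apply: (integrable_continuous_on (F := fun x => f x * eta x) oO) => // x Ox.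
  exact: (continuousM (cf x Ox) (ceta x)).
have iB3 : mu.-integrable (row @^-1` B)
    (fun t => (f (row t) * eta (row t + h *: e))%:E).
  apply: (integrable_continuous_on (F := fun x => f x * eta (x + h *: e)) oO) => // x Ox.
  apply: (continuousM (cf x Ox)).
  by apply: continuous_comp; [exact: shiftc|exact: ceta].
have E1 : \int[mu]_(t in row @^-1` K) (f (row t - h *: e) * eta (row t)) =
    \int[mu]_(t in row @^-1` B) (f (row t) * eta (row t + h *: e)).
  rewrite -(Rintegral_shift (v := h *: e) (K := K)
    (F := fun x => f x * eta (x + h *: e)))//.
  - by apply: eq_Rintegral => t _; rewrite subrK.
  - by apply: eq_integrable iK1 => // t _; rewrite subrK.
  - move=> x Kx; exists (x, h) => //=; split => //.
    by rewrite in_itv/= !ltW.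
  - by move=> y _ nK; rewrite (support_of_eq0 (contra_not (@sK _) nK)) mulr0.
have E2 : \int[mu]_(t in row @^-1` K) (f (row t) * eta (row t)) =
    \int[mu]_(t in row @^-1` B) (f (row t) * eta (row t)).
  rewrite /Rintegral -(integral_compact_support
    (F := fun x => f x * eta x) KB)// => x _ nKx; exact: outK.
have -> : \int[mu]_(t in row @^-1` K)
     ((f (row t - h *: e) - f (row t)) / h * eta (row t)) =
   \int[mu]_(t in row @^-1` B)
     (h^-1 * (f (row t) * eta (row t + h *: e) - f (row t) * eta (row t))).
  under eq_Rintegral do rewrite mulrAC mulrC mulrBl.
  rewrite RintegralZl//; last exact: integrableB_EFin.
  rewrite RintegralZl//; last exact: integrableB_EFin.
  by rewrite RintegralB// RintegralB// E1 E2.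
have iB4 : mu.-integrable (row @^-1` B) (fun t =>
    (h^-1 * (f (row t) * eta (row t + h *: e) - f (row t) * eta (row t)))%:E).
  by apply: integrableZl_EFin => //; exact: integrableB_EFin.
rewrite -RintegralB//.
apply: le_trans (le_normr_Rintegral _ _) _ => //; first exact: integrableB_EFin.
apply: (@le_trans _ _ (\int[mu]_(t in row @^-1` B) (eps / (m + 1)))).
  apply: le_Rintegral => //.
  - by apply: integrable_normr_EFin => //; exact: integrableB_EFin.
  - exact: integrable_cst.
  - move=> t Bt.
    have : B `<=` [set x |
      `|(eta (h *: e + x) - eta x) / h - 'D_e eta x| <= eps / (M * (m + 1))].
      near: h; apply: uniform_difference_quotient => //.
      by rewrite divr_gt0.
    move=> /(_ _ Bt) /= dh.
    have -> : f (row t) * 'D_e eta (row t) -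
       h^-1 * (f (row t) * eta (row t + h *: e) - f (row t) * eta (row t)) =
       - (f (row t) * ((eta (h *: e + row t) - eta (row t)) / h - 'D_e eta (row t))).
      rewrite [h *: e + _]addrC.
      by move: (f _) (eta _) (eta _) ('D_e eta _) => ? ? ? ?; ring.
    rewrite normrN normrM (le_trans (ler_pM _ _ (fM _ Bt) dh))//.
    by rewrite invfM mulrCA mulVKf ?gt_eqF.
rewrite Rintegral_cst// -/m -mulrA ler_piMr ?(ltW eps0)//.
by rewrite mulrC ler_pdivrMr ?mul1r ?lerDl// ltr_wpDl.
Unshelve. all: by end_near. Qed.

End difference_quotient.

(** * The chain rule for weak derivatives *)

Section weak_chain_rule.
Context {R : realType} {n : nat}.
Local Notation mu := (lebesgue_tuple R n).
Local Notation row := (@row_of_tuple R n).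
Local Notation mR := (measurableTypeR R).
Implicit Types (O K B : set 'rV[R]_n) (f F G : 'rV[R]_n -> R) (i : 'I_n).
Local Notation quot f i h x := ((f (x - h *: std_vec i) - f x) / h).

Lemma near_sub_line O i (x0 : 'rV[R]_n) : nbhs x0 O ->
  \forall x \near x0 & h \near (0 : R)^'+, O (x - h *: std_vec i).
Proof.
move=> /(near_ball_line i)[[U V] [/= x0U /nbhs_ballP[d /= d0 dV]] UV].
exists (U, [set h | 0 < h < d]).
  split => //=; near=> h; apply/andP; split; near: h.
    exact: nbhs_right_gt.
  exact: nbhs_right_lt.
move=> [x h] /= [Ux /andP[h0 hd]]; rewrite addrC -scaleNr.
apply: (UV (x, - h)); split => //=; apply: dV.
by rewrite -ball_normE /= sub0r opprK gtr0_norm.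
Unshelve. all: by end_near. Qed.

Lemma norm_sub_line i (x : 'rV[R]_n) (h : R) : 0 < h ->
  `|(x - h *: std_vec i) - x| <= h.
Proof.
move=> h0; rewrite addrAC subrr add0r normrN normrZ gtr0_norm//.
by rewrite -[leRHS]mulr1 ler_pM2l// norm_std_vec_le1.
Qed.

Lemma near_sub_line_compact O i K : open O -> compact K -> K `<=` O ->
  \forall h \near (0 : R)^'+, K `<=` [set x | O (x - h *: std_vec i)].
Proof.
move=> oO cK KO.
have nc := iffLR (compact_near_coveringP K) cK R (0 : R)^'+
  (fun h x => O (x - h *: std_vec i)) _.
apply: nc => x /KO Ox; apply: near_sub_line; exact: open_nbhs_nbhs.
Qed.

Lemma near_quotient_integrable O i K f F : open O -> compact K -> K `<=` O ->
  continuous_on O f -> continuous_on O F ->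
  \forall h \near (0 : R)^'+, mu.-integrable (row @^-1` K)
    (fun t => (quot f i h (row t) * F (row t))%:E).
Proof.
move=> oO cK KO cf cF.
have := near_sub_line_compact i oO cK KO; apply: filterS => h Kh.
have sc : continuous (fun x : 'rV[R]_n => x - h *: std_vec i).
  move=> x; have ci : {for x, continuous (@id 'rV[R]_n)} by exact: cvg_id.
  exact: (continuousD ci (@cst_continuous _ _ (- (h *: std_vec i)) x)).
have oOh : open (O `&` (fun x => x - h *: std_vec i) @^-1` O).
  by apply: openI => //; apply: open_comp => // x _; exact: sc.
apply: (integrable_continuous_on (F := fun x => quot f i h x * F x) oOh) => //.
  by move=> x Kx; split; [exact: KO|exact: Kh].
move=> x [Ox Ohx].
have cs : {for x, continuous (fun x : 'rV[R]_n => f (x - h *: std_vec i))}.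
  by apply: continuous_comp; [exact: sc|exact: cf].
exact: (continuousM (continuousM (continuousB cs (cf x Ox))
  (@cst_continuous _ _ h^-1 x)) (cF x Ox)).
Qed.

(** The compactness argument runs along pairs, with the bound tending to infinity while the step
    tends to 0 from the right, so that a single cover delivers both. *)
Lemma near_quotient_bounded O i K f : open O -> compact K -> K `<=` O ->
  locally_lipschitz O f -> exists2 L : R, 0 < L &
  \forall h \near (0 : R)^'+, forall x, K x -> `|quot f i h x| <= L.
Proof.
move=> oO cK KO lf.
have nc := iffLR (compact_near_coveringP K) cK (R * R)%type
  (filter_prod (pinfty_nbhs R) (0 : R)^'+)
  (fun Lh x => `|quot f i Lh.2 x| <= Lh.1) _.
have : \forall Lh \near (filter_prod (pinfty_nbhs R) (0 : R)^'+),
    K `<=` [set x | `|quot f i Lh.2 x| <= Lh.1].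
  apply: nc => x0 /KO /lf[L [[U V] /= [x0U x0V] UV]].
  have [[U' V'] /= [x0U' V0] UV'] := near_sub_line i x0U.
  exists (U' `&` V, [set Lh | L < Lh.1 /\ 0 < Lh.1 /\ 0 < Lh.2 /\ V' Lh.2]) => /=.
    split; first exact: filterI.
    exists ([set l | L < l /\ 0 < l], [set h | 0 < h /\ V' h]) => /=.
      split; near=> h; split; near: h => //.
      - by apply: nbhs_pinfty_gt; rewrite num_real.
      - exact: nbhs_pinfty_gt.
      - exact: nbhs_right_gt.
    by move=> [l h] /= [[] ? ? []].
  move=> [x [l h]] /= [[U'x Vx] [Ll [l0 [h0 V'h]]]].
  rewrite normrM normfV (gtr0_norm h0) ler_pdivrMr//.
  apply: (@le_trans _ _ (L * `|x - h *: std_vec i - x|)).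
    by apply: (UV (_, _)); split => //=; exact: (UV' (x, h)).
  rewrite (@le_trans _ _ (l * `|x - h *: std_vec i - x|)) ?ler_wpM2r ?(ltW Ll)//.
  by rewrite ler_pM2l// norm_sub_line.
move=> [[U V] /= [Uoo V0] UV].
have [L [L0 UL]] : exists L, 0 < L /\ U L.
  near (pinfty_nbhs R) => L; exists L; split; near: L => //.
  exact: nbhs_pinfty_gt.
exists L => //; move: V0; apply: filterS => h Vh x Kx.
by have /(_ x Kx) := UV (L, h) (conj UL Vh).
Unshelve. all: by end_near. Qed.

(** For smooth [G] this is the previous limit with [G * eta] as test function. A continuous [G] is
    approximated uniformly by a smooth [P]; the error is controlled because the quotients of [f] are
    bounded by [L] and [df] is integrable, whence the majorant [|df| + L]. *)
Lemma cvg_quotient_weak_partial O i f df G (eta : 'rV[R]_n -> R^o) K :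
  open O -> locally_lipschitz O f -> weak_partial O i f df ->
  continuous_on O G -> smooth_on setT eta ->
  compact K -> K `<=` O -> support_of eta `<=` K ->
  (fun h => \int[mu]_(t in row @^-1` K)
     (quot f i h (row t) * (G (row t) * eta (row t)))) @ 0^'+ -->
  - \int[mu]_(t in row @^-1` K) (df (row t) * (G (row t) * eta (row t))).
Proof.
move=> oO lf fdf cG se cK KO sK.
have cf := locally_lipschitz_continuous lf.
have [di fD] := (weak_partialE i df oO cf).1 fdf.
have mK := compact_measurable_row cK.
have Kfin := compact_lebesgue_tuple_fin cK.
have ceta : continuous_on O eta by move=> x _; exact: smooth_continuous.
have [M [M0 eM]] : exists M, 0 < M /\ forall x, K x -> `|eta x| <= M.
  by apply: near_compact_bounded => // x /KO; exact: ceta.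
have [L L0 fL] := near_quotient_bounded i oO cK KO lf.
pose A := \int[mu]_(t in row @^-1` K) (`|df (row t)| + L).
have iA : mu.-integrable (row @^-1` K) (fun t => (`|df (row t)| + L)%:E).
  by apply: integrableD_EFin; [|apply/integrable_normr_EFin/di|exact: integrable_cst].
have A0 : 0 <= A by apply: Rintegral_ge0 => t _; rewrite addr_ge0// ltW.
apply/cvgrPdist_le => eps eps0.
have D0 : 0 < eps / 2 / (M * (A + 1)).
  by rewrite !divr_gt0// mulr_gt0// ltr_wpDl.
have [P [sP PG]] := smooth_approx cK (fun x Kx => cG x (KO x Kx)) D0.
have sPe : smooth_on setT ((fun x => (P x : R) * (eta x : R)) : _ -> R^o).
  exact: (smoothM sP se).
have sPeK : support_of (fun x => (P x : R) * (eta x : R)) `<=` K.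
  apply: subset_trans sK; apply: closure_subset => x /=.
  by apply: contra_neq => ->; rewrite mulr0.
have cP : continuous_on O P by move=> x _; exact: smooth_continuous.
have cPe : continuous_on O (fun x => (P x : R) * eta x).
  move=> x Ox.
  exact: (@continuousM _ _ (P : _ -> R) (eta : _ -> R) x (cP x Ox) (ceta x Ox)).
have cGe : continuous_on O (fun x => G x * eta x).
  move=> x Ox.
  exact: (@continuousM _ _ G (eta : _ -> R) x (cG x Ox) (ceta x Ox)).
have eps2 : 0 < eps / 2 by rewrite divr_gt0.
have /cvgrPdist_le/(_ _ eps2) := cvg_difference_quotient (i := i) oO cf sPe cK KO sPeK.
rewrite (fD _ _ sPe cK KO sPeK) => nDQ.
have iP : mu.-integrable (row @^-1` K)
    (fun t => (df (row t) * ((P (row t) : R) * eta (row t)))%:E).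
  exact: (integrable_continuousM (G := fun x => (P x : R) * eta x) oO cK KO cPe (di _ cK KO)).
have iG : mu.-integrable (row @^-1` K)
    (fun t => (df (row t) * (G (row t) * eta (row t)))%:E).
  exact: (integrable_continuousM (G := fun x => G x * eta x) oO cK KO cGe (di _ cK KO)).
near=> h.
have iqP : mu.-integrable (row @^-1` K)
    (fun t => (quot f i h (row t) * ((P (row t) : R) * eta (row t)))%:E).
  near: h.
  exact: (near_quotient_integrable i (F := fun x => (P x : R) * eta x) oO cK KO cf cPe).
have iqG : mu.-integrable (row @^-1` K)
    (fun t => (quot f i h (row t) * (G (row t) * eta (row t)))%:E).
  near: h.
  exact: (near_quotient_integrable i (F := fun x => G x * eta x) oO cK KO cf cGe).
have hL : forall x, K x -> `|quot f i h x| <= L by near: h; exact: fL.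
have : `|(- \int[mu]_(t in row @^-1` K) (df (row t) * ((P (row t) : R) * eta (row t)))) -
    \int[mu]_(t in row @^-1` K) (quot f i h (row t) * ((P (row t) : R) * eta (row t)))|
    <= eps / 2 by near: h; exact: nDQ.
set a := \int[mu]_(t in _) _; set b := \int[mu]_(t in _) _.
set a' := \int[mu]_(t in _) _; set b' := \int[mu]_(t in _) _ => ab.
have : `|(a + b) - (a' + b')| <= eps / 2.
  have -> : (a + b) - (a' + b') = \int[mu]_(t in row @^-1` K)
     ((df (row t) + quot f i h (row t)) * (((P (row t) : R) - G (row t)) * eta (row t))).
    rewrite /a /b /a' /b' -!RintegralD// -RintegralB//; first last.
    - exact: integrableD_EFin.
    - exact: integrableD_EFin.
    by apply: eq_Rintegral => t _; ring.
  apply: le_trans (le_normr_Rintegral _ _) _ => //.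
    have := integrableB_EFin mK (integrableD_EFin mK iP iqP)
      (integrableD_EFin mK iG iqG).
    by apply: eq_integrable => // t _; congr (_%:E); ring.
  apply: (@le_trans _ _ (\int[mu]_(t in row @^-1` K)
     ((eps / 2 / (A + 1)) * (`|df (row t)| + L)))).
    apply: le_Rintegral => //.
    - apply: integrable_normr_EFin => //.
      have := integrableB_EFin mK (integrableD_EFin mK iP iqP)
        (integrableD_EFin mK iG iqG).
      by apply: eq_integrable => // t _; congr (_%:E); ring.
    - exact: integrableZl_EFin.
    - move=> t Kt; rewrite normrM mulrC; apply: ler_pM => //.
        rewrite normrM.
        apply: (le_trans (ler_pM _ _ (PG _ Kt) (eM _ Kt))) => //.
        by rewrite invfM mulrAC mulrA mulfK ?gt_eqF.
      by rewrite (le_trans (ler_normD _ _))// lerD2l hL.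
  rewrite RintegralZl// -/A mulrAC ler_pdivrMr ?ltr_wpDl//.
  by rewrite ler_wpM2l ?(ltW eps2)// lerDl.
move: ab; rewrite !ler_norml => /andP[? ?] /andP[? ?].
by apply/andP; split; lra.
Unshelve. all: by end_near. Qed.

(* The hypothesis on psi is local, so that no partition of unity is needed. *)
Lemma weak_partial_chain O i (f1 f2 f3 df1 df2 df3 G1 G2 G3 psi : 'rV[R]_n -> R) :
  open O ->
  locally_lipschitz O f1 -> locally_lipschitz O f2 -> locally_lipschitz O f3 ->
  weak_partial O i f1 df1 -> weak_partial O i f2 df2 -> weak_partial O i f3 df3 ->
  continuous_on O G1 -> continuous_on O G2 -> continuous_on O G3 ->
  continuous_on O psi ->
  (forall x0, O x0 -> forall e : R, 0 < e -> \forall x \near x0 & y \near x0,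
    `|psi y - psi x - (G1 x * (f1 y - f1 x) + G2 x * (f2 y - f2 x) +
                       G3 x * (f3 y - f3 x))| <= e * `|y - x|) ->
  weak_partial O i psi (fun x => G1 x * df1 x + G2 x * df2 x + G3 x * df3 x).
Proof.
move=> oO l1 l2 l3 w1 w2 w3 c1 c2 c3 cpsi hpsi.
have cf1 := locally_lipschitz_continuous l1.
have cf2 := locally_lipschitz_continuous l2.
have cf3 := locally_lipschitz_continuous l3.
have [d1 _] := w1; have [d2 _] := w2; have [d3 _] := w3.
have ci (G df : 'rV[R]_n -> R) K : compact K -> K `<=` O -> continuous_on O G ->
    mu.-integrable (row @^-1` K) (fun t => (df (row t))%:E) ->
    mu.-integrable (row @^-1` K) (fun t => (G (row t) * df (row t))%:E).
  move=> cK KO cG di; have := integrable_continuousM oO cK KO cG di.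
  apply: eq_integrable; first exact: compact_measurable_row.
  by move=> t _; rewrite mulrC.
apply/(weak_partialE i _ oO cpsi); split.
  move=> K cK KO; have mK := compact_measurable_row cK.
  apply: integrableD_EFin => //; first apply: integrableD_EFin => //.
  - by apply: ci => //; exact: d1.
  - by apply: ci => //; exact: d2.
  - by apply: ci => //; exact: d3.
move=> eta K se cK KO sK.
have mK := compact_measurable_row cK.
have ceta : continuous_on O eta by move=> x _; exact: smooth_continuous.
have cGe (G : 'rV[R]_n -> R) : continuous_on O G ->
    continuous_on O (fun x => G x * eta x).
  move=> cG x Ox.
  exact: (@continuousM _ _ G (eta : _ -> R) x (cG x Ox) (ceta x Ox)).
have iGe (G df : 'rV[R]_n -> R) : continuous_on O G ->
    (forall K, compact K -> K `<=` O ->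
       mu.-integrable (row @^-1` K) (fun t => (df (row t))%:E)) ->
    mu.-integrable (row @^-1` K)
      (fun t => (df (row t) * (G (row t) * eta (row t)))%:E).
  move=> cG di.
  exact: (integrable_continuousM (G := fun x => G x * eta x) oO cK KO (cGe _ cG) (di _ cK KO)).
have -> : (- \int[mu]_(t in row @^-1` K)
    ((G1 (row t) * df1 (row t) + G2 (row t) * df2 (row t) +
      G3 (row t) * df3 (row t)) * eta (row t))) =
   (- \int[mu]_(t in row @^-1` K) (df1 (row t) * (G1 (row t) * eta (row t)))) +
   (- \int[mu]_(t in row @^-1` K) (df2 (row t) * (G2 (row t) * eta (row t)))) +
   (- \int[mu]_(t in row @^-1` K) (df3 (row t) * (G3 (row t) * eta (row t)))).
  rewrite -!opprD; congr (- _).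
  have i1 := iGe _ _ c1 d1; have i2 := iGe _ _ c2 d2; have i3 := iGe _ _ c3 d3.
  rewrite -RintegralD// -RintegralD//; last exact: integrableD_EFin.
  by apply: eq_Rintegral => t _; ring.
have := cvg_difference_quotient (i := i) oO cpsi se cK KO sK.
set I0 := \int[mu]_(t in _) _ => cvg0.
(* Discrete integration by parts gives one limit of the quotients of [psi]; the claim follows by
   computing the same limit a second time. *)
transitivity (lim ((fun h => \int[mu]_(t in row @^-1` K)
    (quot psi i h (row t) * eta (row t))) @ 0^'+)); first exact/esym/cvg_lim.
apply: cvg_lim => //.
have := cvgD (cvgD (cvg_quotient_weak_partial oO l1 w1 c1 se cK KO sK)
  (cvg_quotient_weak_partial oO l2 w2 c2 se cK KO sK))
  (cvg_quotient_weak_partial oO l3 w3 c3 se cK KO sK).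
move=> /(_ _ _)/(_ _ _); set J := (X in _ --> X); set Q := (X in X @ _) => cvgQ.
(* [Q] is the combination of the three quotients, with known limit [J]. The first-order hypothesis
   on [psi], made uniform on [K], shows that it differs from the quotient of [psi] by a vanishing
   amount. *)
suff cvgpsiQ : ((fun h => \int[mu]_(t in row @^-1` K)
    (quot psi i h (row t) * eta (row t))) - Q) @ 0^'+ --> (0 : R).
  exact: (cvg_sub0 cvgpsiQ cvgQ).
have [M [M0 eM]] : exists M, 0 < M /\ forall x, K x -> `|eta x| <= M.
  by apply: near_compact_bounded => // x /KO; exact: ceta.
pose m := fine (mu (row @^-1` K)).
have Kfin := compact_lebesgue_tuple_fin cK.
have m0 : 0 <= m by exact: fine_ge0.
apply/cvgrPdist_le => eps eps0.
have D0 : 0 < eps / (M * (m + 1)) by rewrite divr_gt0// mulr_gt0// ltr_wpDl.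
near=> h.
have h0 : 0 < h by near: h; exact: nbhs_right_gt.
have iq1 : mu.-integrable (row @^-1` K)
    (fun t => (quot f1 i h (row t) * (G1 (row t) * eta (row t)))%:E).
  near: h; exact: (near_quotient_integrable i
    (F := fun x => G1 x * eta x) oO cK KO cf1 (cGe _ c1)).
have iq2 : mu.-integrable (row @^-1` K)
    (fun t => (quot f2 i h (row t) * (G2 (row t) * eta (row t)))%:E).
  near: h; exact: (near_quotient_integrable i
    (F := fun x => G2 x * eta x) oO cK KO cf2 (cGe _ c2)).
have iq3 : mu.-integrable (row @^-1` K)
    (fun t => (quot f3 i h (row t) * (G3 (row t) * eta (row t)))%:E).
  near: h; exact: (near_quotient_integrable i
    (F := fun x => G3 x * eta x) oO cK KO cf3 (cGe _ c3)).
have iqp : mu.-integrable (row @^-1` K)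
    (fun t => (quot psi i h (row t) * eta (row t))%:E).
  near: h.
  exact: (near_quotient_integrable i (F := eta : _ -> R) oO cK KO cpsi ceta).
have iq12 := integrableD_EFin mK iq1 iq2.
have iq123 := integrableD_EFin mK iq12 iq3.
rewrite sub0r normrN -[X in `|X|]/(
  (\int[mu]_(t in row @^-1` K) (quot psi i h (row t) * eta (row t))) -
  ((\int[mu]_(t in row @^-1` K) (quot f1 i h (row t) * (G1 (row t) * eta (row t)))) +
   (\int[mu]_(t in row @^-1` K) (quot f2 i h (row t) * (G2 (row t) * eta (row t)))) +
   (\int[mu]_(t in row @^-1` K) (quot f3 i h (row t) * (G3 (row t) * eta (row t)))))).
rewrite -RintegralD// -RintegralD// -RintegralB//.
apply: le_trans (le_normr_Rintegral _ _) _ => //; first exact: integrableB_EFin.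
apply: (@le_trans _ _ (\int[mu]_(t in row @^-1` K) (eps / (m + 1)))).
  apply: le_Rintegral => //.
  - by apply: integrable_normr_EFin => //; exact: integrableB_EFin.
  - exact: integrable_cst.
  - move=> t Kt.
    have : K `<=` [set x |
      `|psi (x - h *: std_vec i) - psi x -
         (G1 x * (f1 (x - h *: std_vec i) - f1 x) +
          G2 x * (f2 (x - h *: std_vec i) - f2 x) +
          G3 x * (f3 (x - h *: std_vec i) - f3 x))| <= eps / (M * (m + 1)) * h].
      near: h.
      have nc := iffLR (compact_near_coveringP K) cK R (0 : R)^'+
        (fun h x => `|psi (x - h *: std_vec i) - psi x -
         (G1 x * (f1 (x - h *: std_vec i) - f1 x) +
          G2 x * (f2 (x - h *: std_vec i) - f2 x) +
          G3 x * (f3 (x - h *: std_vec i) - f3 x))| <= eps / (M * (m + 1)) * h) _.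
      apply: nc => x0 /KO Ox0.
      have [[U V] /= [x0U x0V] UV] := hpsi _ Ox0 _ D0.
      have [[U' V'] /= [x0U' V'0] UV'] := near_sub_line i x0V.
      exists (U `&` U', [set h | 0 < h /\ V' h]) => /=.
        by split; [exact: filterI|near=> k; split; near: k => //; exact: nbhs_right_gt].
      move=> [x k] /= [[Ux U'x] [k0 V'k]].
      apply: (@le_trans _ _ (eps / (M * (m + 1)) * `|x - k *: std_vec i - x|)).
        by apply: (UV (x, _)); split => //=; exact: (UV' (x, k)).
      by rewrite ler_pM2l// norm_sub_line.
    move=> /(_ _ Kt) /= dh.
    set Z := (X in `|X| <= _) in dh.
    rewrite [X in `|X|](_ : _ = Z / h * eta (row t)); last by rewrite /Z; ring.
    rewrite normrM normrM normfV (gtr0_norm h0).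
    apply: (@le_trans _ _ (eps / (M * (m + 1)) * M)).
      by apply: ler_pM => //; [rewrite divr_ge0// ltW|rewrite ler_pdivrMr|exact: eM].
    by rewrite invfM mulrAC mulrA mulfK ?gt_eqF.
rewrite Rintegral_cst// -/m mulrAC ler_pdivrMr ?ltr_wpDl//.
by rewrite ler_wpM2l ?(ltW eps0)// lerDl.
Unshelve. all: by end_near. Qed.

End weak_chain_rule.

(** * Gram matrices *)

Section continuity_of_sums.
Context {R : realType} {X : topologicalType} (x : X).

Lemma continuous_at_sum (I : Type) (s : seq I) (P : pred I) (F : I -> X -> R) :
  (forall i, {for x, continuous (F i)}) ->
  {for x, continuous (fun y => \sum_(i <- s | P i) F i y)}.
Proof.
move=> cF; elim: s => [|i s ih].
  rewrite (_ : (fun y => _) = fun=> 0); first exact: cst_continuous.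
  by apply/funext => y; rewrite big_nil.
rewrite (_ : (fun y => _) = fun y =>
  (if P i then F i y else 0) + \sum_(i <- s | P i) F i y).
  apply: (@continuousD _ _ _ (fun y => if P i then F i y else 0)) => //.
  by case: (P i); [exact: cF|exact: cst_continuous].
by apply/funext => y; rewrite big_cons; case: (P i); rewrite ?add0r.
Qed.

Lemma continuous_at_prod (I : Type) (s : seq I) (P : pred I) (F : I -> X -> R) :
  (forall i, {for x, continuous (F i)}) ->
  {for x, continuous (fun y => \prod_(i <- s | P i) F i y)}.
Proof.
move=> cF; elim: s => [|i s ih].
  rewrite (_ : (fun y => _) = fun=> 1); first exact: cst_continuous.
  by apply/funext => y; rewrite big_nil.
rewrite (_ : (fun y => _) = fun y =>
  (if P i then F i y else 1) * \prod_(i <- s | P i) F i y).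
  apply: (@continuousM _ _ (fun y => if P i then F i y else 1)) => //.
  by case: (P i); [exact: cF|exact: cst_continuous].
by apply/funext => y; rewrite big_cons; case: (P i); rewrite ?mul1r.
Qed.

Lemma continuous_at_det m (A : X -> 'M[R]_m) :
  (forall i j, {for x, continuous (fun y => A y i j)}) ->
  {for x, continuous (fun y => \det (A y))}.
Proof.
move=> cA; apply: (continuous_at_sum (F := fun (s : 'S_m) y =>
  (-1) ^+ s * \prod_i A y i (s i))) => s.
exact: (continuousM (@cst_continuous _ _ ((-1) ^+ s : R) x)
  (continuous_at_prod (fun i => cA i (s i)))).
Qed.

Lemma continuous_at_adj m (A : X -> 'M[R]_m) :
  (forall i j, {for x, continuous (fun y => A y i j)}) ->
  forall i j, {for x, continuous (fun y => (\adj (A y)) i j)}.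
Proof.
move=> cA i j.
rewrite (_ : (fun y => _) = fun y => (-1) ^+ (j + i) * \det (row' j (col' i (A y)))).
  apply: (@continuousM _ _ (fun=> (-1) ^+ (j + i) : R)); first exact: cst_continuous.
  apply: continuous_at_det => k l.
  rewrite (_ : (fun y => _) = fun y => A y (lift j k) (lift i l)); first exact: cA.
  by apply/funext => y; rewrite !mxE.
by apply/funext => y; rewrite mxE.
Qed.

Lemma continuous_at_quadratic m (A : X -> 'M[R]_m) (v w : X -> 'rV[R]_m) :
  (forall i j, {for x, continuous (fun y => A y i j)}) ->
  (forall i, {for x, continuous (fun y => v y ord0 i)}) ->
  (forall i, {for x, continuous (fun y => w y ord0 i)}) ->
  {for x, continuous (fun y => (v y *m A y *m (w y)^T) ord0 ord0)}.
Proof.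
move=> cA cv cw.
rewrite (_ : (fun y => _) = fun y =>
  \sum_j (\sum_i v y ord0 i * A y i j) * w y ord0 j).
  apply: continuous_at_sum => j; apply: continuousM => //.
  by apply: continuous_at_sum => i; apply: continuousM.
by apply/funext => y; rewrite !mxE; apply: eq_bigr => j _; rewrite !mxE.
Qed.

End continuity_of_sums.

Lemma quadratic_le {R : realType} m (A : 'M[R]_m) (v : 'rV[R]_m) :
  `|(v *m A *m v^T) ord0 ord0| <= (\sum_i \sum_j `|A i j|) * `|v| ^+ 2.
Proof.
have vn i : `|v ord0 i| <= `|v|.
  rewrite [leRHS]mx_normrE.
  exact: (le_bigmax_cond _ (fun i0 : 'I_1 * 'I_m => `|v i0.1 i0.2|) (isT : xpredT (ord0, i))).
have -> : (v *m A *m v^T) ord0 ord0 = \sum_i \sum_j v ord0 i * A i j * v ord0 j.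
  rewrite exchange_big !mxE; apply: eq_bigr => j _; rewrite !mxE mulr_suml.
  by apply: eq_bigr => i _.
apply: (le_trans (ler_norm_sum _ _ _)); rewrite mulr_suml; apply: ler_sum => i _.
apply: (le_trans (ler_norm_sum _ _ _)); rewrite mulr_suml; apply: ler_sum => j _.
rewrite !normrM mulrAC mulrC ler_wpM2l// expr2.
by apply: ler_pM.
Qed.

Section frame.
Context {R : realType} {n : nat} {M : manifold R n} (g : riemannian_metric M).
Implicit Types (c : chart R n M) (p : M).

Definition transition c c' : 'rV[R]_n -> 'rV[R]_n := chart_to c' \o chart_inv c.

Definition overlap c c' : set 'rV[R]_n :=
  chart_cod c `&` chart_inv c @^-1` chart_dom c'.

Lemma overlap_open c c' : open (overlap c c').
Proof.
rewrite openE => x [cx c'x]; apply: filterI.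
  by apply: open_nbhs_nbhs; split => //; exact: chart_cod_open.
apply: (chart_inv_continuous cx).
by apply: open_nbhs_nbhs; split => //; exact: chart_dom_open.
Qed.

Lemma overlap_chart_to c c' p : chart_dom c p -> chart_dom c' p ->
  overlap c c' (chart_to c p).
Proof. by move=> cp c'p; split; [exact: chart_to_cod|rewrite /= chart_toK]. Qed.

Lemma transition_differentiable c c' x : atlas c -> atlas c' ->
  overlap c c' x -> differentiable (transition c c') x.
Proof. by move=> ac ac' Ox; have [/(_ x Ox)] := atlas_compatible ac ac' 1%N. Qed.

Lemma transitionK c c' x : overlap c c' x ->
  transition c' c (transition c c' x) = x.
Proof. by move=> [cx c'x]; rewrite /transition /= chart_toK// chart_invK. Qed.

(** The Jacobian of the transition from [c] to [chart_at p] in the row convention: [v *m frame c p]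
    is the tangent vector with coordinates [v] in [c]. *)
Definition frame c p : 'M[R]_n := \matrix_i (coord_vec c i p : 'rV[R]_n).

Lemma frameE c p (v : 'rV[R]_n) : atlas c -> chart_dom c p ->
  v *m frame c p = 'd (transition c (chart_at p)) (chart_to c p) v.
Proof.
move=> ac cp.
have dT : differentiable (transition c (chart_at p)) (chart_to c p).
  apply: transition_differentiable => //; first exact: chart_at_atlas.
  by apply: overlap_chart_to => //; exact: chart_at_dom.
rewrite [v in RHS]row_sum_delta linear_sum mulmx_sum_row; apply: eq_bigr => i _.
by rewrite linearZ/= rowK -deriveE.
Qed.

(** The differential of the reverse transition is a left inverse, so a vector in the kernel is
    zero. *)
Lemma frame_unit c p : atlas c -> chart_dom c p -> frame c p \in unitmx.
Proof.
move=> ac cp; set c' := chart_at p.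
have ac' : atlas c' by exact: chart_at_atlas.
have c'p : chart_dom c' p by exact: chart_at_dom.
have Ox : overlap c c' (chart_to c p) by exact: overlap_chart_to.
have Tx : transition c c' (chart_to c p) = chart_to c' p.
  by rewrite /transition /= chart_toK.
have dT : differentiable (transition c c') (chart_to c p).
  exact: transition_differentiable.
have dT' : differentiable (transition c' c) (transition c c' (chart_to c p)).
  by rewrite Tx; apply: transition_differentiable => //; exact: overlap_chart_to.
have dK v : 'd (transition c' c) (transition c c' (chart_to c p))
    ('d (transition c c') (chart_to c p) v) = v.
  rewrite -[LHS]/(('d (transition c' c) (transition c c' (chart_to c p)) \o
    'd (transition c c') (chart_to c p)) v) -diff_comp//.
  rewrite -deriveE; last exact: differentiable_comp.
  rewrite (near_eq_derive _ (g := id)).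
    by rewrite derive_id.
  have : nbhs (chart_to c p) (overlap c c').
    by apply: open_nbhs_nbhs; split => //; exact: overlap_open.
  by apply: filterS => y Oy; rewrite /= transitionK.
rewrite -row_free_unit -kermx_eq0; apply/eqP/row_matrixP => i.
rewrite row0; have := frameE (row i (kermx (frame c p))) ac cp.
rewrite -row_mul mulmx_ker row0 => /esym d0.
have dKi := dK (row i (kermx (frame c p))).
rewrite -[RHS](linear0 ('d (transition c' c) (transition c c' (chart_to c p)))).
by rewrite -d0; exact/esym/dKi.
Qed.

Lemma gramE c p : gram g c p = frame c p *m metric_at g p *m (frame c p)^T.
Proof.
apply/matrixP => i j; rewrite mxE /inner [LHS]mxE [RHS]mxE.
apply: eq_bigr => k _; congr (_ * _); last by rewrite !mxE.
by rewrite !mxE; apply: eq_bigr => l _; rewrite !mxE.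
Qed.

Lemma inner_frame c p (v w : 'rV[R]_n) :
  inner g (v *m frame c p : tangent p) (w *m frame c p) =
  (v *m gram g c p *m w^T) ord0 ord0.
Proof. by rewrite gramE /inner trmx_mul !mulmxA. Qed.

Lemma inner_coord c p (v : tangent p) i :
  inner g v (coord_vec c i p) = (v *m metric_at g p *m (frame c p)^T) ord0 i.
Proof.
rewrite /inner !mxE; apply: eq_bigr => k _; rewrite !mxE; congr (_ * _).
Qed.

Lemma gram_pos c p (v : 'rV[R]_n) : atlas c -> chart_dom c p -> v != 0 ->
  0 < (v *m gram g c p *m v^T) ord0 ord0.
Proof.
move=> ac cp v0; rewrite -inner_frame; apply: metric_pos.
apply: contra_neq v0 => vf0.
by rewrite -[v](mulmxK (frame_unit ac cp)) vf0 mul0mx.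
Qed.

Lemma unitmx_pos (A : 'M[R]_n) :
  (forall v : 'rV[R]_n, v != 0 -> 0 < (v *m A *m v^T) ord0 ord0) -> A \in unitmx.
Proof.
move=> A0; rewrite -row_free_unit -kermx_eq0; apply/eqP/row_matrixP => i.
rewrite row0; apply/eqP; apply: contraT => /A0.
by rewrite -row_mul mulmx_ker row0 mul0mx mxE ltxx.
Qed.

Lemma metric_unit p : metric_at g p \in unitmx.
Proof. by apply: unitmx_pos => v; exact: metric_pos. Qed.

Lemma gram_unit c p : atlas c -> chart_dom c p -> gram g c p \in unitmx.
Proof. by move=> ac cp; apply: unitmx_pos => v; exact: gram_pos. Qed.

Lemma gram_continuous c x i j : atlas c -> chart_cod c x ->
  {for x, continuous (fun y => gram g c (chart_inv c y) i j)}.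
Proof.
move=> ac cx; have /(_ x cx) := metric_smooth g ac i j 0%N.
rewrite (_ : (fun y => gram g c _ i j) = (fun y => let p := chart_inv c y in
  (coord_vec c i p *m metric_at g p *m (coord_vec c j p)^T) ord0 ord0 : R^o)) //.
by apply/funext => y; rewrite mxE.
Qed.

(** The pairing is expressed through the components that weak gradients control. The inverse Gram
    matrix appears as adjugate over determinant, which makes the continuity of its entries
    visible. *)
Lemma innerE c p (v w : tangent p) : atlas c -> chart_dom c p ->
  inner g v w = \sum_i \sum_j inner g v (coord_vec c i p) *
    ((\det (gram g c p))^-1 * (\adj (gram g c p)) i j) * inner g w (coord_vec c j p).
Proof.
move=> ac cp; set E := frame c p; set A := metric_at g p.
have uE : E \in unitmx by exact: frame_unit.
have uG := gram_unit ac cp.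
have -> : inner g v w =
    ((v *m A *m E^T) *m invmx (gram g c p) *m (w *m A *m E^T)^T) ord0 ord0.
  have uET : E^T \in unitmx by rewrite unitmx_tr.
  have uA : A \in unitmx by exact: metric_unit.
  rewrite gramE -/E -/A !trmx_mul trmxK (_ : A^T = A); last exact: Defs.metric_sym.
  have -> : invmx (E *m A *m E^T) = invmx E^T *m invmx A *m invmx E.
    apply: (can_inj (mulKmx (_ : E *m A *m E^T \in unitmx))).
      by rewrite !unitmx_mul uE uA uET.
    rewrite mulmxV ?unitmx_mul ?uE ?uA ?uET//.
    by rewrite !mulmxA mulmxK// mulmxK// mulmxV.
  by rewrite !mulmxA mulmxK// mulmxK// mulmxKV.
rewrite mxE exchange_big; apply: eq_bigr => j _.
rewrite [in RHS]inner_coord -/A -/E [((_)^T) j _]mxE -mulr_suml; congr (_ * _).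
rewrite mxE; apply: eq_bigr => i _; rewrite inner_coord; congr (_ * _).
by rewrite /invmx uG !mxE.
Qed.

End frame.

(** * Lipschitz functions for the Riemannian distance *)

Lemma near_eq_continuous_at (X Y : topologicalType) (f h : X -> Y) (x : X) :
  (\forall z \near x, f z = h z) -> {for x, continuous f} ->
  {for x, continuous h}.
Proof.
move=> E cf; have fhx : f x = h x := nbhs_singleton E.
have {}cf : f @ x --> h x by rewrite -fhx; exact: cf.
by apply: cvg_trans cf; apply: near_eq_cvg; exact: E.
Qed.

Section real_line.
Context {R : realType}.

Lemma near_derive_le (W : normedModType R) (f : R^o -> W) (t e : R) :
  derivable f t 1 -> 0 < e ->
  \forall s \near t, `|f s - f t - (s - t) *: 'D_1 f t| <= e * `|s - t|.
Proof.
move=> df e0.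
have : \forall h \near (0 : R)^',
    `|'D_1 f t - h^-1 *: (f (h *: (1 : R^o) + t) - f t)| <= e.
  have /cvgrPdist_le := df; exact.
rewrite near_withinE => /nbhs_ballP[d /= d0 dh].
apply/nbhs_ballP; exists d => //= s; rewrite -ball_normE /= => sd.
have [->|st] := eqVneq s t; first by rewrite !subrr scale0r subr0 !normr0 mulr0.
have st0 : s - t != 0 by rewrite subr_eq0.
have dst : ball (0 : R) d (s - t).
  by rewrite -ball_normE /= sub0r normrN distrC.
have := dh _ dst st0; rewrite [(_ - _) *: _]mulr1 subrK => h.
rewrite -[f s - f t](scalerKV st0) -scalerBr normrZ mulrC distrC.
by rewrite ler_wpM2r.
Qed.

(** A supremum argument: the hypothesis at the supremum of the good times shows first that it is
    good, then that it cannot lie below 1. Values are only ever compared with the one at the central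
    point. *)
Lemma local_nondecreasing_le (psi : R -> R) :
  (forall t : R, 0 <= t <= 1 -> \forall s \near t,
     (t <= s -> psi t <= psi s) /\ (s <= t -> psi s <= psi t)) ->
  psi 0 <= psi 1.
Proof.
move=> hpsi.
pose S := [set t | 0 <= t <= 1 /\ psi 0 <= psi t].
have S0 : S 0 by split; rewrite ?lexx ?ler01.
have hasS : has_sup S.
  by split; [exists 0|exists 1 => t [/andP[]]].
have s0 : 0 <= sup S by apply: ub_le_sup => //; case: hasS.
have s1 : sup S <= 1.
  by apply: sup_le_ub; [exists 0|move=> t [/andP[]]].
have s01 : 0 <= sup S <= 1 by rewrite s0 s1.
have /nbhs_ballP[d /= d0 dS] := hpsi _ s01.
have [t St ts] := sup_adherent d0 hasS.
have tS : t <= sup S by apply: ub_le_sup => //; case: hasS.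
have psiS : psi 0 <= psi (sup S).
  have [_ pt] := St; apply: (le_trans pt); apply: (dS t _).2 => //.
  by rewrite -ball_normE /= ger0_norm ?subr_ge0// ltrBlDr -ltrBlDl.
have [->|sn1] := eqVneq 1 (sup S); first by [].
have s1' : sup S < 1 by rewrite lt_neqAle eq_sym sn1.
pose s := Num.min 1 (sup S + d / 2).
have ss : sup S < s by rewrite lt_min s1' ltrDl divr_gt0.
have Ss : S s.
  split; first by rewrite (le_trans s0 (ltW ss))/= ge_min lexx.
  apply: (le_trans psiS); apply: (dS s _).1; last exact: ltW.
  rewrite -ball_normE /= distrC ger0_norm ?subr_ge0 ?(ltW ss)//.
  rewrite ltrBlDl; apply: (@le_lt_trans _ _ (sup S + d / 2)).
    by rewrite ge_min lexx orbT.
  by rewrite ltrD2l; lra.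
have : s <= sup S by apply: ub_le_sup => //; case: hasS.
by rewrite leNgt ss.
Qed.

(** A [C1_curve] is controlled on [0, 1] only; clamping the parameter makes its speed continuous on
    the whole line, so that 0 and 1 become interior points for the fundamental theorem of
    calculus. *)
Definition clamp01 (t : R) : R := Num.max 0 (Num.min t 1).

Lemma clamp01_id t : 0 <= t <= 1 -> clamp01 t = t.
Proof. by move=> /andP[t0 t1]; rewrite /clamp01 min_l// max_r. Qed.

Lemma clamp01_itv t : 0 <= clamp01 t <= 1.
Proof. by rewrite /clamp01 le_max lexx/= ge_max ler01 ge_min lexx orbT. Qed.

Lemma clamp01_continuous : continuous (clamp01 : R -> R).
Proof.
move=> t.
have cm : {for t, continuous ((fun t : R => t : R^o) \min (fun=> 1 : R^o))}.
  by apply: continuous_min; [exact: cvg_id|exact: cst_continuous].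
exact: (continuous_max (@cst_continuous R R^o 0 t) cm).
Qed.

End real_line.

(** * Speed of curves and Lipschitz bounds along them *)

Section speed.
Context {R : realType} {n : nat} {M : manifold R n} (g : riemannian_metric M).
Implicit Types (c : chart R n M) (gamma : R -> M) (t s : R).

Let y c gamma : R^o -> 'rV[R]_n := chart_to c \o gamma.

Lemma near_chart_dom c gamma t : {for t, continuous gamma} ->
  chart_dom c (gamma t) -> \forall s \near t, chart_dom c (gamma s).
Proof.
move=> cg cgt; have oc : nbhs (gamma t) (chart_dom c).
  by apply: open_nbhs_nbhs; split => //; exact: chart_dom_open.
exact: (cg _ oc).
Qed.

(** [velocity] is taken in the chart chosen at the current point; the chain rule for the transition
    map brings it to any fixed chart. *)
Lemma velocityE c gamma t : atlas c -> {for t, continuous gamma} ->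
  chart_dom c (gamma t) -> derivable (y c gamma) t 1 ->
  velocity gamma t = 'D_1 (y c gamma) t *m frame c (gamma t).
Proof.
move=> ac cg cgt dy; rewrite /velocity derive1E frameE//.
set c' := chart_at (gamma t).
have dyd : differentiable (y c gamma) t by exact/derivable1_diffP.
have dT : differentiable (transition c c') (y c gamma t).
  apply: transition_differentiable => //; first exact: chart_at_atlas.
  by apply: overlap_chart_to => //; exact: chart_at_dom.
rewrite [LHS](near_eq_derive _ (g := transition c c' \o y c gamma)); last first.
  have := near_chart_dom cg cgt; apply: filterS => s cs.
  by rewrite /transition /y /= (chart_toK cs).
rewrite [LHS]deriveE; last exact: differentiable_comp.
rewrite diff_comp//=; congr ('d _ _ _).
by rewrite deriveE.
Qed.

(** At an endpoint, nearby parameters may leave [0, 1], where continuity of [gamma] is not part of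
    [C1_curve]. It is recovered by applying [chart_inv c] to the derivable chart expression. *)
Lemma C1_curve_near c gamma t : C1_curve gamma -> 0 <= t <= 1 -> atlas c ->
  chart_dom c (gamma t) ->
  \forall s \near t, [/\ {for s, continuous gamma}, chart_dom c (gamma s) &
    derivable (y c gamma) s 1].
Proof.
move=> C1 t01 ac cgt; have [cg /(_ c ac cgt)[dy _]] := C1 t t01.
have cnear := near_join (near_chart_dom cg cgt).
near=> s.
have dys : derivable (y c gamma) s 1 by near: s.
have cs : \forall r \near s, chart_dom c (gamma r).
  by near: s; exact: cnear.
have css : chart_dom c (gamma s) := nbhs_singleton cs.
split => //.
have cys : {for s, continuous (y c gamma)}.
  by apply: differentiable_continuous; exact/derivable1_diffP.
have cis : {for s, continuous (chart_inv c \o y c gamma)}.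
  apply: continuous_comp => //; apply: chart_inv_continuous.
  exact: chart_to_cod.
have E : \forall r \near s, chart_inv c (y c gamma r) = gamma r.
  by move: cs; apply: filterS => r cr; rewrite /y /= chart_toK.
have E0 : (chart_inv c \o y c gamma) s = gamma s by exact: chart_toK.
have {}cis : (chart_inv c \o y c gamma) @ s --> gamma s.
  by rewrite -[X in _ --> X]E0; exact: cis.
rewrite /continuous_at; move: cis.
by apply: cvg_trans; apply: near_eq_cvg; exact: E.
Unshelve. all: by end_near. Qed.

Definition speed gamma t : R := rnorm g (velocity gamma t).

Lemma speedE c gamma t : atlas c -> {for t, continuous gamma} ->
  chart_dom c (gamma t) -> derivable (y c gamma) t 1 ->
  speed gamma t = Num.sqrt (('D_1 (y c gamma) t *m gram g c (gamma t) *m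
                             ('D_1 (y c gamma) t)^T) ord0 ord0).
Proof.
by move=> ac cg cgt dy; rewrite /speed /rnorm (velocityE ac)// inner_frame.
Qed.

(** [chart_at] may jump along the curve, so the speed is first rewritten in one fixed chart near
    [t]. *)
Lemma speed_continuous gamma t : C1_curve gamma -> 0 <= t <= 1 ->
  {for t, continuous (speed gamma)}.
Proof.
move=> C1 t01; set c := chart_at (gamma t).
have ac : atlas c by exact: chart_at_atlas.
have cgt : chart_dom c (gamma t) by exact: chart_at_dom.
have [cg /(_ c ac cgt)[dy cdy]] := C1 t t01.
have nC := C1_curve_near C1 t01 ac cgt.
have [_ _ dyt] := nbhs_singleton nC.
have cy : {for t, continuous (y c gamma)}.
  by apply: differentiable_continuous; exact/derivable1_diffP.
have E : \forall s \near t, Num.sqrt (('D_1 (y c gamma) s *m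
    gram g c (chart_inv c (y c gamma s)) *m ('D_1 (y c gamma) s)^T) ord0 ord0) =
    speed gamma s.
  move: nC; apply: filterS => s [cgs cs dys].
  apply: (etrans _ (esym (speedE ac cgs cs dys))).
  by have -> : chart_inv c (y c gamma s) = gamma s := chart_toK cs.
have cw : {for t, continuous (fun s => 'D_1 (y c gamma) s)}.
  move: cdy; rewrite (_ : derive1 _ = fun s => 'D_1 (y c gamma) s)//.
  by apply/funext => s; rewrite derive1E.
have cF : {for t, continuous (fun s => Num.sqrt (('D_1 (y c gamma) s *m
    gram g c (chart_inv c (y c gamma s)) *m ('D_1 (y c gamma) s)^T) ord0 ord0))}.
  apply: (continuous_comp (f := fun s => ('D_1 (y c gamma) s *m
    gram g c (chart_inv c (y c gamma s)) *m ('D_1 (y c gamma) s)^T) ord0 ord0));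
    last exact: sqrt_continuous.
  apply: continuous_at_quadratic.
  - move=> i j.
    exact: (continuous_comp cy (@gram_continuous R n M g c _ i j ac (chart_to_cod cgt))).
  - move=> i; exact: (continuous_comp cw (@coord_continuous _ _ _ _ _ _)).
  - move=> i; exact: (continuous_comp cw (@coord_continuous _ _ _ _ _ _)).
exact: (near_eq_continuous_at E cF).
Qed.

Lemma speed_ge0 gamma t : 0 <= speed gamma t.
Proof. exact: sqrtr_ge0. Qed.

Lemma speed_clamp_continuous gamma : C1_curve gamma ->
  continuous (fun t => speed gamma (clamp01 t) : R^o).
Proof.
move=> C1 t; apply: (@continuous_comp _ _ _ (clamp01 : R -> R)
  (speed gamma : R -> R^o) t (@clamp01_continuous R t)).
exact: (speed_continuous C1 (clamp01_itv t)).
Qed.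

Lemma integrable_speed_clamp gamma (a b : R) : C1_curve gamma ->
  (@lebesgue_measure R).-integrable `[a, b]
    (fun t => (speed gamma (clamp01 t))%:E).
Proof.
move=> C1; apply: (@continuous_compact_integrable _
  (fun t => speed gamma (clamp01 t))); first exact: segment_compact.
by apply: continuous_subspaceT; exact: speed_clamp_continuous.
Qed.

Lemma curve_lengthE gamma : C1_curve gamma -> curve_length g gamma =
  (\int[lebesgue_measure]_(t in `[0, 1]) speed gamma (clamp01 t))%:E.
Proof.
move=> C1; rewrite /Rintegral fineK; last first.
  apply: integrable_fin_num; first exact: measurable_itv.
  exact: integrable_speed_clamp.
apply: eq_integral => t; rewrite inE/= in_itv/= => t01.
by rewrite clamp01_id.
Qed.

(** An infinitesimal Lipschitz condition at [p]. Being pointwise it can be collected over a compact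
    set, and it integrates to a global bound because [rdist] is an infimum of lengths. *)
Definition lipschitz_along_curves (f : M -> R) (K : R) (p : M) :=
  forall gamma t, C1_curve gamma -> 0 <= t <= 1 -> gamma t = p ->
  forall e, 0 < e -> \forall s \near t,
    `|f (gamma s) - f (gamma t)| <= (K * speed gamma t + e) * `|s - t|.

(** [K] times the arc length, plus an arbitrarily small slope, minus plus-or-minus [f] along the
    curve is locally nondecreasing. *)
Lemma lipschitz_curve_length (f : M -> R) (K : R) gamma : 0 <= K ->
  (forall p, lipschitz_along_curves f K p) -> C1_curve gamma ->
  (`|f (gamma 0%R) - f (gamma 1%R)|%:E <= K%:E * curve_length g gamma)%E.
Proof.
move=> K0 fK C1; rewrite curve_lengthE// -EFinM lee_fin.
pose h t := speed gamma (clamp01 t).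
(* The lower limit -1 keeps all of [0, 1] inside the open interval where the primitive is
   differentiated. *)
pose F x := \int[lebesgue_measure]_(t in `[-1, x]) h t.
have F01 : \int[lebesgue_measure]_(t in `[0, 1]) h t = F 1 - F 0.
  rewrite /F (_ : `[-1, 0]%classic = [set` Interval (BLeft (-1 : R)) (BRight 0)])//.
  rewrite Rintegral_itvB ?bnd_simp ?ler01 ?oppr_le0 ?ler01//.
    rewrite Rintegral_itv_obnd_cbnd//.
    have hi : (@lebesgue_measure R).-integrable `[0, 1] (EFin \o h).
      exact: integrable_speed_clamp.
    apply: integrableS hi => //; exact: subset_itv_oc_cc.
  exact: integrable_speed_clamp.
have dF t : 0 <= t <= 1 -> derivable (F : R^o -> R^o) t 1 /\ 'D_1 F t = speed gamma t.
  move=> t01; have /andP[t0 t1] := t01.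
  have [] := @continuous_FTC1_closed R h (-1) t 2.
  - by lra.
  - exact: integrable_speed_clamp.
  - by lra.
  - exact: speed_clamp_continuous.
  by rewrite derive1E /h clamp01_id.
suff key (sg e : R) : `|sg| = 1 -> 0 < e ->
    sg * (f (gamma 1) - f (gamma 0)) <= K * (F 1 - F 0) + e.
  rewrite F01 distrC; apply/ler_addgt0Pr => e e0.
  rewrite ler_norml; apply/andP; split.
    by have := key (-1) e; rewrite normrN1 mulN1r => /(_ erefl e0); lra.
  by have := key 1 e; rewrite normr1 mul1r => /(_ erefl e0).
move=> sg1 e0.
pose psi t := K * F t + e * t - sg * f (gamma t).
suff : psi 0 <= psi 1 by rewrite /psi mulr0 mulr1 mulrBr mulrBr; lra.
apply: local_nondecreasing_le => t t01.
(* The error is paid once for [f] and [K] times for [F]: (K + 1) e' is e/2. *)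
pose e' := e / (K + 1) / 2.
have K1 : 0 < K + 1 by rewrite ltr_wpDl.
have e'0 : 0 < e' by rewrite !divr_gt0.
have [dFt DFt] := dF t t01.
have n1 := near_derive_le dFt e'0; rewrite DFt in n1.
have n2 := fK _ gamma t C1 t01 erefl e' e'0.
near=> s.
have h1 : `|F s - F t - (s - t) *: speed gamma t| <= e' * `|s - t| by near: s.
have h2 : `|f (gamma s) - f (gamma t)| <= (K * speed gamma t + e') * `|s - t| by near: s.
have {}h2 : `|sg * (f (gamma s) - f (gamma t))| <= (K * speed gamma t + e') * `|s - t|.
  by rewrite normrM sg1 mul1r.
have ee : K * e' + e' <= e.
  have -> : K * e' + e' = (K + 1) * e' by ring.
  rewrite /e' mulrA mulrCA mulfV ?gt_eqF// mulr1; lra.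
have a0 : 0 <= `|s - t| by [].
move: h1 h2; rewrite !ler_norml [_ *: _]mulrC.
set v := speed gamma t; set D := F s - F t.
move=> /andP[h1 h1'] /andP[h2 h2'].
have eea : (K * e' + e') * `|s - t| <= e * `|s - t| by rewrite ler_wpM2r.
have psiE : psi s - psi t = K * D + e * (s - t) - sg * (f (gamma s) - f (gamma t)).
  by rewrite /psi /D; ring.
split=> st; rewrite -subr_ge0.
  have aE : `|s - t| = s - t by rewrite ger0_norm// subr_ge0.
  rewrite psiE; move: h1 h2' eea; rewrite aE => {}h1 {}h2' {}eea.
  have : K * (v * (s - t)) - K * (e' * (s - t)) <= K * D.
    by rewrite -mulrBr ler_wpM2l//; lra.
  by move: h2' eea; set X := sg * _; rewrite !mulrDl !mulrA; lra.
have aE : `|s - t| = - (s - t) by rewrite ler0_norm// subr_le0.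
rewrite -opprB psiE; move: h1' h2 eea; rewrite aE => {}h1' {}h2 {}eea.
have : K * D <= K * (v * (s - t)) - K * (e' * (s - t)).
  by rewrite -mulrBr ler_wpM2l//; lra.
by move: h2 eea; set X := sg * _; rewrite !mulrDl !mulrA; lra.
Unshelve. all: by end_near. Qed.

(** The triangle inequality sums the bound over the pieces of a curve; positivity of [K] allows
    dividing by it before taking the infimum. *)
Lemma lipschitz_along_curves_rlipschitz (f : M -> R) (K : R) : 0 < K ->
  (forall p, lipschitz_along_curves f K p) -> rlipschitz g f.
Proof.
move=> K0 fK; exists K => p q _ _.
rewrite muleC -lee_pdivrMr//; apply: le_ereal_inf_tmp => _ [s /= spq <-].
rewrite lee_pdivrMr// muleC.
elim: s p spq => [|gamma s ih] p /=; first by move=> ->; rewrite subrr normr0 big_nil mule0.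
move=> [C1 <- spq]; rewrite big_cons.
have len0 ga : (0 <= curve_length g ga)%E.
  by apply: integral_ge0 => t _; rewrite lee_fin sqrtr_ge0.
rewrite ge0_muleDr//; last by apply: sume_ge0.
apply: (@le_trans _ _ (`|f (gamma 0%R) - f (gamma 1%R)|%:E + `|f (gamma 1%R) - f q|%:E)%E).
  by rewrite -EFinD lee_fin (le_trans _ (ler_normD _ _))// addrA subrK.
apply: leeD; last exact: ih.
by apply: lipschitz_curve_length => //; exact: ltW.
Qed.

End speed.

(** On unit vectors the two forms differ by at most the sum of the entrywise differences;
    homogeneity does the rest. *)
Lemma quadratic_ge_perturb {R : realType} n (A B : 'M[R]_n) (m : R) (v : 'rV[R]_n) :
  (forall w : 'rV[R]_n, `|w| = 1 -> 2 * m <= (w *m B *m w^T) ord0 ord0) ->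
  \sum_i \sum_j `|A i j - B i j| < m ->
  m * `|v| ^+ 2 <= (v *m A *m v^T) ord0 ord0.
Proof.
move=> Bm ABm.
have [->|v0] := eqVneq v 0.
  by rewrite normr0 expr0n mulr0 !mul0mx mxE.
have nv0 : 0 < `|v| by rewrite normr_gt0.
have nw : `|(`|v|^-1 *: v)| = 1.
  by rewrite normrZ normfV normr_id mulVf// gt_eqF.
have unit_case (w : 'rV[R]_n) : `|w| = 1 -> m <= (w *m A *m w^T) ord0 ord0.
  move=> w1; have h := quadratic_le (A - B) w.
  have QB : (w *m (A - B) *m w^T) ord0 ord0 =
      (w *m A *m w^T) ord0 ord0 - (w *m B *m w^T) ord0 ord0.
    by rewrite mulmxBr mulmxBl [LHS]mxE; congr (_ + _); rewrite mxE.
  have FE : \sum_i \sum_j `|(A - B) i j| = \sum_i \sum_j `|A i j - B i j|.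
    by apply: eq_bigr => i _; apply: eq_bigr => j _; rewrite !mxE.
  move: h (Bm _ w1); rewrite QB FE w1 expr1n mulr1 ler_norml => /andP[h _].
  by lra.
have := unit_case _ nw.
rewrite linearZ/= -scalemxAl -!scalemxAl -scalemxAr scalerA mxE -expr2 exprVn.
by rewrite mulrC ler_pdivlMr ?exprn_gt0.
Qed.

(** * Comparison of the Riemannian metric with the norm of a chart *)

Section chart_lipschitz.
Context {R : realType} {n : nat} {M : manifold R n} (g : riemannian_metric M).
Implicit Types (c : chart R n M) (gamma : R -> M) (t s : R).

Local Notation G c x := (gram g c (chart_inv c x)).

Lemma near_gram_le c x0 : atlas c -> chart_cod c x0 -> exists2 K : R, 0 < K &
  \forall x \near x0, chart_cod c x /\
    forall v : 'rV[R]_n, (v *m G c x *m v^T) ord0 ord0 <= K * `|v| ^+ 2.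
Proof.
move=> ac cx0.
pose F x : R := \sum_i \sum_j `|G c x i j|.
have cF : {for x0, continuous F}.
  apply: continuous_at_sum => i; apply: continuous_at_sum => j.
  exact: (continuous_comp (gram_continuous (g := g) (i := i) (j := j) ac cx0)
    (@norm_continuous _ _ _)).
have F0 : 0 <= F x0 by apply: sumr_ge0 => i _; apply: sumr_ge0.
exists (F x0 + 1); first by rewrite ltr_wpDl.
near=> x.
have cx : chart_cod c x.
  near: x; apply: open_nbhs_nbhs; split => //; exact: chart_cod_open.
have Fx : F x < F x0 + 1.
  by near: x; apply: (cvgr_lt _ cF); rewrite ltrDl.
split => // v; apply: le_trans (ler_norm _) _.
apply: le_trans (quadratic_le _ _) _.
by rewrite ler_wpM2r ?exprn_ge0// ltW.
Unshelve. all: by end_near. Qed.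

Lemma near_gram_ge c x0 : atlas c -> chart_cod c x0 -> exists2 m : R, 0 < m &
  \forall x \near x0, chart_cod c x /\
    forall v : 'rV[R]_n, m * `|v| ^+ 2 <= (v *m G c x *m v^T) ord0 ord0.
Proof.
move=> ac cx0.
pose Q x (v : 'rV[R]_n) := (v *m G c x *m v^T) ord0 ord0.
pose S : set 'rV[R]_n := [set v | `|v| = 1].
have [m m0 Qm] : exists2 m : R, 0 < m & forall v, S v -> 2 * m <= Q x0 v.
  (* The unit sphere is empty in dimension 0; otherwise the form attains a positive minimum on
     it. *)
  have [S0|/set0P S0] := eqVneq S set0; first by exists 1 => // v; rewrite S0.
  have cS : compact S.
    apply: bounded_closed_compact.
      by exists 1; split; rewrite ?num_real// => r r1 v /= ->; exact: ltW.
    apply: (@closed_comp _ _ (fun v : 'rV[R]_n => `|v|) [set 1]).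
      by move=> v _; exact: norm_continuous.
    exact: closed_eq.
  have cQ : continuous (Q x0).
    move=> v; apply: (@continuous_at_quadratic _ _ _ _ (fun=> G c x0) id id).
    - by move=> i j; exact: cst_continuous.
    - by move=> i; exact: coord_continuous.
    - by move=> i; exact: coord_continuous.
  have [v0 v0S Qv0] := EVT_min_rV S0 cS (continuous_subspaceT cQ).
  have v0n0 : v0 != 0.
    by rewrite -normr_gt0; move: v0S; rewrite inE /S /= => ->.
  have Q0 : 0 < Q x0 v0.
    by apply: gram_pos => //; exact: chart_inv_dom.
  exists (Q x0 v0 / 2); first by rewrite divr_gt0.
  by move=> v Sv; rewrite mulrC divfK ?pnatr_eq0//; apply: Qv0; rewrite inE.
exists m => //.
pose F x : R := \sum_i \sum_j `|G c x i j - G c x0 i j|.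
have cF : {for x0, continuous F}.
  apply: continuous_at_sum => i; apply: continuous_at_sum => j.
  apply: (@continuous_comp _ _ _ (fun x => G c x i j - G c x0 i j) (fun r => `|r|)).
    exact: (continuousB (gram_continuous (g := g) (i := i) (j := j) ac cx0)
      (@cst_continuous _ _ _ _)).
  exact: norm_continuous.
have F0 : F x0 = 0.
  by apply: big1 => i _; apply: big1 => j _; rewrite subrr normr0.
near=> x.
have cx : chart_cod c x.
  near: x; apply: open_nbhs_nbhs; split => //; exact: chart_cod_open.
have Fx : F x < m.
  by near: x; apply: (cvgr_lt _ cF); rewrite F0.
by split=> // v; exact: (quadratic_ge_perturb (A := G c x) (B := G c x0) v Qm Fx).
Unshelve. all: by end_near. Qed.

Let line (x y : 'rV[R]_n) : R^o -> 'rV[R]_n := fun s => s *: (y - x) + x.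

Let line_derive x y s : is_derive s 1 (line x y) (y - x).
Proof.
have := @derive_line R n _ id (y - x) x s; rewrite derive_id; apply.
exact: ex_diff.
Qed.

Let line_continuous x y : continuous (line x y).
Proof.
move=> s; apply: differentiable_continuous; apply/derivable1_diffP.
by have [] := line_derive x y s.
Qed.

Lemma segment_C1 c x y : atlas c ->
  (forall t, 0 <= t <= 1 -> chart_cod c (line x y t)) ->
  C1_curve (chart_inv c \o line x y).
Proof.
move=> ac cl t t01; have clt := cl t t01.
have cg : {for t, continuous (chart_inv c \o line x y)}.
  exact: (continuous_comp (@line_continuous x y t) (chart_inv_continuous clt)).
split=> // c' ac' c'gt.
have Olt : overlap c c' (line x y t) by [].
have nO : \forall s \near t, overlap c c' (line x y s).
  have oO : nbhs (line x y t) (overlap c c').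
    by apply: open_nbhs_nbhs; split => //; exact: overlap_open.
  exact: (@line_continuous x y t _ oO).
have dT s : overlap c c' (line x y s) ->
    is_derive s 1 (transition c c' \o line x y)
      ('D_(y - x) (transition c c') (line x y s)).
  by move=> Os; apply: derive_line; exact: transition_differentiable.
split.
  by apply: filterS nO => s Os; have [] := dT s Os.
have [_ /(_ (y - x)) cD] := atlas_compatible ac ac' 1%N.
apply: (@near_eq_continuous_at _ _
  (fun s => 'D_(y - x) (transition c c') (line x y s))).
  apply: filterS nO => s Os; rewrite derive1E.
  by have [_ ->] := dT s Os.
exact: (continuous_comp (@line_continuous x y t) (cD _ Olt)).
Qed.

Lemma segment_speed c x y t : atlas c ->
  (forall t, 0 <= t <= 1 -> chart_cod c (line x y t)) -> 0 <= t <= 1 ->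
  speed g (chart_inv c \o line x y) t =
  Num.sqrt (((y - x) *m G c (line x y t) *m (y - x)^T) ord0 ord0).
Proof.
move=> ac cl t01; have clt := cl t t01.
have [cg _] := segment_C1 ac cl t01.
have cgt : chart_dom c ((chart_inv c \o line x y) t) by exact: chart_inv_dom.
have nE : \forall s \near t, line x y s = (chart_to c \o (chart_inv c \o line x y)) s.
  have oO : nbhs (line x y t) (chart_cod c).
    by apply: open_nbhs_nbhs; split => //; exact: chart_cod_open.
  have nc : \forall s \near t, chart_cod c (line x y s).
    exact: (@line_continuous x y t _ oO).
  move: nc; apply: filterS => s cs.
  by rewrite /= (chart_invK cs).
have [dl Dl] := line_derive x y t.
have dy : derivable (chart_to c \o (chart_inv c \o line x y) : R^o -> _) t 1.
  exact: (near_eq_derivable nE dl).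
have Dy : 'D_1 (chart_to c \o (chart_inv c \o line x y) : R^o -> _) t = y - x.
  by rewrite -Dl; exact: (esym (near_eq_derive (1 : R^o) nE)).
by apply: (etrans (speedE g ac cg cgt dy)); rewrite Dy.
Qed.

Lemma rdist_ge0 p q : (0 <= rdist g p q)%E.
Proof.
apply: le_ereal_inf_tmp => _ [s _ <-]; apply: sume_ge0 => gamma _.
by apply: integral_ge0 => t _; rewrite lee_fin sqrtr_ge0.
Qed.

(** The straight segment in the chart is an admissible curve, of length at most the square root of
    [K] times the norm of its difference vector. *)
Lemma near_rdist_le c x0 : atlas c -> chart_cod c x0 -> exists2 L : R, 0 < L &
  \forall x \near x0 & y \near x0,
    (rdist g (chart_inv c x) (chart_inv c y) <= (L * `|x - y|)%:E)%E.
Proof.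
move=> ac cx0; have [K K0 /nbhs_ballP[r /= r0 hK]] := near_gram_le ac cx0.
exists (Num.sqrt K); first by rewrite sqrtr_gt0.
(* Points of the segment are within r/3 + 2r/3 of [x0], by the distance of an endpoint plus that of
   the endpoints to each other. *)
exists (ball x0 (r / 3), ball x0 (r / 3)).
  by split; apply: nbhsx_ballx; rewrite divr_gt0.
move=> [x y] /= [xr yr].
have xyr t : 0 <= t <= 1 -> ball x0 r (line x y t).
  move=> /andP[t0 t1]; move: xr yr; rewrite -!ball_normE /= /line => xr yr.
  rewrite opprD addrCA addrC.
  apply: (le_lt_trans (ler_normB _ _)); rewrite normrZ ger0_norm//.
  have yx : `|y - x| < 2 * (r / 3).
    have -> : y - x = (x0 - x) - (x0 - y) by rewrite opprB [RHS]addrC addrA subrK.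
    by rewrite (le_lt_trans (ler_normB _ _))//; lra.
  have : t * `|y - x| <= `|y - x| by rewrite ler_piMl.
  by move: yx; set a := t * _; set b := `|y - x|; lra.
have cl t : 0 <= t <= 1 -> chart_cod c (line x y t).
  by move=> /xyr/hK[].
have C1 := segment_C1 ac cl.
apply: (@le_trans _ _ (curve_length g (chart_inv c \o line x y))).
  apply: ereal_inf_lbound; exists [:: chart_inv c \o line x y].
    by split; rewrite //= /line ?scale0r ?add0r// scale1r subrK.
  by rewrite big_cons big_nil adde0.
rewrite curve_lengthE// lee_fin.
apply: (@le_trans _ _ (\int[lebesgue_measure]_(t in `[0, 1]) (Num.sqrt K * `|x - y|))).
  apply: le_Rintegral => //.
  - exact: integrable_speed_clamp.
  - apply: (@continuous_compact_integrable _ (fun=> Num.sqrt K * `|x - y|)).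
      exact: segment_compact.
    by apply: continuous_subspaceT; exact: cst_continuous.
  - move=> t; rewrite /= in_itv/= => t01; rewrite clamp01_id// segment_speed//.
    rewrite distrC -[`|y - x|]ger0_norm// -sqrtr_sqr -sqrtrM ?(ltW K0)//.
    rewrite ler_wsqrtr//; exact: (hK _ (xyr _ t01)).2.
rewrite Rintegral_cst//= lebesgue_measure_itv/= lte_fin ltr01 oppr0 adde0/=.
by rewrite mulr1.
Qed.

Lemma locally_rlipschitz_chart f c : atlas c -> locally_rlipschitz g f ->
  locally_lipschitz (chart_cod c) (f \o chart_inv c).
Proof.
move=> ac lf x0 cx0.
have [A Ap [K fK]] := lf (chart_inv c x0).
have [L L0 [[U V] /= [x0U x0V] UV]] := near_rdist_le ac cx0.
exists (`|K| * L).
have A0 : nbhs x0 (chart_inv c @^-1` A) by exact: (chart_inv_continuous cx0).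
exists (U `&` chart_inv c @^-1` A, V `&` chart_inv c @^-1` A).
  by split; exact: filterI.
move=> [x y] /= [[Ux Ax] [Vy Ay]].
rewrite -lee_fin; apply: le_trans (fK _ _ Ax Ay) _.
apply: (@le_trans _ _ (`|K|%:E * rdist g (chart_inv c x) (chart_inv c y))%E).
  by apply: lee_wpmul2r; [exact: rdist_ge0|rewrite lee_fin ler_norm].
rewrite -mulrA EFinM; apply: lee_wpmul2l; first by rewrite lee_fin.
exact: (UV (x, y) (conj Ux Vy)).
Qed.

(** The lower bound [m] on the Gram matrix bounds the chart velocity by the speed, which turns the
    chart constant [L] into L divided by the square root of m. Arguing at one time of the curve
    avoids any lower bound on [rdist], for which curves leaving the chart would matter. *)
Lemma near_lipschitz_along_curves f p0 :
  locally_lipschitz (chart_cod (chart_at p0)) (f \o chart_inv (chart_at p0)) ->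
  exists2 K : R, 0 <= K & \forall p \near p0, lipschitz_along_curves g f K p.
Proof.
set c := chart_at p0 => lf.
have ac : atlas c by exact: chart_at_atlas.
have cp0 : chart_dom c p0 by exact: chart_at_dom.
have cx0 := chart_to_cod cp0.
have [L nL] := lf _ cx0.
have {nL} nL : \forall x \near chart_to c p0, \forall x' \near x,
    `|f (chart_inv c x') - f (chart_inv c x)| <= `|L| * `|x' - x|.
  have [[U V] /= [x0U x0V] UV] := nL.
  have : nbhs (chart_to c p0) (U `&` V) by exact: filterI.
  move/near_join; apply: filterS => x nx.
  have [Ux Vx] := nbhs_singleton nx.
  move: nx; apply: filterS => x' [Ux' Vx'].
  apply: (le_trans (UV (x', x) (conj Ux' Vx))).
  by rewrite ler_wpM2r// ler_norm.
have [m m0 nm] := near_gram_ge ac cx0.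
exists (`|L| / Num.sqrt m); first by rewrite divr_ge0// sqrtr_ge0.
have np : \forall p \near p0, chart_dom c p /\
    [/\ (\forall x' \near chart_to c p,
      `|f (chart_inv c x') - f (chart_inv c (chart_to c p))| <= `|L| * `|x' - chart_to c p|)
    , chart_cod c (chart_to c p) & forall v : 'rV[R]_n,
        m * `|v| ^+ 2 <= (v *m G c (chart_to c p) *m v^T) ord0 ord0].
  have n0 : \forall p \near p0, chart_dom c p.
    by apply: open_nbhs_nbhs; split => //; exact: chart_dom_open.
  have n1 := chart_to_continuous cp0 nL.
  have n2 := chart_to_continuous cp0 nm.
  near=> p; split; first by near: p; exact: n0.
  have [] : chart_cod c (chart_to c p) /\ forall v : 'rV[R]_n,
      m * `|v| ^+ 2 <= (v *m G c (chart_to c p) *m v^T) ord0 ord0.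
    by near: p; exact: n2.
  by split=> //; near: p; exact: n1.
move: np; apply: filterS => p [cp [nLp _ mp]] gamma t C1 t01 gtp e e0.
have cgt : chart_dom c (gamma t) by rewrite gtp.
have nC := C1_curve_near C1 t01 ac cgt.
have [cg _ dy] := nbhs_singleton nC.
have e1 : 0 < e / (`|L| + 1) by rewrite divr_gt0// ltr_wpDl.
have nD := near_derive_le dy e1.
have cy : {for t, continuous (chart_to c \o gamma : R^o -> 'rV[R]_n)}.
  by apply: differentiable_continuous; exact/derivable1_diffP.
set D := 'D_1 (chart_to c \o gamma : R^o -> 'rV[R]_n) t in nD.
have Dspeed : Num.sqrt m * `|D| <= speed g gamma t.
  have mD : m * `|D| ^+ 2 <= (D *m gram g c (gamma t) *m D^T) ord0 ord0.
    by rewrite gtp -[X in gram g c X](chart_toK cp); exact: mp.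
  have -> : Num.sqrt m * `|D| = Num.sqrt (m * `|D| ^+ 2).
    by rewrite sqrtrM ?(ltW m0)// sqrtr_sqr normr_id.
  apply: (le_trans (ler_wsqrtr mD)).
  by rewrite (speedE g ac cg cgt dy) lexx.
rewrite -gtp in nLp.
have nL' := cy _ nLp.
near=> s.
have cs : chart_dom c (gamma s).
  by near: s; apply: filterS nC => s [].
have h1 : `|f (chart_inv c (chart_to c (gamma s))) -
    f (chart_inv c (chart_to c (gamma t)))| <=
    `|L| * `|chart_to c (gamma s) - chart_to c (gamma t)|.
  by near: s; exact: nL'.
have h2 : `|chart_to c (gamma s) - chart_to c (gamma t) - (s - t) *: D| <=
    e / (`|L| + 1) * `|s - t| by near: s; exact: nD.
rewrite !chart_toK// in h1; apply: (le_trans h1).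
have h3 : `|chart_to c (gamma s) - chart_to c (gamma t)| <=
    (`|D| + e / (`|L| + 1)) * `|s - t|.
  rewrite -[X in `|X|](subrK ((s - t) *: D)).
  rewrite (le_trans (ler_normD _ _))// addrC mulrDl lerD//.
  by rewrite normrZ mulrC.
apply: (@le_trans _ _ (`|L| * ((`|D| + e / (`|L| + 1)) * `|s - t|))).
  by rewrite ler_wpM2l.
rewrite mulrA ler_wpM2r// mulrDr lerD//.
  rewrite -mulrA ler_wpM2l// ler_pdivlMl ?sqrtr_gt0//.
rewrite mulrA mulrAC -[leRHS]mul1r ler_wpM2r ?(ltW e0)//.
by rewrite ler_pdivrMr ?mul1r ?lerDl// ltr_wpDl.
Unshelve. all: by end_near. Qed.

(** Compactness gives one constant valid at all points of the support. At a point off the support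
    [f] vanishes nearby, so even the constant 0 works. *)
Lemma compact_support_rlipschitz f : compact (support_of f) ->
  (forall c, atlas c -> locally_lipschitz (chart_cod c) (f \o chart_inv c)) ->
  rlipschitz g f.
Proof.
move=> cf lf.
have mono K K' p : K <= K' -> lipschitz_along_curves g f K p ->
    lipschitz_along_curves g f K' p.
  move=> KK' fK gamma t C1 t01 gp e e0; have := fK _ _ C1 t01 gp _ e0.
  apply: filterS => s h; apply: (le_trans h); rewrite ler_wpM2r// lerD2r.
  by rewrite ler_wpM2r// speed_ge0.
have : \forall K \near +oo, support_of f `<=` lipschitz_along_curves g f K.
  have nc := iffLR (compact_near_coveringP (support_of f)) cf R (pinfty_nbhs R)
    (fun K p => lipschitz_along_curves g f K p) _.
  apply: nc => p _; have [K K0 nK] := near_lipschitz_along_curves (lf _ (chart_at_atlas p)).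
  exists (lipschitz_along_curves g f K, [set K' | K < K']).
    by split => //=; exists K; split => //; rewrite num_real.
  by move=> [q K'] /= [qK KK']; apply: mono qK; exact: ltW.
move=> nK.
have [K [K0 fK]] : exists K : R, 0 < K /\
    support_of f `<=` lipschitz_along_curves g f K.
  near (pinfty_nbhs R) => K; exists K; split; near: K => //.
  exact: nbhs_pinfty_gt.
apply: (lipschitz_along_curves_rlipschitz K0) => p.
have [/fK//|nfp] := pselect (support_of f p).
apply: (mono 0); first exact: ltW.
move=> gamma t C1 t01 gp e e0.
have [cg _] := C1 t t01.
have nS : nbhs (gamma t) (~` support_of f).
  apply: open_nbhs_nbhs; split; first by rewrite openC; exact: closed_closure.
  by rewrite gp.
have nsS : \forall s \near t, ~ support_of f (gamma s) by exact: (cg _ nS).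
move: nsS; apply: filterS => s ns.
rewrite (support_of_eq0 ns) (support_of_eq0 (f := f)) ?gp//.
by rewrite subrr normr0 mul0r add0r mulr_ge0// ltW.
Unshelve. all: by end_near. Qed.

End chart_lipschitz.

(** * Products of Lipschitz functions *)

Section first_order_calculus.
Context {R : realType} {n : nat}.
Local Notation V := 'rV[R]_n.
Implicit Types (O : set V) (f psi : V -> R) (L : V -> V -> R) (x : V).

Definition lipschitz_at x0 f := exists K : R,
  \forall x \near x0 & y \near x0, `|f x - f y| <= K * `|x - y|.

(** Differentiability uniform in the base point, relative to other functions: [dpsi x y] is
    assembled from their increments, so no derivative of them has to exist. *)
Definition increment_at x0 psi (dpsi : V -> V -> R) := forall e : R, 0 < e ->
  \forall x \near x0 & y \near x0, `|psi y - psi x - dpsi x y| <= e * `|y - x|.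

Definition C1_at (u u' : R -> R) (s0 : R) :=
  {for s0, continuous u'} /\ \forall s \near s0, is_derive (s : R^o) 1 (u : R^o -> R^o) (u' s).

Lemma near2_fst (P : V -> Prop) x0 : (\forall x \near x0, P x) ->
  \forall x \near x0 & y \near x0, P x.
Proof.
by move=> nP; exists (P, setT); [split => //; exact: filterT|move=> [x y] []].
Qed.

Lemma near2_snd (P : V -> Prop) x0 : (\forall x \near x0, P x) ->
  \forall x \near x0 & y \near x0, P y.
Proof.
by move=> nP; exists (setT, P); [split => //; exact: filterT|move=> [x y] []].
Qed.

Lemma near2S (P Q : V -> V -> Prop) x0 : (forall x y, P x y -> Q x y) ->
  (\forall x \near x0 & y \near x0, P x y) ->
  \forall x \near x0 & y \near x0, Q x y.
Proof.
by move=> PQ [[A B] AB ABP]; exists (A, B) => // -[x y] h; exact/PQ/(ABP (x, y)).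
Qed.

Lemma near2I (P Q : V -> V -> Prop) x0 :
  (\forall x \near x0 & y \near x0, P x y) ->
  (\forall x \near x0 & y \near x0, Q x y) ->
  \forall x \near x0 & y \near x0, P x y /\ Q x y.
Proof.
move=> [[A B] [/= Ax Bx] ABP] [[C D] [/= Cx Dx] CDQ].
exists (A `&` C, B `&` D); first by split; exact: filterI.
move=> [x y] /= [[? ?] [? ?]]; split; first exact: (ABP (x, y)).
exact: (CDQ (x, y)).
Qed.

Lemma lipschitz_at_continuous x0 f : lipschitz_at x0 f -> {for x0, continuous f}.
Proof.
move=> lf; apply: (@locally_lipschitz_continuous _ _ [set x0] f) => //.
by move=> _ ->.
Qed.

Lemma near_bounded f x0 : {for x0, continuous f} ->
  exists2 K : R, 0 < K & \forall x \near x0, `|f x| <= K.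
Proof.
move=> cf; exists (`|f x0| + 1); first by rewrite ltr_wpDl.
have cn : {for x0, continuous (fun x => `|f x|)}.
  exact: (continuous_comp cf (@norm_continuous _ _ _)).
near=> x; apply: ltW; near: x; apply: (cvgr_lt _ cn); by rewrite ltrDl.
Unshelve. all: by end_near. Qed.

Lemma C1_at_continuous u u' s0 : C1_at u u' s0 -> {for s0, continuous u}.
Proof.
move=> [_ /nbhs_singleton[du _]].
by apply: differentiable_continuous; exact/derivable1_diffP.
Qed.

(** The mean value theorem replaces the difference quotient by [u'] at an intermediate point, and
    continuity of [u'] at [s0] absorbs the change of base point. *)
Lemma C1_at_increment u u' (s0 e : R) : C1_at u u' s0 -> 0 < e ->
  \forall s \near s0 & t \near s0, `|u t - u s - u' s * (t - s)| <= e * `|t - s|.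
Proof.
move=> [cu' du] e0.
have e2 : 0 < e / 2 by rewrite divr_gt0.
have nu : \forall s \near s0, `|u' s0 - u' s| <= e / 2.
  by move/cvgrPdist_le: cu'; exact.
have /nbhs_ballP[r /= r0 hr] : nbhs s0
    [set s : R | is_derive (s : R^o) 1 (u : R^o -> R^o) (u' s) /\
                 `|u' s0 - u' s| <= e / 2].
  exact: filterS2 (fun s a b => conj a b) du nu.
exists (ball s0 r, ball s0 r); first by split; apply: nbhsx_ballx.
(* The free point [a] allows either end of the interval as base point, so both orders of [s] and [t]
   are covered. *)
have main (s t a : R) : ball s0 r s -> ball s0 r t -> a \in `[s, t] -> s < t ->
    `|u t - u s - u' a * (t - s)| <= e * (t - s).
  move=> sr tr ast st.
  have str (z : R) : s <= z <= t -> ball s0 r z.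
    move=> /andP[sz zt]; move: sr tr; rewrite -!ball_normE /= !ltr_norml.
    by move=> /andP[? ?] /andP[? ?]; apply/andP; split; lra.
  have [] := @MVT R u u' s t st.
  - by move=> z; rewrite in_itv/= => /andP[sz zt]; apply: (hr z _).1; apply: str; rewrite !ltW.
  - apply: derivable_within_continuous => z; rewrite in_itv/= => szt.
    by have [] := (hr z (str z szt)).1.
  move=> z; rewrite in_itv/= => /andP[sz zt] ->.
  rewrite -mulrBl normrM (gtr0_norm (_ : 0 < t - s)) ?subr_gt0//.
  apply: ler_wpM2r; first by rewrite subr_ge0 ltW.
  have szt : s <= z <= t by rewrite !ltW.
  have ur := (hr z (str z szt)).2.
  have ar := (hr a (str a ast)).2.
  have -> : u' z - u' a = (u' s0 - u' a) - (u' s0 - u' z).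
    by rewrite opprB [RHS]addrC addrA subrK.
  by apply: (le_trans (ler_normB _ _)); rewrite [leRHS]splitr; apply: lerD.
move=> [s t] /= [sr tr].
have [st|ts|->] := ltgtP s t; last by rewrite !subrr mulr0 subr0 !normr0 mulr0.
  rewrite (gtr0_norm (_ : 0 < t - s)) ?subr_gt0//.
  by apply: main => //; rewrite in_itv/= lexx ltW.
rewrite distrC (_ : u' s * (t - s) - _ = u s - u t - u' s * (s - t)); last by ring.
rewrite [`|t - s|]distrC (gtr0_norm (_ : 0 < s - t)) ?subr_gt0//.
by apply: main => //; rewrite in_itv/= lexx ltW.
Qed.

Lemma increment_at_id x0 f : increment_at x0 f (fun x y => f y - f x).
Proof.
move=> e e0; exists (setT, setT); first by split; exact: filterT.
by move=> [x y] _ /=; rewrite subrr normr0 mulr_ge0// ltW.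
Qed.

Lemma increment_at_comp x0 f (u u' : R -> R) : lipschitz_at x0 f ->
  C1_at u u' (f x0) -> increment_at x0 (u \o f) (fun x y => u' (f x) * (f y - f x)).
Proof.
move=> lf cu e e0; have cf := lipschitz_at_continuous lf.
have [K nK] := lf.
have K1 : 0 < `|K| + 1 by rewrite ltr_wpDl.
have eK : 0 < e / (`|K| + 1) by rewrite divr_gt0.
have [[U W] /= [fU fW] UW] := C1_at_increment cu eK.
have nU : \forall x \near x0, U (f x) by exact: (cf _ fU).
have nW : \forall x \near x0, W (f x) by exact: (cf _ fW).
have := near2I nK (near2I (near2_fst nU) (near2_snd nW)).
apply: near2S => x y /= [xy [Ux Wy]].
apply: (le_trans (UW (f x, f y) (conj Ux Wy))) => /=.
rewrite mulrAC ler_pdivrMr// -mulrA ler_wpM2l ?(ltW e0)//.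
rewrite [`|f y - _|]distrC [`|y - x|]distrC; apply: (le_trans xy).
rewrite mulrC ler_wpM2l// (le_trans (ler_norm _))//.
by rewrite lerDl.
Qed.

Lemma lipschitz_at_comp x0 f (u u' : R -> R) : lipschitz_at x0 f ->
  C1_at u u' (f x0) -> lipschitz_at x0 (u \o f).
Proof.
move=> lf cu; have cf := lipschitz_at_continuous lf.
have [K nK] := lf.
have [[U W] /= [fU fW] UW] := C1_at_increment cu (@ltr01 R).
have nU : \forall x \near x0, U (f x) by exact: (cf _ fU).
have nW : \forall x \near x0, W (f x) by exact: (cf _ fW).
have cuf : {for x0, continuous (u' \o f)} by apply: continuous_comp => //; exact: cu.1.
have [B B0 nB] := near_bounded cuf.
exists ((B + 1) * K).
have := near2I (near2I nK (near2_snd nB)) (near2I (near2_fst nW) (near2_snd nU)).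
apply: near2S => x y /= [[xy uB] [Wx Uy]].
have := UW (f y, f x) (conj Uy Wx); rewrite /= mul1r => h.
rewrite -[u _ - _](subrK (u' (f y) * (f x - f y))).
rewrite (le_trans (ler_normD _ _))// normrM.
apply: (@le_trans _ _ ((B + 1) * `|f x - f y|)); last first.
  by rewrite -mulrA ler_wpM2l// addr_ge0// ltW.
by rewrite mulrDl mul1r addrC lerD// ler_wpM2r.
Qed.

Lemma lipschitz_atM x0 f1 f2 : lipschitz_at x0 f1 -> lipschitz_at x0 f2 ->
  lipschitz_at x0 (fun x => f1 x * f2 x).
Proof.
move=> l1 l2; have [K1 n1] := l1; have [K2 n2] := l2.
have [B1 B10 b1] := near_bounded (lipschitz_at_continuous l1).
have [B2 B20 b2] := near_bounded (lipschitz_at_continuous l2).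
exists (B1 * K2 + B2 * K1).
have := near2I (near2I n1 n2) (near2I (near2_fst b1) (near2_snd b2)).
apply: near2S => x y /= [[xy1 xy2] [B1x B2y]].
have -> : f1 x * f2 x - f1 y * f2 y = f1 x * (f2 x - f2 y) + f2 y * (f1 x - f1 y).
  by ring.
rewrite (le_trans (ler_normD _ _))// !normrM mulrDl -!mulrA lerD//.
  by apply: ler_pM.
by apply: ler_pM.
Qed.

(** The remainder is the two individual remainders times bounded factors, plus a product of two
    increments. The latter is quadratic in the distance, hence below e/3 times it for close
    points. *)
Lemma increment_atM x0 f1 f2 L1 L2 : lipschitz_at x0 f1 -> lipschitz_at x0 f2 ->
  increment_at x0 f1 L1 -> increment_at x0 f2 L2 ->
  increment_at x0 (fun x => f1 x * f2 x) (fun x y => f1 x * L2 x y + f2 x * L1 x y).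
Proof.
move=> l1 l2 i1 i2 e e0; have [K1 n1] := l1; have [K2 n2] := l2.
have [B1 B10 b1] := near_bounded (lipschitz_at_continuous l1).
have [B2 B20 b2] := near_bounded (lipschitz_at_continuous l2).
have e3 : 0 < e / 3 by rewrite divr_gt0.
have KK : 0 < `|K1| * `|K2| + 1 by rewrite ltr_wpDl// mulr_ge0.
have nxy : \forall x \near x0 & y \near x0, `|y - x| <= e / 3 / (`|K1| * `|K2| + 1).
  have r0 : 0 < e / 3 / (`|K1| * `|K2| + 1) / 2 by rewrite !divr_gt0.
  exists (ball x0 (e / 3 / (`|K1| * `|K2| + 1) / 2),
          ball x0 (e / 3 / (`|K1| * `|K2| + 1) / 2)).
    by split; apply: nbhsx_ballx.
  move=> [x y] /= []; rewrite -!ball_normE /= => xr yr.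
  have -> : y - x = (x0 - x) - (x0 - y) by rewrite opprB [RHS]addrC addrA subrK.
  rewrite (le_trans (ler_normB _ _))// [leRHS]splitr lerD//; exact: ltW.
have := near2I (near2I (near2I n1 n2) (near2I (near2_fst b1) (near2_fst b2)))
  (near2I nxy (near2I (i1 _ (divr_gt0 e3 B20)) (i2 _ (divr_gt0 e3 B10)))).
apply: near2S => x y /= [[[xy1 xy2] [B1x B2x]] [dxy [h1 h2]]].
have -> : f1 y * f2 y - f1 x * f2 x - (f1 x * L2 x y + f2 x * L1 x y) =
   f1 x * (f2 y - f2 x - L2 x y) + f2 x * (f1 y - f1 x - L1 x y) +
   (f1 x - f1 y) * (f2 x - f2 y) by ring.
have -> : e * `|y - x| = e / 3 * `|y - x| + e / 3 * `|y - x| + e / 3 * `|y - x|.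
  by rewrite -!mulrDl; congr (_ * _); field.
rewrite (le_trans (ler_normD _ _))// lerD//.
  rewrite (le_trans (ler_normD _ _))// lerD// normrM.
    apply: (le_trans (ler_pM _ _ B1x h2)) => //.
    by rewrite mulrA [B1 * _]mulrC divfK// gt_eqF.
  apply: (le_trans (ler_pM _ _ B2x h1)) => //.
  by rewrite mulrA [B2 * _]mulrC divfK// gt_eqF.
rewrite normrM; apply: (@le_trans _ _ ((`|K1| * `|x - y|) * (`|K2| * `|x - y|))).
  apply: ler_pM => //.
    by apply: (le_trans xy1); rewrite ler_wpM2r// ler_norm.
  by apply: (le_trans xy2); rewrite ler_wpM2r// ler_norm.
rewrite mulrACA mulrA ![`|x - y|]distrC ler_wpM2r//.
apply: (@le_trans _ _ ((`|K1| * `|K2| + 1) * `|y - x|)).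
  by rewrite ler_wpM2r// lerDl.
by rewrite mulrC -ler_pdivlMr.
Qed.

Lemma weak_partial_eq O i f df df' : (forall x, O x -> df x = df' x) ->
  weak_partial O i f df -> weak_partial O i f df'.
Proof.
move=> dd [di fD]; split=> [K cK KO|eta se ce sO].
  apply: eq_integrable (di K cK KO); first exact: compact_measurable_row.
  by move=> t; rewrite inE => /KO Ot; rewrite dd.
rewrite fD//; congr (- _)%E; apply: eq_integral => t.
by rewrite inE => Ot; rewrite dd.
Qed.

(* u and w may be singular, hence the restriction of their regularity to the support
   of f3. *)
Section product.
Variables (O : set V) (f1 f2 f3 : V -> R) (u u' w w' : R -> R).
Hypothesis oO : open O.
Hypotheses (l1 : locally_lipschitz O f1) (l2 : locally_lipschitz O f2)
  (l3 : locally_lipschitz O f3).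
Hypothesis reg : forall x, O x -> (\forall y \near x, f3 y = 0) \/
  (C1_at u u' (f1 x) /\ C1_at w w' (f2 x)).

Let psi x := u (f1 x) * w (f2 x) * (f3 x * f3 x).
Let G1 x := u' (f1 x) * w (f2 x) * (f3 x * f3 x).
Let G2 x := u (f1 x) * w' (f2 x) * (f3 x * f3 x).
Let G3 x := u (f1 x) * w (f2 x) * (2 * f3 x).

Let vanish (F : V -> R) x : (\forall y \near x, F y = 0) -> {for x, continuous F}.
Proof.
move=> F0; apply: (@near_eq_continuous_at _ _ (fun=> 0)); last exact: cst_continuous.
by apply: filterS F0 => y ->.
Qed.

(** Every coefficient keeps a factor that vanishes with [f3], so the singular factors do no harm
    where [f3] is zero nearby. *)
Let cont (F1 F2 F3 : V -> R) x : O x ->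
  (forall y, f3 y = 0 -> F3 y = 0) ->
  (C1_at u u' (f1 x) -> {for x, continuous F1}) ->
  (C1_at w w' (f2 x) -> {for x, continuous F2}) -> {for x, continuous F3} ->
  {for x, continuous (fun y => F1 y * F2 y * F3 y)}.
Proof.
move=> Ox F0 c1 c2 c3; have [f0|[hu hw]] := reg Ox.
  apply: vanish; apply: filterS f0 => y fy.
  by rewrite F0// mulr0.
exact: (continuousM (continuousM (c1 hu) (c2 hw)) c3).
Qed.

Let c1 := locally_lipschitz_continuous l1.
Let c2 := locally_lipschitz_continuous l2.
Let c3 := locally_lipschitz_continuous l3.

Let c33 x : O x -> {for x, continuous (fun y => f3 y * f3 y)}.
Proof. by move=> Ox; exact: (continuousM (c3 Ox) (c3 Ox)). Qed.

Let G1_continuous : continuous_on O G1.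
Proof.
move=> x Ox; apply: cont => //; last exact: c33.
- by move=> y ->; rewrite mulr0.
- by move=> [cu' _]; apply: continuous_comp; [exact: c1|].
- by move=> /C1_at_continuous cw; apply: continuous_comp; [exact: c2|].
Qed.

Let G2_continuous : continuous_on O G2.
Proof.
move=> x Ox; apply: cont => //; last exact: c33.
- by move=> y ->; rewrite mulr0.
- by move=> /C1_at_continuous cu; apply: continuous_comp; [exact: c1|].
- by move=> [cw' _]; apply: continuous_comp; [exact: c2|].
Qed.

Let G3_continuous : continuous_on O G3.
Proof.
move=> x Ox; apply: cont => //.
- by move=> y ->; rewrite mulr0.
- by move=> /C1_at_continuous cu; apply: continuous_comp; [exact: c1|].
- by move=> /C1_at_continuous cw; apply: continuous_comp; [exact: c2|].
- exact: (continuousM (@cst_continuous _ _ (2 : R) x) (c3 Ox)).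
Qed.

Lemma product_lipschitz : locally_lipschitz O psi.
Proof.
move=> x Ox; have [f0|[hu hw]] := reg Ox.
  exists 0; have := near2I (near2_fst f0) (near2_snd f0).
apply: near2S => y z /= [y0 z0].
  by rewrite /psi y0 z0 !mulr0 subrr normr0 mul0r.
apply: lipschitz_atM; first apply: lipschitz_atM.
- by apply: lipschitz_at_comp hu; exact: l1.
- by apply: lipschitz_at_comp hw; exact: l2.
- by apply: lipschitz_atM; exact: l3.
Qed.

Let psi_increment x : O x -> increment_at x psi (fun x y =>
  G1 x * (f1 y - f1 x) + G2 x * (f2 y - f2 x) + G3 x * (f3 y - f3 x)).
Proof.
move=> Ox; have [f0|[hu hw]] := reg Ox.
  move=> e e0; have := near2I (near2_fst f0) (near2_snd f0).
apply: near2S => y z /= [y0 z0].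
  rewrite /psi /G1 /G2 /G3 y0 z0 !mulr0 !mul0r !addr0 !subr0 normr0.
  by rewrite mulr_ge0// ltW.
have lu := lipschitz_at_comp (l1 Ox) hu.
have lw := lipschitz_at_comp (l2 Ox) hw.
have l33 := lipschitz_atM (l3 Ox) (l3 Ox).
have iuw := increment_atM lu lw (increment_at_comp (l1 Ox) hu)
  (increment_at_comp (l2 Ox) hw).
have i33 := increment_atM (l3 Ox) (l3 Ox) (increment_at_id x f3) (increment_at_id x f3).
have := increment_atM (lipschitz_atM lu lw) l33 iuw i33.
move=> h e e0; have := h e e0; apply: near2S => y z /=.
rewrite /psi /G1 /G2 /G3; congr (is_true (`|_ - _| <= _)).
by ring.
Qed.

Lemma product_weak_partial i (df1 df2 df3 : V -> R) :
  weak_partial O i f1 df1 -> weak_partial O i f2 df2 -> weak_partial O i f3 df3 ->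
  weak_partial O i psi (fun x => G1 x * df1 x + G2 x * df2 x + G3 x * df3 x).
Proof.
move=> w1 w2 w3; apply: (weak_partial_chain oO l1 l2 l3) => //.
exact: locally_lipschitz_continuous product_lipschitz.
Qed.

End product.

End first_order_calculus.

(** * Test functions *)

Section C1_functions.
Context {R : realType} {n : nat}.
Local Notation mu := (lebesgue_tuple R n).
Local Notation row := (@row_of_tuple R n).
Local Notation quot f i h x := ((f (x - h *: std_vec i) - f x) / h).
Implicit Types (O K : set 'rV[R]_n) (f : 'rV[R]_n -> R^o).

Lemma ball_segment (x0 x y : 'rV[R]_n) (r s : R) : ball x0 r x -> ball x0 r y ->
  0 <= s <= 1 -> ball x0 r (s *: (y - x) + x).
Proof.
rewrite -!ball_normE /= => xr yr /andP[s0 s1].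
have -> : x0 - (s *: (y - x) + x) = (1 - s) *: (x0 - x) + s *: (x0 - y).
  by apply/rowP => j; rewrite !mxE; ring.
rewrite (le_lt_trans (ler_normD _ _))// !normrZ !ger0_norm ?subr_ge0//.
have [->|sn0] := eqVneq s 0; first by rewrite subr0 mul1r mul0r addr0.
have s0' : 0 < s by rewrite lt_neqAle eq_sym sn0.
have h1 : s * `|x0 - y| < s * r by rewrite ltr_pM2l.
have h2 : (1 - s) * `|x0 - x| <= (1 - s) * r by rewrite ler_wpM2l ?subr_ge0// ltW.
by move: h1 h2; set a := s * `|_|; set b := (1 - s) * `|_|; lra.
Qed.

Lemma derive_norm_le f (z v : 'rV[R]_n) : differentiable f z ->
  `|'D_v f z| <= (\sum_i `|'D_(std_vec i) f z|) * `|v|.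
Proof.
move=> df; rewrite deriveE// [v in 'd f z v]row_sum_delta linear_sum.
apply: (le_trans (ler_norm_sum _ _ _)); rewrite mulr_suml; apply: ler_sum => i _.
rewrite linearZ/= -deriveE// normrM mulrC ler_wpM2l//.
rewrite [leRHS]mx_normrE.
exact: (le_bigmax_cond _ (fun i0 : 'I_1 * 'I_n => `|v i0.1 i0.2|) (isT : xpredT (ord0, i))).
Qed.

Lemma C1_locally_lipschitz O f : open O -> Ck_on 1 O f -> locally_lipschitz O f.
Proof.
move=> oO [df cD] x0 Ox0.
pose F x : R := \sum_i `|'D_(std_vec i) f x|.
have cF : {for x0, continuous F}.
  apply: continuous_at_sum => i.
  exact: (continuous_comp (cD (std_vec i) x0 Ox0) (@norm_continuous _ _ _)).
have /nbhs_ballP[r /= r0 hr] : nbhs x0 [set x | O x /\ F x <= F x0 + 1].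
  have n1 : nbhs x0 O by exact: open_nbhs_nbhs.
  have n2 : \forall x \near x0, F x < F x0 + 1.
    by apply: (cvgr_lt _ cF); rewrite ltrDl.
  by apply: filterS2 n1 n2 => x Ox /ltW.
exists (F x0 + 1).
exists (ball x0 r, ball x0 r); first by split; apply: nbhsx_ballx.
move=> [x y] /= [xr yr].
have [] := @mean_value_line _ _ f (x - y) y 1 ltr01.
  by move=> s s01; apply: df; exact: (hr _ (ball_segment yr xr s01)).1.
move=> c [/andP[c0 c1]]; rewrite scale1r subrK mul1r => ->.
have c01 : 0 <= c <= 1 by rewrite !ltW.
have [Oz Fz] := hr _ (ball_segment yr xr c01).
by apply: (le_trans (derive_norm_le _ (df _ Oz))); rewrite ler_wpM2r.
Qed.

Lemma near_quotient_C1 O f i K (e : R) : open O -> Ck_on 1 O f ->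
  compact K -> K `<=` O -> 0 < e ->
  \forall h \near (0 : R)^'+, forall x, K x -> `|quot f i h x + 'D_(std_vec i) f x| <= e.
Proof.
move=> oO [df /(_ (std_vec i)) cD] cK KO e0.
have e2 : 0 < e / 2 by rewrite divr_gt0.
have nc := iffLR (compact_near_coveringP K) cK R (0 : R)^'+
  (fun h x => `|quot f i h x + 'D_(std_vec i) f x| <= e) _.
apply: nc => x0 /KO Ox0.
have /nbhs_ballP[r /= r0 hr] : nbhs x0
    [set x | O x /\ `|'D_(std_vec i) f x0 - 'D_(std_vec i) f x| <= e / 2].
  have n1 : nbhs x0 O by exact: open_nbhs_nbhs.
  have n2 : \forall x \near x0, `|'D_(std_vec i) f x0 - 'D_(std_vec i) f x| <= e / 2.
    by have /cvgrPdist_le := cD _ Ox0; exact.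
  by apply: filterS2 n1 n2 => x.
have [[U W] /= [x0U W0] UW] := near_sub_line i (nbhsx_ballx x0 _ r0).
exists (U `&` ball x0 r, [set h | 0 < h /\ W h]) => /=.
  split; first by apply: filterI => //; exact: nbhsx_ballx.
  by near=> h; split; near: h => //; exact: nbhs_right_gt.
move=> [x h] /= [[Ux xr] [h0 Wh]].
have xhr : ball x0 r (x - h *: std_vec i) := UW (x, h) (conj Ux Wh).
have seg s : 0 <= s <= h -> ball x0 r (s *: std_vec i + (x - h *: std_vec i)).
  move=> /andP[s0 sh].
  have := ball_segment (s := s / h) xhr xr.
  have -> : x - (x - h *: std_vec i) = h *: std_vec i by rewrite subKr.
  rewrite scalerA divfK ?gt_eqF//; apply.
  by rewrite divr_ge0 ?(ltW h0)//= ler_pdivrMr// mul1r.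
have [] := mean_value_line (x := x - h *: std_vec i) h0 (fun s sh => df _ (hr _ (seg s sh)).1).
move=> c [/andP[c0 ch]].
have -> : h *: std_vec i + (x - h *: std_vec i) = x by rewrite addrC subrK.
move=> E; rewrite -opprB E mulNr mulrAC mulfV ?gt_eqF// mul1r addrC.
have c0h : 0 <= c <= h by rewrite !ltW.
have h1 := (hr _ xr).2; have h2 := (hr _ (seg c c0h)).2.
rewrite -[X in `|X|](_ : ('D_(std_vec i) f x0 - 'D_(std_vec i) f
  (c *: std_vec i + (x - h *: std_vec i))) - ('D_(std_vec i) f x0 - 'D_(std_vec i) f x) = _).
  by apply: (le_trans (ler_normB _ _)); rewrite [leRHS]splitr; apply: lerD => //; exact: h2.
by move: ('D_ _ f _) ('D_ _ f _) ('D_ _ f _) => a b d; ring.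
Unshelve. all: by end_near. Qed.

(** The integrals of the difference quotients against [eta] have two limits: one by translation, one
    by uniform convergence of the quotients to minus the derivative. *)
Lemma C1_weak_partial O f i : open O -> Ck_on 1 O f ->
  weak_partial O i f ('D_(std_vec i) f : _ -> R).
Proof.
move=> oO C1f; have [df /(_ (std_vec i)) cD] := C1f.
have cDf : continuous_on O ('D_(std_vec i) f : _ -> R) by exact: cD.
have cf : continuous_on O f.
  exact: locally_lipschitz_continuous (C1_locally_lipschitz oO C1f).
apply/(weak_partialE i _ oO cf); split.
  move=> K cK KO.
  exact: (integrable_continuous_on (F := 'D_(std_vec i) f : _ -> R) oO cK KO cDf).
move=> eta K se cK KO sK.
have mK := compact_measurable_row cK.
have ceta : continuous_on O (eta : _ -> R) by move=> x _; exact: smooth_continuous.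
have Kfin := compact_lebesgue_tuple_fin cK.
pose m := fine (mu (row @^-1` K)).
have m0 : 0 <= m by exact: fine_ge0.
have [M [M0 eM]] : exists M, 0 < M /\ forall x, K x -> `|eta x| <= M.
  by apply: near_compact_bounded => // x /KO; exact: ceta.
have cvg0 := cvg_difference_quotient (i := i) oO cf se cK KO sK.
have iD : mu.-integrable (row @^-1` K)
    (fun t => ('D_(std_vec i) f (row t) * eta (row t))%:E).
  apply: (integrable_continuousM (F := 'D_(std_vec i) f : _ -> R) oO cK KO ceta).
  exact: (integrable_continuous_on (F := 'D_(std_vec i) f : _ -> R) oO cK KO cDf).
rewrite -(cvg_lim (@Rhausdorff R) cvg0); apply: cvg_lim => //.
apply/cvgrPdist_le => e e0.
have D0 : 0 < e / (m + 1) / M by rewrite !divr_gt0// ltr_wpDl.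
have nq := near_quotient_C1 i oO C1f cK KO D0.
near=> h.
have iq : mu.-integrable (row @^-1` K)
    (fun t => (quot f i h (row t) * eta (row t))%:E).
  near: h; exact: (near_quotient_integrable i (F := eta : _ -> R) oO cK KO cf ceta).
have hq : forall x, K x -> `|quot f i h x + 'D_(std_vec i) f x| <= e / (m + 1) / M.
  by near: h; exact: nq.
rewrite -opprD normrN -RintegralD//.
apply: le_trans (le_normr_Rintegral _ _) _ => //; first exact: integrableD_EFin.
apply: (@le_trans _ _ (\int[mu]_(t in row @^-1` K) (e / (m + 1)))).
  apply: le_Rintegral => //.
  - by apply: integrable_normr_EFin => //; exact: integrableD_EFin.
  - exact: integrable_cst.
  - move=> t Kt; rewrite -mulrDl normrM addrC.
    apply: (@le_trans _ _ (e / (m + 1) / M * M)).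
      by apply: ler_pM => //; [exact: hq|exact: eM].
    by rewrite divfK ?gt_eqF.
rewrite Rintegral_cst// -/m mulrAC ler_pdivrMr ?ltr_wpDl//.
by rewrite ler_wpM2l ?(ltW e0)// lerDl.
Unshelve. all: by end_near. Qed.

End C1_functions.

(** * Algebra of the metric and the product test functions *)

Section test_functions.
Context {R : realType} {n : nat} {M : manifold R n} (g : riemannian_metric M).

Lemma innerDl p (v1 v2 w : tangent p) :
  inner g (v1 + v2 : tangent p) w = inner g v1 w + inner g v2 w.
Proof. by rewrite /inner !mulmxDl mxE. Qed.

Lemma innerZl p (k : R) (v w : tangent p) :
  inner g (k *: v : tangent p) w = k * inner g v w.
Proof. by rewrite /inner -!scalemxAl mxE. Qed.

Lemma innerC p (v w : tangent p) : inner g v w = inner g w v.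
Proof.
rewrite /inner; have -> : (v *m metric_at g p *m w^T) ord0 ord0 =
  (v *m metric_at g p *m w^T)^T ord0 ord0 by rewrite [RHS]mxE.
by rewrite !trmx_mul trmxK Defs.metric_sym mulmxA.
Qed.

Lemma innerDr p (v w1 w2 : tangent p) :
  inner g v (w1 + w2 : tangent p) = inner g v w1 + inner g v w2.
Proof. by rewrite innerC innerDl !(innerC v). Qed.

Lemma innerZr p (k : R) (v w : tangent p) :
  inner g v (k *: w : tangent p) = k * inner g v w.
Proof. by rewrite innerC innerZl innerC. Qed.

Lemma inner_ge0 p (v : tangent p) : 0 <= inner g v v.
Proof.
have [->|v0] := eqVneq (v : 'rV[R]_n) 0; first by rewrite /inner !mul0mx mxE.
exact/ltW/metric_pos.
Qed.

Lemma smooth_locally_lipschitz (phi : M -> R) (c : chart R n M) : smooth phi -> atlas c ->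
  locally_lipschitz (chart_cod c) (phi \o chart_inv c).
Proof.
move=> sphi ac; apply: C1_locally_lipschitz (sphi c ac 1%N).
exact: chart_cod_open.
Qed.

(** [grad] is computed in [chart_at p]; the chain rule for the transition map identifies its
    components in an arbitrary chart. *)
Lemma grad_coord (phi : M -> R) (c : chart R n M) i x :
  smooth phi -> atlas c -> chart_cod c x ->
  inner g (grad g phi (chart_inv c x)) (coord_vec c i (chart_inv c x)) =
  'D_(std_vec i) (phi \o chart_inv c : _ -> R^o) x.
Proof.
move=> sphi ac cx; set p := chart_inv c x; set c' := chart_at p.
have ac' : atlas c' by exact: chart_at_atlas.
have c'p : chart_dom c' p by exact: chart_at_dom.
have cp : chart_dom c p by exact: chart_inv_dom.
have Ox : overlap c c' x by [].
have Tx : transition c c' x = chart_to c' p by [].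
have dT : differentiable (transition c c') x by exact: transition_differentiable.
have dphi : differentiable (phi \o chart_inv c' : _ -> R^o) (transition c c' x).
  by have [+ _] := sphi c' ac' 1%N; apply; exact: chart_to_cod.
have -> : 'D_(std_vec i) (phi \o chart_inv c : _ -> R^o) x =
    'D_(std_vec i) ((phi \o chart_inv c' : _ -> R^o) \o transition c c') x.
  apply: near_eq_derive.
  have nO : nbhs x (overlap c c').
    by apply: open_nbhs_nbhs; split => //; exact: overlap_open.
  by apply: filterS nO => z [cz c'z]; rewrite /= /transition /= (chart_toK c'z).
rewrite deriveE; last exact: differentiable_comp.
rewrite diff_comp//= -(deriveE (std_vec i) dT).
have -> : coord_vec c i p = 'D_(std_vec i) (transition c c') x :> 'rV[R]_n.
  by rewrite /coord_vec (chart_invK cx).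
set w : 'rV[R]_n := 'D_(std_vec i) (transition c c') x.
rewrite /inner /grad -/c' mulmxKV ?metric_unit// mxE.
rewrite [w in RHS]row_sum_delta linear_sum; apply: eq_bigr => j _.
by rewrite !mxE linearZ/= -deriveE// mulrC.
Qed.

Lemma smooth_weak_grad (phi : M -> R) : smooth phi -> is_weak_grad g phi (grad g phi).
Proof.
move=> sphi c ac i.
have oc : open (chart_cod c) by exact: chart_cod_open.
have := C1_weak_partial i oc (sphi c ac 1%N).
by apply: weak_partial_eq => x cx; exact: (esym (grad_coord i sphi ac cx)).
Qed.

Section product.
Variables (f1 f2 phi : M -> R) (G1 G2 : vector_field M) (u u' w w' : R -> R).
Hypotheses (l1 : locally_rlipschitz g f1) (w1 : is_weak_grad g f1 G1).
Hypotheses (l2 : locally_rlipschitz g f2) (w2 : is_weak_grad g f2 G2).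
Hypotheses (sphi : smooth phi) (cphi : compact (support_of phi)).
Hypothesis reg : forall p, support_of phi p ->
  C1_at u u' (f1 p) /\ C1_at w w' (f2 p).

(** The common shape of psi1 ([f1] is a, [u] the identity) and psi2 ([f1] is delta, [u] its
    inverse), with a power of rho as second factor. *)
Definition test_product p := u (f1 p) * w (f2 p) * (phi p * phi p).

Definition test_product_grad : vector_field M := fun p =>
  (u' (f1 p) * w (f2 p) * (phi p * phi p)) *: G1 p +
  (u (f1 p) * w' (f2 p) * (phi p * phi p)) *: G2 p +
  (u (f1 p) * w (f2 p) * (2 * phi p)) *: grad g phi p.

Let chart_reg c x : atlas c -> chart_cod c x ->
  (\forall y \near x, phi (chart_inv c y) = 0) \/
  (C1_at u u' (f1 (chart_inv c x)) /\ C1_at w w' (f2 (chart_inv c x))).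
Proof.
move=> ac cx; have [/reg|np] := pselect (support_of phi (chart_inv c x)); first by right.
left; have nS : nbhs (chart_inv c x) (~` support_of phi).
  by apply: open_nbhs_nbhs; split => //; rewrite openC; exact: closed_closure.
have nx : \forall y \near x, ~ support_of phi (chart_inv c y).
  exact: (chart_inv_continuous cx nS).
by apply: filterS nx => y ny; exact: support_of_eq0.
Qed.

Lemma test_product_support : support_of test_product `<=` support_of phi.
Proof.
apply: closure_subset => p /=; apply: contra_neq => phi0.
by rewrite /test_product phi0 !mulr0.
Qed.

Lemma test_product_compact : compact (support_of test_product).
Proof.
by apply: (subclosed_compact _ cphi test_product_support); exact: closed_closure.
Qed.

Lemma test_product_rlipschitz : rlipschitz g test_product.
Proof.
apply: (compact_support_rlipschitz _ test_product_compact) => c ac.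
apply: (@product_lipschitz _ _ (chart_cod c) (f1 \o chart_inv c) (f2 \o chart_inv c)
  (phi \o chart_inv c) u u' w w').
- exact: locally_rlipschitz_chart ac l1.
- exact: locally_rlipschitz_chart ac l2.
- exact: smooth_locally_lipschitz.
- by move=> x cx; exact: chart_reg.
Qed.

Lemma test_product_weak_grad : is_weak_grad g test_product test_product_grad.
Proof.
move=> c ac i; have oc : open (chart_cod c) by exact: chart_cod_open.
have := @product_weak_partial _ _ (chart_cod c) (f1 \o chart_inv c) (f2 \o chart_inv c)
  (phi \o chart_inv c) u u' w w' oc (locally_rlipschitz_chart ac l1)
  (locally_rlipschitz_chart ac l2) (smooth_locally_lipschitz sphi ac)
  (fun x cx => chart_reg ac cx) i _ _ _ (w1 ac i) (w2 ac i) (smooth_weak_grad sphi ac i).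
apply: weak_partial_eq => x cx.
by rewrite /test_product_grad !innerDl !innerZl.
Qed.

End product.

End test_functions.

(** * Integration against the Riemannian volume *)

Section measure_domination.
Local Open Scope ereal_scope.
Context d (T : measurableType d) (R : realType).
Variables (m1 m2 : {measure set T -> \bar R}) (D : set T).

Import HBNNSimple.

(** A simple function below the restriction of [f] to [D] has all its level sets of nonzero value
    inside [D], where the measures are compared. *)
Lemma ge0_le_measure_integral (f : T -> \bar R) : (forall x, D x -> 0 <= f x) ->
  (forall A, measurable A -> A `<=` D -> m1 A <= m2 A) ->
  \int[m1]_(x in D) f x <= \int[m2]_(x in D) f x.
Proof.
move=> f0 m12; rewrite !ge0_integralE//.
apply: ge_ereal_sup => _ /= [h hfD <-].
apply: (@le_trans _ _ (sintegral m2 h)); last first.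
  by apply: ereal_sup_ubound; exists h.
rewrite !sintegralE; apply: lee_fsum; first exact: fimfunP.
move=> r [x _ hx]; have r0 : (0 <= r)%R by rewrite -hx fun_ge0.
have [->|rn0] := eqVneq r 0%R; first by rewrite !mul0e.
apply: lee_wpmul2l; first by rewrite lee_fin.
apply: m12 => // y hy; apply: contrapT => nDy.
have := hfD y; rewrite patchE memNset// hy lee_fin => r0'.
by move: rn0; rewrite eq_le r0 r0'.
Qed.

End measure_domination.

Section integrable_union.
Context d (T : measurableType d) (R : realType) (m : {measure set T -> \bar R}).

Lemma integrable_setU (A B : set T) (f : T -> \bar R) :
  measurable A -> measurable B -> m.-integrable A f -> m.-integrable B f ->
  m.-integrable (A `|` B) f.
Proof.
move=> mA mB /integrableP[mfA fA] /integrableP[mfB fB].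
have mBA : measurable (B `\` A) by exact: measurableD.
have mU : measurable_fun (A `|` B) f by apply/measurable_funU.
apply/integrableP; split => //.
have -> : A `|` B = A `|` (B `\` A).
  apply/seteqP; split=> x; last by move=> [|[]]; [left|right].
  by move=> [|Bx]; [left|have [|nA] := pselect (A x); [left|right]].
rewrite ge0_integral_setU//.
- apply: lte_add_pinfty => //; apply: le_lt_trans fB.
  apply: ge0_subset_integral => //.
  by apply: measurableT_comp.
- apply: measurableT_comp => //; apply: measurable_funS mU; first exact: measurableU.
  by move=> x [|[]]; [left|right].
- apply/disj_setPS => x [Ax [_ nAx]]; exact: nAx.
Qed.

End integrable_union.

Lemma pushforward_measure {d1 d2} {R : realType} (X : measurableType d1)
    (Y : measurableType d2) (mu : {measure set X -> \bar R}) (s : X -> Y)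
    (ms : measurable_fun setT s) :
  exists m2 : {measure set Y -> \bar R}, (forall A, m2 A = mu (s @^-1` A)) /\
    forall D (f : Y -> \bar R), measurable D -> measurable_fun D f ->
      (forall y, D y -> 0 <= f y)%E ->
      (\int[m2]_(y in D) f y = \int[mu]_(x in s @^-1` D) f (s x))%E.
Proof.
pose m2 : {measure set Y -> \bar R} := pushforward mu s.
exists (m2 ms); split=> // D f mD mf f0; rewrite /m2 ge0_integral_pushforward//.
by move=> y; rewrite inE; exact: f0.
Qed.

Section chart_pieces.
Context {R : realType} {n : nat} {M : manifold R n} (g : riemannian_metric M).
Variable vol : {measure set (borel M) -> \bar R}.
Hypothesis vol_g : is_riemannian_volume g vol.
Hypothesis M_noncompact : ~ compact [set: M].
Local Notation mu := (lebesgue_tuple R n).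
Local Notation row := (@row_of_tuple R n).
Local Notation mR := (measurableTypeR R).

Lemma open_measurable_borel (U : set M) : open U -> measurable (U : set (borel M)).
Proof. by move=> oU; apply: sub_sigma_algebra. Qed.

Lemma compact_measurable_borel (K : set M) :
  compact K -> measurable (K : set (borel M)).
Proof.
move=> /(compact_closed (@point_space_hausdorff _ _ M)) cK.
rewrite -[K]setCK; apply: measurableC; apply: open_measurable_borel.
by rewrite openC.
Qed.

Section piece.
Variables (c : chart R n M) (B : set 'rV[R]_n).
Hypotheses (ac : atlas c) (cB : compact B) (Bc : B `<=` chart_cod c).

Definition chart_piece : set M := chart_inv c @` B.

Lemma chart_piece_compact : compact chart_piece.
Proof.
apply: continuous_compact => //; apply: continuous_in_subspaceT => x.
by rewrite inE => /Bc cx; exact: chart_inv_continuous.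
Qed.

Lemma chart_piece_measurable : measurable (chart_piece : set (borel M)).
Proof. exact: compact_measurable_borel chart_piece_compact. Qed.

Lemma chart_piece_dom p : chart_piece p -> chart_dom c p.
Proof. by move=> [x /Bc cx <-]; exact: chart_inv_dom. Qed.

Lemma chart_pieceE x : chart_cod c x -> chart_piece (chart_inv c x) <-> B x.
Proof.
move=> cx; split=> [[y By yx]|]; last by exists x.
by rewrite -(chart_invK cx) -yx chart_invK//; exact: Bc.
Qed.

Lemma measurable_chart_piece (F : M -> R) :
  measurable_fun (row @^-1` B) (fun t => F (chart_inv c (row t))) ->
  measurable_fun (chart_piece : set (borel M)) F.
Proof.
move=> mF.
(* Restriction to the piece makes the coordinates measurable on all of [M], although [chart_to c] is
   arbitrary off its domain. *)
pose co i (p : borel M) : mR := ((fun p => chart_to c p ord0 i) \_ chart_piece) p.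
pose tau (p : borel M) : n.-tuple mR := [tuple co i p | i < n].
have mtau : measurable_fun [set: borel M] tau.
  apply/measurable_fun_tnthP => i.
  rewrite (_ : _ \o _ = co i); last by apply/funext => p; rewrite /= tnth_mktuple.
  apply: (measurable_restrictT _ chart_piece_measurable).1.
  have mdom : measurable (chart_dom c : set (borel M)).
    by apply: open_measurable_borel; exact: chart_dom_open.
  apply: (@measurable_funS _ _ (borel M) mR (chart_dom c)) => //.
    by move=> p; exact: chart_piece_dom.
  apply: measurable_fun_open_preimage => O oO; apply: open_measurable_borel.
  rewrite openE => p [cp Op]; apply: filterI.
    by apply: open_nbhs_nbhs; split => //; exact: chart_dom_open.
  have cco : {for p, continuous (fun p => chart_to c p ord0 i)}.
    exact: (continuous_comp (chart_to_continuous cp) (@coord_continuous _ _ _ _ _ _)).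
  by apply: cco; exact: open_nbhs_nbhs.
have rtau p : chart_piece p -> row (tau p) = chart_to c p.
  by move=> Ap; apply/rowP => i; rewrite mxE tnth_mktuple /co patchE mem_set.
apply: (@eq_measurable_fun _ _ _ _ _ ((fun t => F (chart_inv c (row t))) \o tau)).
  by move=> p; rewrite inE => Ap; rewrite /= rtau// chart_toK//; exact: chart_piece_dom.
apply: (measurable_comp (F := row @^-1` B)) => //.
- exact: compact_measurable_row.
- move=> _ [p Ap <-] /=; rewrite rtau//; case: Ap => x Bx <-.
  by rewrite chart_invK//; exact: Bc.
- exact: measurable_funTS.
Qed.

(** On the piece, the volume is at most a constant times the pushforward of Lebesgue measure, the
    constant being a bound on the density over the compact set [B]. *)
Lemma integrable_chart_piece (F : M -> R) :
  mu.-integrable (row @^-1` B) (fun t => (F (chart_inv c (row t)))%:E) ->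
  vol.-integrable (chart_piece : set (borel M)) (fun p => (F p)%:E).
Proof.
move=> /integrableP[mF iF]; have mB := compact_measurable_row cB.
have mA := chart_piece_measurable.
have mFA : measurable_fun (chart_piece : set (borel M)) F.
  by apply: measurable_chart_piece; exact/measurable_EFinP.
(* A value for [sigma] off [B] that lies outside the piece makes the preimage of the piece exactly
   [B]. It exists because the piece is compact and [M] is not. *)
have [p0 nAp0] : exists p0, ~ chart_piece p0.
  apply: contrapT => h; apply: M_noncompact.
  rewrite (_ : [set: M] = chart_piece); first exact: chart_piece_compact.
  apply/seteqP; split=> // p _; apply: contrapT => np; apply: h; by exists p.
pose sigma (t : n.-tuple mR) : borel M :=
  if `[< B (row t) >] then chart_inv c (row t) else p0.
have mcod : measurable (row @^-1` chart_cod c).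
  by apply: open_measurable_row; exact: chart_cod_open.
have msigma : measurable_fun [set: n.-tuple mR] sigma.
  apply: measurable_fun_if => //.
  - apply: (measurable_fun_bool true); rewrite setTI (_ : _ @^-1` _ = row @^-1` B)//.
    by apply/seteqP; split=> t /= /asboolP.
  - rewrite setTI (_ : _ @^-1` _ = row @^-1` B); last first.
      by apply/seteqP; split=> t /= /asboolP.
    apply: (@measurable_funS _ _ _ _ (row @^-1` chart_cod c)) => //.
      by move=> t; exact: Bc.
    apply: (@measurability _ _ _ (borel M) _ _ (@open M)) => //.
    move=> _ [U oU <-].
    rewrite (_ : _ `&` _ = row @^-1` (chart_cod c `&` chart_inv c @^-1` U))//.
    apply: open_measurable_row; rewrite openE => x [cx Ux]; apply: filterI.
      by apply: open_nbhs_nbhs; split => //; exact: chart_cod_open.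
    by apply: (chart_inv_continuous cx); exact: open_nbhs_nbhs.
have sigmaA : sigma @^-1` chart_piece = row @^-1` B.
  apply/seteqP; split=> t /=; rewrite /sigma; case: asboolP => // Bt _.
  by exists (row t).
pose dens x : R := Num.sqrt (\det (gram g c (chart_inv c x))).
have cdens : continuous_on (chart_cod c) dens.
  move=> x cx.
  apply: (@continuous_comp _ _ _ (fun x => \det (gram g c (chart_inv c x))) Num.sqrt).
    by apply: continuous_at_det => i j; exact: gram_continuous.
  exact: sqrt_continuous.
have [D [D0 densD]] : exists D, 0 < D /\ forall x, B x -> `|dens x| <= D.
  by apply: near_compact_bounded => // x /Bc; exact: cdens.
have [m1 [m1E m1I]] := pushforward_measure mu msigma.
pose m2 : {measure set (borel M) -> \bar R} := mscale (NngNum (ltW D0)) m1.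
have mdens : measurable_fun (row @^-1` B) (fun t => (dens (row t))%:E).
  apply/measurable_EFinP; apply: (@measurable_funS _ _ _ _ (row @^-1` chart_cod c)) => //.
    by move=> t; exact: Bc.
  by apply: continuous_on_measurable_row => //; exact: chart_cod_open.
have volm2 (Y : set (borel M)) : measurable Y -> Y `<=` chart_piece -> (vol Y <= m2 Y)%E.
  move=> mY YA; rewrite (vol_g ac mY); last by move=> p /YA; exact: chart_piece_dom.
  have sigmaY : [set t | chart_cod c (row t) /\ Y (chart_inv c (row t))] =
      sigma @^-1` Y.
    apply/seteqP; split=> t /=; rewrite /sigma.
      move=> [ct Yt]; have Bt : B (row t) by apply/(chart_pieceE ct)/YA.
      by case: asboolP.
    by case: asboolP => [/Bc//|_ /YA].
  have mY' : measurable (sigma @^-1` Y).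
    by rewrite -[X in measurable X]setTI; exact: msigma.
  have YB : sigma @^-1` Y `<=` row @^-1` B by rewrite -sigmaA => t /YA.
  have -> : m2 Y = (D%:E * mu (sigma @^-1` Y))%E by congr (_ * _)%E; exact: m1E.
  rewrite sigmaY -integral_cst//.
  apply: ge0_le_integral => //.
  - exact: measurable_funS mdens.
  - move=> t /YB Bt; rewrite lee_fin (le_trans _ (densD _ Bt))//.
    exact: ler_norm.
apply/integrableP; split; first exact/measurable_EFinP.
apply: le_lt_trans (ge0_le_measure_integral _ volm2) _ => //.
have mNF : measurable_fun (chart_piece : set (borel M)) (fun p => `|(F p)%:E|%E).
  by apply: measurableT_comp => //; exact/measurable_EFinP.
rewrite /m2 ge0_integral_mscale// m1I// sigmaA.
apply: lte_mul_pinfty; [by rewrite lee_fin ltW|by []|].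
apply: le_lt_trans iF; rewrite le_eqVlt; apply/orP; left; apply/eqP.
apply: eq_integral => t /set_mem Bt; rewrite /sigma.
by case: asboolP.
Qed.

End piece.
End chart_pieces.

Lemma measurable_sqrtr {R : realType} :
  measurable_fun [set: measurableTypeR R] (@Num.sqrt R).
Proof. by apply: continuous_measurable_fun => x; exact: sqrt_continuous. Qed.

(** * Integrability on compact subsets of the manifold *)

Section compact_integrability.
Context {R : realType} {n : nat} {M : manifold R n} (g : riemannian_metric M).
Variable vol : {measure set (borel M) -> \bar R}.
Hypothesis vol_g : is_riemannian_volume g vol.
Hypothesis M_noncompact : ~ compact [set: M].
Local Notation mu := (lebesgue_tuple R n).
Local Notation row := (@row_of_tuple R n).
Implicit Types (K : set M) (G : vector_field M).

(** An induction principle over finite covers: closed balls in charts have compact images whose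
    interiors cover [K]. The property is obtained on a superset of [K], from which each application
    restricts. *)
Lemma compact_piece_cover (Q : set (borel M) -> Prop) : Q set0 ->
  (forall A B, measurable A -> measurable B -> Q A -> Q B -> Q (A `|` B)) ->
  (forall (c : chart R n M) B, atlas c -> compact B -> B `<=` chart_cod c ->
    Q (chart_piece c B)) ->
  forall K, compact K -> exists A : set (borel M), [/\ measurable A, K `<=` A & Q A].
Proof.
move=> Q0 QU Qp K cK.
have ballP (p : M) : exists B : set 'rV[R]_n, [/\ compact B, B `<=` chart_cod (chart_at p) &
    nbhs (chart_to (chart_at p) p) B].
  have /nbhs_closedballP[e eB] : nbhs (chart_to (chart_at p) p) (chart_cod (chart_at p)).
    apply: open_nbhs_nbhs; split; first exact: chart_cod_open.
    by apply: chart_to_cod; exact: chart_at_dom.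
  exists (closed_ball (chart_to (chart_at p) p) e%:num); split => //.
    apply: bounded_closed_compact; last exact: closed_ball_closed.
    rewrite closed_ballE//; exists (`|chart_to (chart_at p) p| + e%:num).
    split; first by rewrite num_real.
    move=> r rx v /= vx; apply: le_trans (ltW rx).
    rewrite -[v](subrK (chart_to (chart_at p) p)) addrC (le_trans (ler_normD _ _))//.
    by rewrite lerD2l distrC.
  by apply: (filterS (@subset_closed_ball _ _ _ _)); exact: nbhsx_ballx.
pose B (p : M) : set 'rV[R]_n := projT1 (cid (ballP p)).
have BP (p : M) : [/\ compact (B p), B p `<=` chart_cod (chart_at p) &
    nbhs (chart_to (chart_at p) p) (B p)] by rewrite /B; case: cid.
pose P (p : M) := chart_piece (chart_at p) (B p).
have nP (p : M) : nbhs p (P p).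
  have cp := chart_at_dom p; have [_ _ nB] := BP p.
  have nd : nbhs p (chart_dom (chart_at p)).
    by apply: open_nbhs_nbhs; split => //; exact: chart_dom_open.
  have nb : \forall q \near p, B p (chart_to (chart_at p) q).
    exact: (chart_to_continuous cp nB).
  apply: filterS2 nb nd => q Bq cq.
  by exists (chart_to (chart_at p) q) => //; exact: chart_toK.
have := cK; rewrite compact_cover => /(_ _ K (fun p => interior (P p))); case.
- by move=> p _; exact: open_interior.
- by move=> p Kp; exists p => //; exact: nP.
move=> D DK KD; pose s := finmap.enum_fset D.
have Ks : K `<=` \big[setU/set0]_(p <- s) P p.
  move=> q /KD[p /= pD /interior_subset Pq].
  have ps : p \in s by [].
  by rewrite (big_rem p ps) /=; left.
suff [mA QA] : measurable (\big[setU/set0]_(p <- s) P p : set (borel M)) /\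
    Q (\big[setU/set0]_(p <- s) P p) by exists (\big[setU/set0]_(p <- s) P p).
elim: s {Ks} => [|p s [mA QA]]; first by rewrite big_nil; split => //; exact: measurable0.
have [cB Bc _] := BP p.
have mP : measurable (P p : set (borel M)) by exact: chart_piece_measurable.
rewrite big_cons; split; first exact: (@measurableU _ (borel M) _ _ mP mA).
by apply: QU => //; apply: Qp => //; exact: chart_at_atlas.
Qed.

Lemma measurable_on_compact (F : M -> R) :
  (forall (c : chart R n M) B, atlas c -> compact B -> B `<=` chart_cod c ->
    measurable_fun (row @^-1` B) (fun t => F (chart_inv c (row t)))) ->
  forall K, compact K -> measurable_fun (K : set (borel M)) F.
Proof.
move=> mF K cK.
have [] := @compact_piece_cover (fun A => measurable_fun A F) _ _ _ K cK.
- exact: measurable_fun_set0.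
- by move=> A B mA mB FA FB; apply/(measurable_funU _ mA mB).
- by move=> c B ac cB Bc; apply: measurable_chart_piece => //; exact: mF.
- by move=> A [mA KA mFA]; exact: (measurable_funS mA KA).
Qed.

Lemma integrable_on_compact (F : M -> R) :
  (forall (c : chart R n M) B, atlas c -> compact B -> B `<=` chart_cod c ->
    mu.-integrable (row @^-1` B) (fun t => (F (chart_inv c (row t)))%:E)) ->
  forall K, compact K -> vol.-integrable (K : set (borel M)) (fun p => (F p)%:E).
Proof.
move=> iF K cK.
have [] := @compact_piece_cover (fun A => vol.-integrable A (fun p => (F p)%:E)) _ _ _ K cK.
- exact: integrable_set0.
- by move=> A B mA mB FA FB; exact: integrable_setU.
- by move=> c B ac cB Bc; apply: (integrable_chart_piece vol_g) => //; exact: iF.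
- by move=> A [mA KA iFA]; apply: (integrableS mA _ KA iFA); exact: compact_measurable_borel.
Qed.

(** Cramer's formula for the inverse Gram matrix. *)
Definition cometric (c : chart R n M) (i j : 'I_n) (x : 'rV[R]_n) : R :=
  (\det (gram g c (chart_inv c x)))^-1 * (\adj (gram g c (chart_inv c x))) i j.

Lemma cometric_continuous c i j : atlas c -> continuous_on (chart_cod c) (cometric c i j).
Proof.
move=> ac x cx.
have cg i' j' := @gram_continuous _ _ _ g c x i' j' ac cx.
have cd := continuous_at_det cg.
have d0 : \det (gram g c (chart_inv c x)) != 0.
  by rewrite -unitfE -unitmxE; apply: gram_unit => //; exact: chart_inv_dom.
have ci : {for x, continuous (fun y => (\det (gram g c (chart_inv c y)))^-1)}.
  exact: (@continuousV _ _ (fun y => \det (gram g c (chart_inv c y))) _ d0 cd).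
exact: (@continuousM _ _ _ (fun y => (\adj (gram g c (chart_inv c y))) i j) _ ci
  (@continuous_at_adj _ _ _ _ (fun y => gram g c (chart_inv c y)) cg i j)).
Qed.

(** The components whose local integrability is part of [is_weak_grad]. *)
Definition covec G (c : chart R n M) (i : 'I_n) (x : 'rV[R]_n) : R :=
  inner g (G (chart_inv c x)) (coord_vec c i (chart_inv c x)).

Lemma inner_covec G G' c x : atlas c -> chart_cod c x ->
  inner g (G (chart_inv c x)) (G' (chart_inv c x)) =
  \sum_i \sum_j covec G c i x * cometric c i j x * covec G' c j x.
Proof. by move=> ac cx; rewrite (innerE g _ _ ac (chart_inv_dom cx)). Qed.

Lemma covec_integrable f G c B i : is_weak_grad g f G -> atlas c ->
  compact B -> B `<=` chart_cod c ->
  mu.-integrable (row @^-1` B) (fun t => (covec G c i (row t))%:E).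
Proof. by move=> wG ac cB Bc; have [+ _] := wG c ac i; exact. Qed.

Lemma measurable_inner_chart f f' G G' c B : is_weak_grad g f G ->
  is_weak_grad g f' G' -> atlas c -> compact B -> B `<=` chart_cod c ->
  measurable_fun (row @^-1` B)
    (fun t => inner g (G (chart_inv c (row t))) (G' (chart_inv c (row t)))).
Proof.
move=> wG wG' ac cB Bc.
have mB := compact_measurable_row cB; have oc : open (chart_cod c) by exact: chart_cod_open.
apply: (@eq_measurable_fun _ _ _ _ _ (fun t => \sum_i \sum_j
    covec G c i (row t) * cometric c i j (row t) * covec G' c j (row t))).
  by move=> t /set_mem /Bc ct; exact: (esym (inner_covec G G' ac ct)).
apply: measurable_sum => i; apply: measurable_sum => j.
have /integrableP[/measurable_EFinP mG _] := covec_integrable i wG ac cB Bc.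
have /integrableP[/measurable_EFinP mG' _] := covec_integrable j wG' ac cB Bc.
have mc : measurable_fun (row @^-1` B) (fun t => cometric c i j (row t)).
  apply: (@measurable_funS _ _ _ _ (row @^-1` chart_cod c)).
  - exact: open_measurable_row.
  - by move=> t; exact: Bc.
  - by apply: continuous_on_measurable_row => //; exact: cometric_continuous.
exact: (measurable_funM (measurable_funM mG mc) mG').
Qed.

Lemma measurable_inner f f' G G' K : is_weak_grad g f G -> is_weak_grad g f' G' ->
  compact K -> measurable_fun (K : set (borel M)) (fun p => inner g (G p) (G' p)).
Proof.
move=> wG wG'; apply: measurable_on_compact => c B ac cB Bc.
exact: (measurable_inner_chart wG wG').
Qed.

Lemma integrable_inner_smooth f G phi K : is_weak_grad g f G -> smooth phi ->
  compact K ->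
  vol.-integrable (K : set (borel M)) (fun p => (inner g (G p) (grad g phi p))%:E).
Proof.
move=> wG sphi; apply: integrable_on_compact => c B ac cB Bc.
have mB := compact_measurable_row cB; have oc : open (chart_cod c) by exact: chart_cod_open.
pose dphi j x : R := 'D_(std_vec j) (phi \o chart_inv c : _ -> R^o) x.
have cdphi j : continuous_on (chart_cod c) (dphi j).
  by move=> x cx; have [_ /(_ (std_vec j)) /(_ x cx)] := sphi c ac 1%N.
apply: (eq_integrable mB (fun t => \sum_i \sum_j
    (covec G c i (row t) * (cometric c i j (row t) * dphi j (row t)))%:E)%E).
  move=> t /set_mem /Bc ct; rewrite (inner_covec G (grad g phi) ac ct).
  under eq_bigr do rewrite sumEFin; rewrite sumEFin; congr (_%:E).
  apply: eq_bigr => i _; apply: eq_bigr => j _.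
  by rewrite mulrA /dphi -(grad_coord g j sphi ac ct).
apply: integrable_sum => // i _; apply: integrable_sum => // j _.
apply: (integrable_continuousM (F := covec G c i)
  (G := fun x => cometric c i j x * dphi j x) oc cB Bc).
- by move=> x cx; exact: (@continuousM _ _ (cometric c i j : _ -> R) (dphi j : _ -> R) x
    (cometric_continuous ac cx) (cdphi j x cx)).
- exact: (covec_integrable i wG ac cB Bc).
Qed.

(** A bound [D] on the inverse Gram entries over [B] makes the norm at most the square root of [D]
    times the sum of the absolute components, each of which is integrable. *)
Lemma integrable_rnorm f G K : is_weak_grad g f G -> compact K ->
  vol.-integrable (K : set (borel M)) (fun p => (rnorm g (G p))%:E).
Proof.
move=> wG; apply: integrable_on_compact => c B ac cB Bc.
have mB := compact_measurable_row cB; have oc : open (chart_cod c) by exact: chart_cod_open.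
pose S x := \sum_i \sum_j `|cometric c i j x|.
have cS : continuous_on (chart_cod c) S.
  move=> x cx; apply: continuous_at_sum => i; apply: continuous_at_sum => j.
  exact: (@cvg_norm _ R^o _ _ _ (cometric c i j) _ (cometric_continuous ac cx)).
have [D [D0 SD]] : exists D, 0 < D /\ forall x, B x -> `|S x| <= D.
  by apply: near_compact_bounded => // x /Bc; exact: cS.
have cometricD i j x : B x -> `|cometric c i j x| <= D.
  move=> Bx; apply: le_trans (le_trans (ler_norm _) (SD x Bx)).
  rewrite /S (bigD1 i)//= (bigD1 j)//= -addrA lerDl addr_ge0//.
    by apply: sumr_ge0 => *.
  by apply: sumr_ge0 => *; apply: sumr_ge0.
pose T x := \sum_i `|covec G c i x|.
have T0 x : 0 <= T x by exact: sumr_ge0.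
have iT : mu.-integrable (row @^-1` B) (fun t => (T (row t))%:E).
  apply: (eq_integrable mB (fun t => \sum_i (`|covec G c i (row t)|)%:E)%E).
    by move=> t _; rewrite sumEFin.
  apply: integrable_sum => // i _; apply: integrable_normr_EFin.
  exact: (covec_integrable i wG ac cB Bc).
apply: (le_integrable mB _ (g := fun t => (Num.sqrt D * T (row t))%:E)).
- apply/measurable_EFinP.
  apply: (@measurableT_comp _ _ _ _ _ _ (@Num.sqrt R)); first exact: measurable_sqrtr.
  exact: (measurable_inner_chart wG wG).
- move=> t Bt; rewrite !abse_EFin lee_fin !ger0_norm ?mulr_ge0 ?sqrtr_ge0//.
  rewrite -[T _]ger0_norm// -sqrtr_sqr -sqrtrM ?(ltW D0)// /rnorm ler_wsqrtr//.
  rewrite (inner_covec G G ac (Bc _ Bt)).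
  rewrite expr2 {1}/T mulr_suml mulr_sumr ler_sum// => i _.
  rewrite /T mulr_sumr mulr_sumr ler_sum// => j _.
  move: (covec G c i _) (covec G c j _) (cometric c i j _) (cometricD i j _ Bt).
  move=> v w m mD; rewrite (le_trans (ler_norm _))// !normrM -mulrA mulrCA.
  by rewrite ler_wpM2r// mulr_ge0.
- exact: integrableZl_EFin.
Qed.

End compact_integrability.

(** * The Hardy inequality *)

Section integrals.
Context d (T : measurableType d) (R : realType) (m : {measure set T -> \bar R}).
Variable D : set T.
Hypothesis mD : measurable D.
Implicit Types f X Y : T -> R.
Local Notation intble f := (m.-integrable D (fun x => (f x)%:E)).

Lemma integral_setD_negligible (N : set T) (f : T -> \bar R) : measurable N ->
  measurable_fun D f -> m N = 0 ->
  (\int[m]_(x in D) f x = \int[m]_(x in D `\` N) f x)%E.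
Proof.
move=> mN mf N0; rewrite integralE [RHS]integralE; congr (_ - _)%E.
  by apply: ge0_negligible_integral => //; exact: measurable_funepos.
by apply: ge0_negligible_integral => //; exact: measurable_funeneg.
Qed.

Lemma Rintegral_EFin f : intble f ->
  (\int[m]_(x in D) (f x)%:E = (\int[m]_(x in D) f x)%R%:E)%E.
Proof. by move=> fi; rewrite /Rintegral fineK//; exact: integrable_fin_num. Qed.

(* Integrability of Y comes for free: if the negative part of X - Y had infinite
   integral, the integral of X - Y would be -oo. *)
Lemma integrable_of_integralB_ge0 X Y : intble X -> measurable_fun D Y ->
  (forall x, D x -> 0 <= Y x) -> (0 <= \int[m]_(x in D) (X x - Y x)%:E)%E ->
  intble Y.
Proof.
move=> iX mY Y0 XY0; pose F x := (X x - Y x)%:E.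
have mX : measurable_fun D X by have /integrableP[/measurable_EFinP] := iX.
have mF : measurable_fun D F by apply/measurable_EFinP; exact: measurable_funB.
have mFp : measurable_fun D (F^\+)%E by exact: measurable_funepos.
have mFn : measurable_fun D (F^\-)%E by exact: measurable_funeneg.
(* As [Y] is nonnegative, the positive part of X - Y is at most |X|. *)
have iFp : (\int[m]_(x in D) F^\+ x < +oo)%E.
  have /integrableP[_] := iX; apply: le_lt_trans.
  apply: ge0_le_integral => //.
    by apply: measurableT_comp => //; exact/measurable_EFinP.
  move=> x Dx; rewrite /F funeposE -EFin_max abse_EFin lee_fin ge_max normr_ge0 andbT.
  by rewrite lerBlDr (le_trans (ler_norm _))// lerDl Y0.
have iFn : (\int[m]_(x in D) F^\- x < +oo)%E.
  rewrite ltey; apply: contraTN XY0 => /eqP Fn; rewrite integralE Fn -ltNge.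
  move: iFp; rewrite -ge0_fin_numE; last exact: integral_ge0.
  by move=> /fineK <-; rewrite addeNy ltNyr.
have iF : m.-integrable D F.
  apply/integrableP; split => //; rewrite -[fun x => _]/(abse \o F) fune_abse.
  by rewrite ge0_integralD//; exact: lte_add_pinfty.
have : m.-integrable D (fun x => (X x - (X x - Y x))%:E) by exact: integrableB_EFin.
by apply: eq_integrable => // x _; rewrite opprB addrC subrK.
Qed.

(** Add up the integrated square, [k] times the Laplacian inequality and half the divergence
    inequality. The first combination trades [Z] for - T2 - 2k T1, so that [T1] ends with k^2 -
    2k^2; the second trades [X] for [T3], which ends with 1/4 - 1/2. *)
Lemma hardy_integrals (k C : R) (T0 T1 T2 T3 Z X : T -> R) : 0 < k ->
  intble T0 -> intble T1 -> intble T2 -> intble Z -> intble X ->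
  measurable_fun D T3 -> (forall x, D x -> 0 <= T3 x) ->
  (forall x, D x ->
    0 <= T0 x + k ^+ 2 * T1 x + 4^-1 * T3 x + k * Z x - 2^-1 * X x) ->
  (\int[m]_(x in D) (C * T1 x)%:E <=
   - (\int[m]_(x in D) (T2 x + (2 * k - C) * T1 x + Z x)%:E))%E ->
  (0 <= \int[m]_(x in D) (X x - T3 x)%:E)%E ->
  ((k ^+ 2)%:E * \int[m]_(x in D) (T1 x)%:E + k%:E * \int[m]_(x in D) (T2 x)%:E +
   (4^-1)%:E * \int[m]_(x in D) (T3 x)%:E <= \int[m]_(x in D) (T0 x)%:E)%E.
Proof.
move=> k0 i0 i1 i2 iZ iX m3 T30 sq lap div.
have i3 := integrable_of_integralB_ge0 iX m3 T30 div.
have Z_ (c : R) f : intble f -> intble (fun x => c * f x) by exact: integrableZl_EFin.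
have D_ f h : intble f -> intble h -> intble (fun x => f x + h x) by exact: integrableD_EFin.
have B_ f h : intble f -> intble h -> intble (fun x => f x - h x) by exact: integrableB_EFin.
have iL1 := D_ _ _ i2 (Z_ (2 * k - C) _ i1); have iL := D_ _ _ iL1 iZ.
have s1 := D_ _ _ i0 (Z_ (k ^+ 2) _ i1); have s2 := D_ _ _ s1 (Z_ 4^-1 _ i3).
have s3 := D_ _ _ s2 (Z_ k _ iZ).
have sq' := Rintegral_ge0 m sq.
rewrite (RintegralB mD s3 (Z_ _ _ iX)) (RintegralD mD s2 (Z_ _ _ iZ)) in sq'.
rewrite (RintegralD mD s1 (Z_ _ _ i3)) (RintegralD mD i0 (Z_ _ _ i1)) in sq'.
rewrite (RintegralZl _ mD i1) (RintegralZl _ mD i3) (RintegralZl _ mD iZ) in sq'.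
rewrite (RintegralZl _ mD iX) in sq'.
move: lap div.
rewrite (Rintegral_EFin (Z_ C _ i1)) (Rintegral_EFin iL) (Rintegral_EFin (B_ _ _ iX i3)).
rewrite (RintegralZl _ mD i1) (RintegralD mD iL1 iZ) (RintegralD mD i2 (Z_ _ _ i1)).
rewrite (RintegralZl _ mD i1) (RintegralB mD iX i3).
rewrite (Rintegral_EFin i0) (Rintegral_EFin i1) (Rintegral_EFin i2) (Rintegral_EFin i3).
rewrite -EFinN -!EFinM -!EFinD !lee_fin.
move: sq'; set t0 := Rintegral m D T0; set t1 := Rintegral m D T1.
set t2 := Rintegral m D T2; set t3 := Rintegral m D T3.
set z := Rintegral m D Z; set x := Rintegral m D X.
move=> sq' lap div.
have : k * (C * t1) <= k * (- (t2 + (2 * k - C) * t1 + z)) by rewrite ler_pM2l.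
nra.
Qed.

End integrals.

Section inner_product.
Context {R : realType} {n : nat} {M : manifold R n} (g : riemannian_metric M).

Lemma inner_le_rnorm p (v w : tangent p) : `|inner g v w| <= rnorm g v * rnorm g w.
Proof.
have vv := inner_ge0 g v; have ww := inner_ge0 g w.
rewrite /rnorm -sqrtrM// -sqrtr_sqr ler_wsqrtr//.
move: vv ww; rewrite le_eqVlt => /predU1P[vv0|vv] ww.
  have [v0|v0] := eqVneq (v : 'rV[R]_n) 0; last first.
    by have := metric_pos g p v0; rewrite -/(inner g v v) -vv0 ltxx.
  by rewrite /inner v0 !mul0mx mxE expr0n mul0r.
(* With a = |v|^2, b the pairing of v and w, and c = |w|^2, the squared norm of a w - b v is a (a c
   - b^2). *)
have := inner_ge0 g (inner g v v *: w + (- inner g v w) *: v : tangent p).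
rewrite !(innerDl, innerDr, innerZl, innerZr) (innerC g w v).
move: (inner g v v) (inner g v w) (inner g w w) vv => a b c a0 h.
have {}h : 0 <= a * (a * c - b ^+ 2) by nra.
by move: h; rewrite pmulr_rge0// subr_ge0.
Qed.

Lemma manifold_continuous (f : M -> R) :
  (forall c : chart R n M, atlas c -> continuous_on (chart_cod c) (f \o chart_inv c)) ->
  continuous f.
Proof.
move=> cf p; have cp := chart_at_dom p; set c := chart_at p in cp.
have ac : atlas c by exact: chart_at_atlas.
apply: (@near_eq_continuous_at _ _ ((f \o chart_inv c) \o chart_to c)).
  have nd : nbhs p (chart_dom c) by apply: open_nbhs_nbhs; split => //; exact: chart_dom_open.
  by apply: filterS nd => q cq; rewrite /= chart_toK.
apply: continuous_comp; first exact: chart_to_continuous.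
by apply: cf => //; exact: chart_to_cod.
Qed.

Lemma locally_rlipschitz_continuous (f : M -> R) : locally_rlipschitz g f -> continuous f.
Proof.
move=> lf; apply: manifold_continuous => c ac.
by apply: locally_lipschitz_continuous; exact: locally_rlipschitz_chart ac lf.
Qed.

Lemma smooth_manifold_continuous (f : M -> R) : smooth f -> continuous f.
Proof.
move=> sf; apply: manifold_continuous => c ac.
by apply: locally_lipschitz_continuous; exact: smooth_locally_lipschitz.
Qed.

Lemma grad_support (phi : M -> R) p : smooth phi -> ~ support_of phi p ->
  grad g phi p = 0.
Proof.
move=> sphi np; rewrite /grad; set c := chart_at p.
rewrite (_ : \row_i _ = 0) ?mul0mx//; apply/rowP => i; rewrite !mxE.
have cp : chart_dom c p by exact: chart_at_dom.
have nS : nbhs (chart_inv c (chart_to c p)) (~` support_of phi).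
  rewrite chart_toK//.
  by apply: open_nbhs_nbhs; split => //; rewrite openC; exact: closed_closure.
rewrite -(derive_cst (0 : R^o) (chart_to c p) (std_vec i)); apply: near_eq_derive.
have nx : \forall y \near chart_to c p, ~ support_of phi (chart_inv c y).
  exact: (chart_inv_continuous (chart_to_cod cp) nS).
by apply: filterS nx => y; exact: support_of_eq0.
Qed.

End inner_product.

(** * Real powers at positive arguments *)

Section powers.
Context {R : realType}.
Implicit Types x b : R.

Lemma powR_continuous b x : 0 < x -> {for x, continuous (fun s : R => s `^ b)}.
Proof.
move=> x0; have [dx _] := is_derive1_powR b x0.
by apply: differentiable_continuous; exact/derivable1_diffP.
Qed.

Lemma C1_at_powR b x : 0 < x ->
  C1_at (fun s : R => s `^ b) (fun s => b * s `^ (b - 1)) x.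
Proof.
move=> x0; split.
  exact: (@continuousM _ _ (fun=> b) (fun s : R => s `^ (b - 1)) x
    (@cst_continuous _ _ b x) (powR_continuous x0)).
have n0 : \forall s \near x, 0 < s by exact: lt_nbhsr.
apply: (@filterS _ (nbhs x) _ _ _ _ n0) => s s0; exact: is_derive1_powR.
Qed.

Lemma C1_at_id x : C1_at (@idfun R) (fun=> 1) x.
Proof.
split; first exact: cst_continuous.
by apply: (@filterE _ (nbhs x)) => s; exact: is_derive_id.
Qed.

Lemma powRV x : 0 < x -> x `^ (- 1) = x^-1.
Proof. by move=> x0; rewrite powRN powRr1// ltW. Qed.

Lemma powRD_gt0 x b b' : 0 < x -> x `^ (b + b') = x `^ b * x `^ b'.
Proof. by move=> x0; rewrite powRD// (gt_eqF x0) implybT. Qed.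

Lemma powRV2 x : 0 < x -> x `^ (- 1 - 1) = x^-1 * x^-1.
Proof. by move=> x0; rewrite powRD_gt0// powRV. Qed.

Lemma powR_sub2_mul x b : 0 < x -> x `^ (b - 1) = x `^ (b - 2) * x.
Proof.
move=> x0; rewrite -{3}(powRr1 (ltW x0)) -powRD_gt0//.
by congr (_ `^ _); ring.
Qed.

Lemma powR_sub2_sqr x b : 0 < x -> x `^ b = x `^ (b - 2) * (x * x).
Proof.
move=> x0; rewrite mulrA -powR_sub2_mul// -{3}(powRr1 (ltW x0)).
by rewrite -powRD_gt0// subrK.
Qed.

End powers.

(** * Integrals with weights continuous off the zero set *)

Section compact_weights.
Context {R : realType} {n : nat} {M : manifold R n}.
Variable vol : {measure set (borel M) -> \bar R}.
Variables (O K : set M).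
Hypotheses (oO : open O) (cK : compact K) (KO : K `<=` O).
Implicit Types W F : M -> R.
Local Notation weight W := (forall p, O p -> {for p, continuous W}).

Lemma weightM W W' : weight W -> weight W' -> weight (fun p => W p * W' p).
Proof. by move=> cW cW' p Op; exact: (@continuousM _ _ W W' p (cW p Op) (cW' p Op)). Qed.

Lemma weight_measurable W : weight W -> measurable_fun (K : set (borel M)) W.
Proof.
move=> cW; apply: (@measurable_funS _ _ (borel M) _ O) => //.
  exact: open_measurable_borel.
apply: measurable_fun_open_preimage => U oU; apply: open_measurable_borel.
rewrite openE => p [Op Up]; apply: filterI; first exact: open_nbhs_nbhs.
by apply: (cW _ Op); exact: open_nbhs_nbhs.
Qed.

Lemma weight_integrable W F : weight W ->
  vol.-integrable (K : set (borel M)) (fun p => (F p)%:E) ->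
  vol.-integrable (K : set (borel M)) (fun p => (W p * F p)%:E).
Proof.
move=> cW iF; have mK := compact_measurable_borel cK.
have mW := weight_measurable cW.
have [D [D0 WD]] : exists D, 0 < D /\ forall p, K p -> `|W p| <= D.
  by apply: near_compact_bounded => // p /KO; exact: cW.
apply: (le_integrable mK _ (g := fun p => (D * F p)%:E)).
- apply/measurable_EFinP; apply: measurable_funM => //.
  by have /integrableP[/measurable_EFinP] := iF.
- move=> p Kp; rewrite !abse_EFin lee_fin !normrM.
  by rewrite ler_wpM2r// (le_trans (WD _ Kp))// ler_norm.
- exact: integrableZl_EFin.
Qed.

(** Moves a global integral to the support minus the exceptional null set, where the almost
    everywhere hypothesis holds at each point, and separates the continuous weight from the gradient
    factor. *)
Lemma integral_support_weight N (H W F : M -> R) : measurable (N : set (borel M)) ->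
  vol N = 0 -> weight W -> measurable_fun (K : set (borel M)) F ->
  (forall p, K p -> H p = W p * F p) -> (forall p, ~ K p -> H p = 0) ->
  (\int[vol]_p (H p)%:E = \int[vol]_(p in K `\` N) (W p * F p)%:E)%E.
Proof.
move=> mN N0 cW mF HK H0; have mK := compact_measurable_borel cK.
rewrite -integral_setD_negligible//; last first.
  by apply/measurable_EFinP; apply: measurable_funM => //; exact: weight_measurable.
rewrite [RHS]integral_mkcond; apply: eq_integral => p _; rewrite patchE.
by case: ifPn => [/set_mem /HK ->|/negP nK]//; rewrite H0// => /mem_set.
Qed.

End compact_weights.

Section pointwise.
Context {R : realType} {n : nat} {M : manifold R n} (g : riemannian_metric M).

(** The expansion of the squared norm of r v + k f w - (r f / (2 d)) z with weight a q m. It is used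
    with v, w, z the gradients of phi, rho, delta and with r, f, d their values of rho, phi, delta;
    for q = rho^(alpha-2) the factor q r^2 is rho^alpha, and no division by rho occurs. *)
Lemma weighted_square_ge0 p (v w z : tangent p) (a q m r d f k : R) :
  0 <= a -> 0 <= q -> 0 <= m ->
  0 <= a * q * (r * r) * m * inner g v v
    + k ^+ 2 * (a * q * (f * f) * m * inner g w w)
    + 4^-1 * (a * q * (r * r) * (f * f) * (d^-1 * d^-1) * m * inner g z z)
    + k * (2 * a * q * r * f * m * inner g w v)
    - 2^-1 * (2 * k * a * q * r * (f * f) * d^-1 * m * inner g z w
              + 2 * a * q * (r * r) * f * d^-1 * m * inner g z v).
Proof.
move=> a0 q0 m0.
have := inner_ge0 g (r *: v + (k * f) *: w + (- (2^-1 * r * f * d^-1)) *: z : tangent p).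
rewrite !(innerDl, innerDr, innerZl, innerZr) (innerC g v w) (innerC g v z) (innerC g w z).
have aqm : 0 <= a * q * m by rewrite !mulr_ge0.
move/(mulr_ge0 aqm); congr (0 <= _).
by move: (inner g v v) (inner g w w) (inner g z z) (inner g w v) (inner g z w)
  (inner g z v) d^-1 => *; field.
Qed.

End pointwise.

Theorem theorem5p4 (R : realType) (n : nat) (M : manifold R n)
  (g : riemannian_metric M)
  (vol : {measure set (borel M) -> \bar R})
  (vol_g : is_riemannian_volume g vol)
  (M_complete : riemannian_complete g)
  (M_noncompact : ~ compact [set: M])
  (u : M -> R) (u_smooth : smooth u)
  (lambda mu C alpha : R)
  (delta rho a : M -> R)
  (Gdelta Grho Ga : vector_field M) :
  let V := fun p : M => expR (u p) in
  let tau := (n.+1)%:R * lambda + mu in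
  let gradD := affine_grad V lambda mu in
  (forall p, 0 < delta p) ->
  (forall p, 0 <= rho p) ->
  (forall p, 0 <= a p) ->
  locally_rlipschitz g delta -> is_weak_grad g delta Gdelta ->
  locally_rlipschitz g rho -> is_weak_grad g rho Grho ->
  locally_rlipschitz g a -> is_weak_grad g a Ga ->
  1 < C ->
  0 < C + alpha - 1 ->
  {ae vol, forall p, rnorm g (gradD Grho p) = 1} ->
  affine_laplacian_ge g vol V lambda mu tau C rho Grho ->
  {ae vol, forall p, 0 <= inner g (gradD Ga p) (gradD Grho p)} ->
  affine_div_le0 g vol V lambda mu tau [set p | rho p != 0]
    (fun p => a p * rho p `^ (1 - C)) Gdelta ->
  forall phi : M -> R,
  smooth phi -> compact (support_of phi) ->
  support_of phi `<=` [set p | rho p != 0] ->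
  ((((C + alpha - 1) / 2) ^+ 2)%:E *
    \int[vol]_p (a p * rho p `^ (alpha - 2) * phi p ^+ 2 *
                 V p `^ (tau + lambda - mu))%:E +
  ((C + alpha - 1) / 2)%:E *
    \int[vol]_p (rho p `^ (alpha - 1) * phi p ^+ 2 *
                 inner g (gradD Ga p) (gradD Grho p) *
                 V p `^ (tau + lambda - mu))%:E +
  (4^-1)%:E *
    \int[vol]_p (a p * rho p `^ alpha *
                 (rnorm g (gradD Gdelta p) ^+ 2 / delta p ^+ 2) * phi p ^+ 2 *
                 V p `^ (tau + lambda - mu))%:E
  <= \int[vol]_p (a p * rho p `^ alpha * rnorm g (gradD (grad g phi) p) ^+ 2 *
                  V p `^ (tau + lambda - mu))%:E)%E.
Proof.
move=> V tau gradD d0 rho_ge0 a0 ld wd lr wr la wa C1 Ca unit lap _ div phi sphi cphi phiO.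
pose K : set M := support_of phi; pose O : set M := [set p | rho p != 0].
pose k := (C + alpha - 1) / 2; have k0 : 0 < k by rewrite divr_gt0.
pose s p := V p `^ (mu - lambda).
(* The weight left in front of a pairing of undeformed gradients. It arises in the goal from two
   factors [s] and [m1], and in both hypotheses from one factor [s] and V^tau. *)
pose m p := V p `^ (tau + mu - lambda).
pose m1 p := V p `^ (tau + lambda - mu).
pose q p := rho p `^ (alpha - 2).
pose gphi := grad g phi.
have V0 p : 0 < V p by exact: expR_gt0.
have rho_gt0 p : O p -> 0 < rho p by move=> Op; rewrite lt_neqAle eq_sym Op rho_ge0.
have ssm p : s p * (s p * m1 p) = m p.
  by rewrite /s /m /m1 -!powRD_gt0//; congr (_ `^ _); ring.
have smt p : s p * V p `^ tau = m p.
  by rewrite /s /m -!powRD_gt0//; congr (_ `^ _); ring.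
have crho : continuous rho by exact: locally_rlipschitz_continuous lr.
have ca : continuous a by exact: locally_rlipschitz_continuous la.
have cd : continuous delta by exact: locally_rlipschitz_continuous ld.
have cf : continuous phi by exact: smooth_manifold_continuous.
have cV b : continuous (fun p => V p `^ b).
  move=> p; apply: (@continuous_comp _ _ _ V (fun x : R => x `^ b)).
    apply: (@continuous_comp _ _ _ u expR); last exact: continuous_expR.
    exact: smooth_manifold_continuous.
  exact: powR_continuous.
have oO : open O.
  apply: (@open_comp _ _ rho [set x | x != 0]); first by move=> x _; exact: crho.
  exact: open_neq.
have cR b p : O p -> {for p, continuous (fun p => rho p `^ b)}.
  move=> Op; apply: (@continuous_comp _ _ _ rho (fun x : R => x `^ b)); first exact: crho.
  by apply: powR_continuous; exact: rho_gt0.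
have cdV p : O p -> {for p, continuous (fun p => (delta p)^-1)}.
  by move=> _; apply: (@continuousV _ _ delta) (cd p); rewrite gt_eqF.
have cc (c : R) p : O p -> {for p, continuous (fun=> c)}.
  by move=> _; exact: cst_continuous.
have wgphi : is_weak_grad g phi gphi by exact: smooth_weak_grad.
have mK := compact_measurable_borel cphi.
have [N [mN N0 bad]] := unit.
have mD : measurable (K `\` N : set (borel M)) by exact: measurableD.
have unitN p : ~ N p -> s p * (s p * inner g (Grho p) (Grho p)) = 1.
  move=> nN; have : rnorm g (gradD Grho p) = 1.
    by apply: contrapT => h; apply: nN; exact: bad.
  move=> /(congr1 (fun x => x ^+ 2)).
  rewrite /rnorm sqr_sqrtr ?inner_ge0// expr1n => <-.
  by rewrite /gradD /affine_grad innerZl innerZr.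
(* This is where the unit length of nabla^D rho enters the square: it identifies the weight of the
   first right-hand term with that of |nabla rho|^2. *)
have m1E p : ~ N p -> m1 p = m p * inner g (Grho p) (Grho p).
  by move=> /unitN h; rewrite -ssm -[LHS]mulr1 -h; ring.
have phi0 p : ~ K p -> phi p = 0 by exact: support_of_eq0.
have gphi0 p : ~ K p -> gphi p = 0 by exact: grad_support.
(* Every integrand is a weight, continuous where rho is nonzero, times a pairing of gradients or the
   constant 1. Squares are spelled as products so that the continuity proofs compose. *)
pose w0 p := a p * q p * (rho p * rho p) * m p.
pose w1 p := a p * q p * (phi p * phi p) * m1 p.
pose w2 p := q p * rho p * (phi p * phi p) * m p.
pose w3 p := a p * q p * (rho p * rho p) * (phi p * phi p) *
  ((delta p)^-1 * (delta p)^-1) * m p.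
pose wz p := 2 * a p * q p * rho p * phi p * m p.
pose wx p := 2 * k * a p * q p * rho p * (phi p * phi p) * (delta p)^-1 * m p.
pose wy p := 2 * a p * q p * (rho p * rho p) * phi p * (delta p)^-1 * m p.
have Oa p : O p -> {for p, continuous a} by move=> _; exact: ca.
have Or p : O p -> {for p, continuous rho} by move=> _; exact: crho.
have Of p : O p -> {for p, continuous phi} by move=> _; exact: cf.
have Om p : O p -> {for p, continuous m} by move=> _; exact: cV.
have Om1 p : O p -> {for p, continuous m1} by move=> _; exact: cV.
have Oq p : O p -> {for p, continuous q} by exact: cR.
have c0 : forall p, O p -> {for p, continuous w0} := weightM (weightM (weightM Oa Oq)
  (weightM Or Or)) Om.
have c1 : forall p, O p -> {for p, continuous w1} := weightM (weightM (weightM Oa Oq)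
  (weightM Of Of)) Om1.
have c2 : forall p, O p -> {for p, continuous w2} := weightM (weightM (weightM Oq Or)
  (weightM Of Of)) Om.
have c3 : forall p, O p -> {for p, continuous w3} := weightM (weightM (weightM (weightM
  (weightM Oa Oq) (weightM Or Or)) (weightM Of Of)) (weightM cdV cdV)) Om.
have cz : forall p, O p -> {for p, continuous wz} := weightM (weightM (weightM (weightM
  (weightM (cc 2) Oa) Oq) Or) Of) Om.
have cx : forall p, O p -> {for p, continuous wx} := weightM (weightM (weightM (weightM
  (weightM (weightM (weightM (cc 2) (cc k)) Oa) Oq) Or) (weightM Of Of)) cdV) Om.
have cy : forall p, O p -> {for p, continuous wy} := weightM (weightM (weightM (weightM
  (weightM (weightM (cc 2) Oa) Oq) (weightM Or Or)) Of) cdV) Om.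
pose T0 p := w0 p * inner g (gphi p) (gphi p).
pose T1 p := w1 p * 1.
pose T2 p := w2 p * inner g (Ga p) (Grho p).
pose T3 p := w3 p * inner g (Gdelta p) (Gdelta p).
pose Z p := wz p * inner g (Grho p) (gphi p).
pose X p := wx p * inner g (Gdelta p) (Grho p) + wy p * inner g (Gdelta p) (gphi p).
have sq p : (K `\` N) p -> 0 <= T0 p + k ^+ 2 * T1 p + 4^-1 * T3 p + k * Z p - 2^-1 * X p.
  move=> [Kp Np].
  have := @weighted_square_ge0 _ _ _ g p (gphi p) (Grho p) (Gdelta p) (a p) (q p) (m p)
    (rho p) (delta p) (phi p) k (a0 p) (powR_ge0 _ _) (powR_ge0 _ _).
  rewrite /T0 /T1 /T3 /Z /X /w0 /w1 /w3 /wz /wx /wy (m1E _ Np).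
  congr (0 <= _); move: (inner g (gphi p) (gphi p)) (inner g (Grho p) (Grho p))
    (inner g (Gdelta p) (Gdelta p)) (inner g (Grho p) (gphi p))
    (inner g (Gdelta p) (Grho p)) (inner g (Gdelta p) (gphi p)) (delta p)^-1 => *; ring.
have i1 : vol.-integrable (K : set (borel M)) (fun p => ((fun=> 1) p)%:E).
  apply: (integrable_on_compact vol_g M_noncompact _ cphi) => c A ac cA Ac.
  by apply: integrable_cst; [exact: compact_measurable_row|exact: compact_lebesgue_tuple_fin].
have toD (F : M -> R) : vol.-integrable (K : set (borel M)) (fun p => (F p)%:E) ->
    vol.-integrable (K `\` N : set (borel M)) (fun p => (F p)%:E).
  by apply: integrableS => // p [].
have toDm (F : M -> R) : measurable_fun (K : set (borel M)) F ->
    measurable_fun (K `\` N : set (borel M)) F.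
  by apply: measurable_funS; [exact: mK|move=> p []].
(* Off [N], |nabla rho| equals V^(lambda-mu), so by Cauchy-Schwarz the pairing is dominated by the
   integrable norm of [G] times a continuous weight. *)
have int_rho (f : M -> R) (G : vector_field M) (w : M -> R) : is_weak_grad g f G ->
    (forall p, O p -> {for p, continuous w}) ->
    vol.-integrable (K `\` N : set (borel M)) (fun p => (w p * inner g (G p) (Grho p))%:E).
  move=> wG cw.
  have csV p : O p -> {for p, continuous (fun p => V p `^ (lambda - mu))}.
    by move=> _; exact: cV.
  have iG := toD _ (weight_integrable oO cphi phiO (weightM cw csV)
    (integrable_rnorm vol_g M_noncompact wG cphi)).
  apply: (le_integrable mD _ _ iG).
    apply/measurable_EFinP.
    apply: toDm; apply: measurable_funM; first exact: (weight_measurable oO phiO cw).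
    exact: measurable_inner wG wr cphi.
  move=> p [_ Np]; rewrite !abse_EFin lee_fin !normrM -mulrA ler_wpM2l//.
  have V0' b : 0 < V p `^ b by exact: powR_gt0.
  have -> : `|V p `^ (lambda - mu)| = rnorm g (Grho p).
    rewrite gtr0_norm//; apply: (mulfI (lt0r_neq0 (V0' (mu - lambda)))).
    rewrite -powRD_gt0// (_ : mu - lambda + _ = 0); last by ring.
    rewrite powRr0; apply/esym/eqP.
    rewrite -(@eqrXn2 _ 2)// ?mulr_ge0 ?sqrtr_ge0 ?(ltW (V0' _))//.
    by rewrite exprMn sqr_sqrtr ?inner_ge0// expr1n expr2 -mulrA unitN.
  rewrite (le_trans (inner_le_rnorm _ _ _))// mulrC ler_wpM2l ?sqrtr_ge0//.
  exact: ler_norm.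
have int_phi (f : M -> R) (G : vector_field M) (w : M -> R) : is_weak_grad g f G ->
    (forall p, O p -> {for p, continuous w}) ->
    vol.-integrable (K `\` N : set (borel M)) (fun p => (w p * inner g (G p) (gphi p))%:E).
  move=> wG cw; apply/toD/(weight_integrable oO cphi phiO cw).
  exact: (integrable_inner_smooth vol_g M_noncompact wG sphi cphi).
have iT0 := int_phi _ _ _ wgphi c0.
have iT1 : vol.-integrable (K `\` N : set (borel M)) (fun p => (T1 p)%:E).
  exact/toD/(weight_integrable oO cphi phiO c1 i1).
have iT2 := int_rho _ _ _ wa c2.
have iZ := int_phi _ _ _ wr cz.
have iX : vol.-integrable (K `\` N : set (borel M)) (fun p => (X p)%:E).
  by apply: integrableD_EFin => //; [exact: int_rho wd cx|exact: int_phi wd cy].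
have mdd := measurable_inner wd wd cphi.
(* For the squared gradient of delta only measurability is established here; integrability is
   supplied inside [hardy_integrals]. *)
have mT3 : measurable_fun (K `\` N : set (borel M)) T3.
  apply: toDm; exact: (measurable_funM (weight_measurable oO phiO c3) mdd).
have T3_ge0 p : (K `\` N) p -> 0 <= T3 p.
  move=> _; rewrite /T3 /w3 /q /m -!expr2; apply: mulr_ge0; last exact: inner_ge0.
  apply: mulr_ge0; last exact: powR_ge0.
  do 3!(apply: mulr_ge0; last exact: sqr_ge0).
  by apply: mulr_ge0; [exact: a0|exact: powR_ge0].
have supp := integral_support_weight oO cphi phiO mN N0.
have m_1 : measurable_fun (K : set (borel M)) (fun=> 1 : R) by exact: measurable_cst.
have gradD_sqr (G : vector_field M) p :
    rnorm g (gradD G p) ^+ 2 = s p * (s p * inner g (G p) (G p)).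
  by rewrite /rnorm sqr_sqrtr ?inner_ge0// /gradD /affine_grad innerZl innerZr.
rewrite (supp _ w1 (fun=> 1) c1 m_1); last 2 first.
- by move=> p _; rewrite /w1 -/(q p) -/(m1 p) mulr1 expr2.
- by move=> p /phi0 ->; rewrite expr0n/= mulr0 mul0r.
rewrite (supp _ w2 (fun p => inner g (Ga p) (Grho p)) c2); last 3 first.
- exact: (measurable_inner wa wr cphi).
- move=> p /phiO Op; rewrite /gradD /affine_grad innerZl innerZr -/(s p) /w2 -/(m1 p) -ssm.
  by rewrite (powR_sub2_mul alpha (rho_gt0 _ Op)) -/(q p); ring.
- by move=> p /phi0 ->; rewrite expr0n/= mulr0 !mul0r.
rewrite (supp _ w3 (fun p => inner g (Gdelta p) (Gdelta p)) c3 mdd); last 2 first.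
- move=> p /phiO Op; rewrite gradD_sqr /w3 -/(m1 p) -ssm !expr2 invfM.
  by rewrite (powR_sub2_sqr alpha (rho_gt0 _ Op)) -/(q p); ring.
- by move=> p /phi0 ->; rewrite expr0n/= mulr0 !mul0r.
rewrite (supp _ w0 (fun p => inner g (gphi p) (gphi p)) c0); last 3 first.
- exact: (measurable_inner wgphi wgphi cphi).
- move=> p /phiO Op; rewrite gradD_sqr /w0 -/(m1 p) -ssm.
  by rewrite (powR_sub2_sqr alpha (rho_gt0 _ Op)) -/(q p); ring.
- move=> p Kp; rewrite gradD_sqr; have -> : grad g phi p = 0 := gphi0 p Kp.
  by rewrite /inner !mul0mx mxE !mulr0 mul0r.
apply: (hardy_integrals mD (C := C) k0 iT0 iT1 iT2 iZ iX mT3 T3_ge0 sq).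
  (* The case of psi1. The power of rho is regular where rho is positive, hence on the support of
     phi. *)
  have reg p : K p -> C1_at idfun (fun=> 1) (a p) /\
      C1_at (fun x : R => x `^ (alpha - 1))
        (fun x : R => (alpha - 1) * x `^ (alpha - 1 - 1)) (rho p).
    move=> /phiO Op; split; first exact: C1_at_id.
    by apply: C1_at_powR; exact: rho_gt0.
  have wpsi := test_product_weak_grad la wa lr wr sphi reg.
  have tpsi : test_on g O (test_product a rho phi idfun (fun x : R => x `^ (alpha - 1))).
    split.
    - move=> p; rewrite /test_product -expr2 mulr_ge0 ?sqr_ge0// mulr_ge0 ?powR_ge0//.
      exact: a0.
    - exact: (test_product_rlipschitz la lr sphi cphi reg).
    - exact: test_product_compact.
    - exact: (subset_trans (@test_product_support _ _ _ _ _ _ _ _) phiO).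
  have := lap _ _ tpsi wpsi.
  set Gpsi := test_product_grad _ _ _ _ _ _ _ _ _ _.
  rewrite (supp _ (fun p => C * w1 p) (fun=> 1) (weightM (cc C) c1) m_1); last 2 first.
  - move=> p /phiO Op; rewrite /test_product /w1 -/(m1 p).
    rewrite (powR_sub2_mul alpha (rho_gt0 _ Op)) -/(q p) /=; field; exact: Op.
  - by move=> p /phi0 phip; rewrite /test_product phip !mulr0 mul0r.
  rewrite (supp _ m (fun p => inner g (Gpsi p) (Grho p)) Om); last 3 first.
  - exact: (measurable_inner wpsi wr cphi).
  - by move=> p _; rewrite /affine_grad innerZr -/(s p) -smt; ring.
  - move=> p /phi0 phip; rewrite /Gpsi /test_product_grad !innerDl !innerZl phip.
    by rewrite !mulr0 !mul0r !addr0 mul0r.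
  have -> : (\int[vol]_(p in K `\` N) (C * w1 p * 1)%:E =
      \int[vol]_(p in K `\` N) (C * T1 p)%:E)%E.
    by apply: eq_integral => p _; rewrite /T1 mulrA.
  have -> // : (\int[vol]_(p in K `\` N) (m p * inner g (Gpsi p) (Grho p))%:E =
      \int[vol]_(p in K `\` N) (T2 p + (2 * k - C) * T1 p + Z p)%:E)%E.
  (* The three terms of the gradient of psi1 give [T2], (alpha - 1) [T1] and [Z]; and alpha - 1 is
     2k - C. *)
  apply: eq_integral => p /set_mem[/phiO Op Np]; congr (_%:E).
  rewrite /Gpsi /test_product_grad !innerDl !innerZl.
  rewrite (_ : alpha - 1 - 1 = alpha - 2); last by ring.
  rewrite (powR_sub2_mul alpha (rho_gt0 _ Op)) -/(q p) (innerC g (grad g phi p)).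
  rewrite /T2 /T1 /Z /w2 /w1 /wz (m1E _ Np) /k /gphi /=.
  move: (inner g (Ga p) (Grho p)) (inner g (Grho p) (Grho p))
    (inner g (Grho p) (grad g phi p)) => x y z; by field.
(* The case of psi2, with 1/delta written as a power and 2k as C + alpha - 1. Differentiating
   1/delta yields - [T3]; the other two factors yield the two halves of [X]. *)
have reg p : K p -> C1_at (fun x : R => x `^ (- 1)) (fun x : R => (- 1) * x `^ (- 1 - 1))
    (delta p) /\ C1_at (fun x : R => x `^ (C + alpha - 1))
      (fun x : R => (C + alpha - 1) * x `^ (C + alpha - 1 - 1)) (rho p).
  move=> /phiO Op; split; apply: C1_at_powR; first exact: d0.
  exact: rho_gt0.
have wpsi := test_product_weak_grad ld wd lr wr sphi reg.
have tpsi : test_on g O (test_product delta rho phi (fun x : R => x `^ (- 1))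
    (fun x : R => x `^ (C + alpha - 1))).
  split.
  - by move=> p; rewrite /test_product -expr2 mulr_ge0 ?sqr_ge0// mulr_ge0 ?powR_ge0.
  - exact: (test_product_rlipschitz ld lr sphi cphi reg).
  - exact: test_product_compact.
  - exact: (subset_trans (@test_product_support _ _ _ _ _ _ _ _) phiO).
have := div _ _ tpsi wpsi.
set Gpsi := test_product_grad _ _ _ _ _ _ _ _ _ _.
rewrite (supp _ (fun p => a p * rho p `^ (1 - C) * m p)
  (fun p => inner g (Gdelta p) (Gpsi p)) (weightM (weightM Oa (cR (1 - C))) Om)); last 3 first.
- exact: (measurable_inner wd wpsi cphi).
- by move=> p _; rewrite /affine_grad innerZl -/(s p) -smt; ring.
- move=> p /phi0 phip; rewrite /Gpsi /test_product_grad !innerDr !innerZr phip.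
  by rewrite !mulr0 !mul0r !addr0 !mulr0 mul0r.
suff -> : (\int[vol]_(p in K `\` N)
    (a p * rho p `^ (1 - C) * m p * inner g (Gdelta p) (Gpsi p))%:E =
    \int[vol]_(p in K `\` N) (X p - T3 p)%:E)%E by [].
apply: eq_integral => p /set_mem[/phiO Op _]; congr (_%:E).
have r0 := rho_gt0 _ Op.
rewrite /Gpsi /test_product_grad !innerDr !innerZr (powRV (d0 p)) (powRV2 (d0 p)).
(* The factor rho^(1-C) of the divergence condition cancels C in the exponents, leaving rho^alpha
   and rho^(alpha-1). *)
have E1 : rho p `^ (1 - C) * rho p `^ (C + alpha - 1) = q p * (rho p * rho p).
  by rewrite /q -(powR_sub2_sqr alpha r0) -(powRD_gt0 _ _ r0); congr (_ `^ _); ring.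
have E2 : rho p `^ (1 - C) * rho p `^ (C + alpha - 1 - 1) = q p * rho p.
  by rewrite /q -(powR_sub2_mul alpha r0) -(powRD_gt0 _ _ r0); congr (_ `^ _); ring.
rewrite /X /T3 /wx /wy /w3 /k /gphi.
move: (inner g (Gdelta p) (Gdelta p)) (inner g (Gdelta p) (Grho p))
  (inner g (Gdelta p) (grad g phi p)) (delta p)^-1 E1 E2.
move: (rho p `^ (1 - C)) (rho p `^ (C + alpha - 1)) (rho p `^ (C + alpha - 1 - 1)).
move=> A P P' x y z d E1 E2.
(* Regrouping so that the powers of rho occur only in the products rewritten by [E1] and [E2]. *)
transitivity (a p * m p * (phi p * phi p) *
    (- (A * P) * (d * d) * x + (A * P') * (C + alpha - 1) * d * y) +
    2 * a p * m p * (A * P) * phi p * d * z); first by ring.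
by rewrite E1 E2; field.
Qed.
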